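(* Let $\Omega$ be a star graph with $n$ edges $\epsilon_i\cong[0,\ell_i]$, let $V_i\in L^1(0,\ell_i)$ be real-valued for $1\le i\le n$, and let $\Gamma=\{\alpha_1,\alpha_2,\beta_1,\beta_2\}$ be separated self-adjoint boundary conditions with $\beta_1,\beta_2$ diagonal. Suppose $\Omega$ is split into three subgraphs $\Omega_1,\tilde\Omega_1,\tilde\Omega_2$ by first splitting $\Omega$ at a non-vertex point $x_j=s_1$ into $\Omega_1$ and $\Omega_2$, and then splitting $\Omega_2$ at a non-vertex point $x_i=s_2$ into $\tilde\Omega_1$ and $\tilde\Omega_2$ (either on the same wire, $i=j$ and $0<s_2<s_1<\ell_j$, or on different wires, $i\ne j$), with boundary conditions $\Gamma_1,\tilde\Gamma_1,\tilde\Gamma_2$ that agree with $\Gamma$ at the original vertices and are Dirichlet at the splitting points. For $\lambda\in\mathbb R$ let $\mathcal N_X(\lambda)$ be the number of eigenvalues (counted with multiplicity) of an operator $X$ that are less than or equal to $\lambda$, and let $N(\lambda)$ be the difference between the number of zeros and the number of poles (counted with multiplicity) less than or equal to $\lambda$ of $\det(\mathcal M_1+\mathcal M_2)$, regarded as a meromorphic function, where $\mathcal M_1+\mathcal M_2$ is the two-sided map associated with $s_1$ and $s_2$. Then $$\mathcal N_{H^\Omega_\Gamma}(\lambda)=\mathcal N_{H^{\Omega_1}_{\Gamma_1}}(\lambda)+\mathcal N_{H^{\tilde\Omega_1}_{\tilde\Gamma_1}}(\lambda)+\mathcal N_{H^{\tilde\Omega_2}_{\tilde\Gamma_2}}(\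lambda)+N(\lambda).$$
   Context: **Star graph and functions.** $\Omega$ has $n\ge1$ edges; edge $\epsilon_i$ has coordinate $x_i\in[0,\ell_i]$, $\ell_i>0$, where $x_i=0$ is the common vertex (origin) of all edges. A function on $\Omega$ is a vector $\vec u=(u_1,\dots,u_n)$ with $u_i$ a function of $x_i$; $\vec u'=(u_1',\dots,u_n')$; $\vec u(\vec 0)=(u_i(0))_i$ and $\vec u(\vec\ell)=(u_i(\ell_i))_i$. **Boundary conditions.** $\Gamma=\{\alpha_1,\alpha_2,\beta_1,\beta_2\}$ consists of complex $n\times n$ matrices with $\operatorname{rank}[\alpha_1\ \alpha_2]=\operatorname{rank}[\beta_1\ \beta_2]=n$, $\alpha_1\alpha_2^*=\alpha_2\alpha_1^*$, $\beta_1\beta_2^*=\beta_2\beta_1^*$, and $\beta_1=\operatorname{diag}(g_1,\dots,g_n)$, $\beta_2=\operatorname{diag}(h_1,\dots,h_n)$. A function $\vec u$ satisfies $\Gamma$ if $\alpha_1\vec u(\vec 0)+\alpha_2\vec u'(\vec 0)=\vec 0$ and $\beta_1\vec u(\vec\ell)+\beta_2\vec u'(\vec\ell)=\vec 0$. **Operators.** $H^\Omega=\operatorname{diag}(-\partial_{x_i}^2+V_i(x_i))$ is a differential expression; $H^{\Omega^*}$ is its restriction to a subgraph $\Omega^*$. Solutions of $(H^{\Omega^*}-\lambda)\vec u=\vec 0$ are understood with $u_i,u_i'$ absolutely continuous on the closed edge and the equation holding a.e. For boundary conditions $\Gamma_0$ on $\Omega^*$, $H^{\Omega^*}_{\Gamma_0}$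 is the operator $\vec u\mapsto H^{\Omega^*}\vec u$ in $L^2(\Omega^* )$ with domain the functions satisfying $\Gamma_0$ such that $u_i,u_i'$ are absolutely continuous and $-u_i''+V_iu_i\in L^2$ (this is $u_i\in H^2$ when $V_i\in L^2$). Its spectrum is discrete; $\rho(\cdot)$ denotes the resolvent set. **The splitting.** $\Omega_1=[s_1,\ell_j]\subset\epsilon_j$, $0<s_1<\ell_j$, and $\Omega_2$ is the star graph with $\epsilon_j$ shortened to $[0,s_1]$. Next, $\Omega_2$ is split at a non-vertex point $x_i=s_2$, with the origin in $\tilde\Omega_2$: - Same wire ($i=j$, $0<s_2<s_1$): $\tilde\Omega_1=[s_2,s_1]\subset\epsilon_j$, and $\tilde\Omega_2$ is the star graph with $\epsilon_j$ shortened to $[0,s_2]$. - Different wires ($i\ne j$, $0<s_2<\ell_i$): $\tilde\Omega_1=[s_2,\ell_i]\subset\epsilon_i$, and $\tilde\Omega_2$ is the star graph with $\epsilon_j$ shortened to $[0,s_1]$ and $\epsilon_i$ shortened to $[0,s_2]$. **Boundary conditions on the pieces.** $\Gamma_1$ on $\Omega_1$: $u(s_1)=0$ and $g_ju(\ell_j)+h_ju'(\ell_j)=0$. $\tilde\Gamma_1$ on $\tilde\Omega_1$: same wire: $u(s_2)=u(s_1)=0$; different wires: $u(s_2)=0$ and $g_iu(\ell_i)+h_iu'(\ell_i)=0$. $\tilde\Gamma_2$ on $\tilde\Omega_2$: $\alpha_1\vec u(\vec 0)+\alpha_2\vec u'(\vec 0)=\vec 0$; $g_ku_k(\ell_k)+h_ku_k'(\ell_k)=0$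 on each edge $k$ that is not shortened; and the Dirichlet condition at the splitting point that ends each shortened edge ($u_j(s_2)=0$ for same wire; $u_j(s_1)=0$ and $u_i(s_2)=0$ for different wires). **Two-sided map, same wire.** For $\lambda\in\rho(H^{\Omega_1}_{\Gamma_1})\cap\rho(H^{\tilde\Omega_1}_{\tilde\Gamma_1})\cap\rho(H^{\tilde\Omega_2}_{\tilde\Gamma_2})$ and $\vec f=(f_1,f_2)\in\mathbb C^2$: $\mathcal M_1(\lambda)\vec f=(u'(s_1),-u'(s_2))^t$, where $u$ solves $(H^{\tilde\Omega_1}-\lambda)u=0$ on $[s_2,s_1]$ with $u(s_1)=f_1$, $u(s_2)=f_2$. $\mathcal M_2(\lambda)\vec f=(-u'(s_1),w_j'(s_2))^t$, where $u$ solves $(H^{\Omega_1}-\lambda)u=0$ with $u(s_1)=f_1$ and the $\Gamma_1$ condition at $\ell_j$, and $\vec w$ solves $(H^{\tilde\Omega_2}-\lambda)\vec w=\vec 0$ with $w_j(s_2)=f_2$ and all other $\tilde\Gamma_2$ conditions. **Two-sided map, different wires.** For the same $\lambda$ and $\vec f$: $\mathcal M_1(\lambda)\vec f=(-u'(s_1),-w'(s_2))^t$, where $u$ solves $(H^{\Omega_1}-\lambda)u=0$ with $u(s_1)=f_1$ and the $\Gamma_1$ condition at $\ell_j$, and $w$ solves $(H^{\tilde\Omega_1}-\lambda)w=0$ with $w(s_2)=f_2$ and the $\tilde\Gamma_1$ condition at $\ell_i$. $\mathcal M_2(\lambda)\vec f=(u_j'(s_1),u_i'(s_2))^t$, where $\vec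 u$ solves $(H^{\tilde\Omega_2}-\lambda)\vec u=\vec 0$ with $u_j(s_1)=f_1$, $u_i(s_2)=f_2$ and all other $\tilde\Gamma_2$ conditions. In both cases these problems have unique solutions, $\mathcal M_1,\mathcal M_2$ are $2\times2$ matrices, and $\det(\mathcal M_1+\mathcal M_2)$ extends to a meromorphic function of $\lambda\in\mathbb C$. *)

(* Defs.v *)
From HB Require Import structures.
From mathcomp Require Import all_boot all_order all_algebra.
From mathcomp Require Import complex.
From mathcomp Require Import all_classical all_reals all_analysis.
Set Implicit Arguments.
Unset Strict Implicit.
Unset Printing Implicit Defensive.
Import Order.TTheory GRing.Theory Num.Theory.
Import numFieldNormedType.Exports.

Local Open Scope classical_set_scope.
Local Open Scope ring_scope.
Local Open Scope complex_scope.
Local Open Scope sesquilinear_scope.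

(* Packing R[i] as a numClosedFieldType gives it the topology and the normed
   module structure that MathComp-Analysis puts on any numFieldType. *)
Definition Cx (R : realType) : numClosedFieldType := R[i].

Definition cplx (R : realType) (x : R) : Cx R := x%:C.

Definition abs_cont (R : realType) (a b : R) (f : R -> Cx R) : Prop :=
  forall e : R, 0 < e -> exists2 d : R, 0 < d &
    forall (m : nat) (x y : 'I_m -> R),
      (forall k, [&& a <= x k, x k <= y k & y k <= b]) ->
      (forall k k', k != k' -> (y k <= x k') || (y k' <= x k)) ->
      \sum_k (y k - x k) < d ->
      \sum_k `|f (y k) - f (x k)| < cplx e.

(* f has derivative d at x relative to [a, b]: one-sided at a and at b. *)
Definition has_deriv (R : realType) (a b : R) (f : R -> Cx R) (x : R)
    (d : Cx R) : Prop :=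
  (fun y : R => (f y - f x) / cplx (y - x))
    @ within [set y | a <= y <= b] x^' --> d.

(* A function on a graph with m edges. Only the values on the edges matter:
   each statement below looks at u k only on the k-th edge. *)
Definition gfun (R : realType) (m : nat) := 'I_m -> R -> Cx R.

(* A Schroedinger operator with separated boundary conditions: the k-th edge is
   [lo k, hi k] with potential pot k, and the conditions are
   al1 u(lo) + al2 u'(lo) = 0 and be1 u(hi) + be2 u'(hi) = 0. Star graphs have
   lo = 0; a single interval is the case m = 1. *)
Record schroedinger (R : realType) (m : nat) := Schroedinger {
  lo : 'I_m -> R;
  hi : 'I_m -> R;
  pot : 'I_m -> R -> R;
  al1 : 'M[Cx R]_m;
  al2 : 'M[Cx R]_m;
  be1 : 'M[Cx R]_m;
  be2 : 'M[Cx R]_m }.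

Section Operators.
Context {R : realType} {m : nat}.
Variable X : schroedinger R m.
Implicit Types (u du f : gfun R m) (z : Cx R).

Definition on_edge (k : 'I_m) : set R := [set x | lo X k <= x <= hi X k].

(* du is u', and both are absolutely continuous on the closed edges. *)
Definition regular u du : Prop :=
  forall k, [/\ abs_cont (lo X k) (hi X k) (u k),
                abs_cont (lo X k) (hi X k) (du k) &
                forall x, on_edge k x ->
                  has_deriv (lo X k) (hi X k) (u k) x (du k x)].

(* - u'' + V u = f almost everywhere on each edge. *)
Definition diff_expr u du f : Prop :=
  forall k, {ae (@lebesgue_measure R), forall x : R, on_edge k x ->
    exists2 d2 : Cx R, has_deriv (lo X k) (hi X k) (du k) x d2 &
      - d2 + cplx (pot X k x) * u k x = f k x}.

(* The boundary conditions with right-hand sides c and d. *)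
Definition bc u du (c d : 'cV[Cx R]_m) : Prop :=
  al1 X *m (\col_k u k (lo X k)) + al2 X *m (\col_k du k (lo X k)) = c /\
  be1 X *m (\col_k u k (hi X k)) + be2 X *m (\col_k du k (hi X k)) = d.

(* (H - z) u = 0 with inhomogeneous boundary conditions. *)
Definition bvp z (c d : 'cV[Cx R]_m) u du : Prop :=
  [/\ regular u du, diff_expr u du (fun k x => z * u k x) & bc u du c d].

Definition sqnorm f : \bar R :=
  (\sum_k \int[@lebesgue_measure R]_(x in on_edge k)
     ((complex.Re (f k x)) ^+ 2 + (complex.Im (f k x)) ^+ 2)%:E)%E.

Definition inL2 f : Prop :=
  (forall k, measurable_fun (on_edge k) (fun x => complex.Re (f k x)) /\
             measurable_fun (on_edge k) (fun x => complex.Im (f k x))) /\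
  (sqnorm f < +oo)%E.

(* The graph of the operator in L^2: u is in the domain and H u = f. *)
Definition op u f : Prop :=
  inL2 f /\ exists du, [/\ regular u du, diff_expr u du f & bc u du 0 0].

(* (H - z) u = f *)
Definition op_sub z u f : Prop := op u (fun k x => f k x + z * u k x).

(* H - z maps its domain onto L^2 and has a bounded inverse; the bound
   contains injectivity. *)
Definition resolvent z : Prop :=
  (forall f, inL2 f -> exists u, op_sub z u f) /\
  exists K : R, forall u f, inL2 f -> op_sub z u f ->
    (sqnorm u <= K%:E * sqnorm f)%E.

Definition eigenspace_at z u : Prop := op u (fun k x => z * u k x).

(* The eigenspace of z has dimension d (d = 0 if z is not an eigenvalue). *)
Definition eigen_mult z (d : nat) : Prop :=
  exists e : 'I_d -> gfun R m,
    [/\ forall p, eigenspace_at z (e p),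
        forall c : 'I_d -> Cx R,
          (forall k x, on_edge k x -> \sum_p c p * e p k x = 0) ->
          forall p, c p = 0 &
        forall u, eigenspace_at z u -> exists c : 'I_d -> Cx R,
          forall k x, on_edge k x -> u k x = \sum_p c p * e p k x].

End Operators.

(* N is the number of points t <= lam, each counted with its multiplicity; in
   particular there are finitely many of them. *)
Definition count_le (R : realType) (mult : R -> nat -> Prop) (lam : R)
    (N : nat) : Prop :=
  exists m : R -> nat,
    let S := [set t | t <= lam /\ m t != 0%N] in
    [/\ forall t, t <= lam -> mult t (m t), finite_set S &
        N = \big[addn/0%N]_(t \in S) m t].

Definition eigen_count (R : realType) (m : nat) (X : schroedinger R m)
    (lam : R) (N : nat) : Prop :=
  count_le (fun t => eigen_mult X (cplx t)) lam N.

Section Meromorphic.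
Context {R : realType}.
Implicit Types (F g : Cx R -> Cx R) (z : Cx R) (d : int).

Definition holomorphic_at g z : Prop :=
  \forall w \near z, derivable (g : Cx R -> (Cx R)^o) w 1.

(* F(w) = (w - z)^d g(w) for w <> z near z, with g holomorphic at z. *)
Definition laurent_at F z d g : Prop :=
  holomorphic_at g z /\ \forall w \near z^', F w = (w - z) ^ d * g w.

Definition meromorphic F : Prop := forall z, exists d g, laurent_at F z d g.

(* d > 0: zero of multiplicity d; d < 0: pole of multiplicity - d. *)
Definition order_at F z d : Prop := exists2 g, laurent_at F z d g & g z != 0.

Definition zero_mult F z (k : nat) : Prop :=
  exists2 d, order_at F z d & k = `|Num.max d 0|%N.

Definition pole_mult F z (k : nat) : Prop :=
  exists2 d, order_at F z d & k = `|Num.max (- d) 0|%N.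

(* N = #zeros - #poles of F in ]-oo, lam] *)
Definition zero_pole_count F (lam : R) (N : int) : Prop :=
  exists nz np : nat,
    [/\ count_le (fun t => zero_mult F (cplx t)) lam nz,
        count_le (fun t => pole_mult F (cplx t)) lam np &
        N = nz%:Z - np%:Z].

End Meromorphic.

Definition selfadjoint_bc (R : realType) (n : nat) (A B : 'M[Cx R]_n) : Prop :=
  \rank (row_mx A B) = n /\ A *m B^t* = B *m A^t*.

Section Splitting.
Context {R : realType} {n : nat}.
Variables (l : 'I_n -> R) (V : 'I_n -> R -> R).
Variables (alpha1 alpha2 : 'M[Cx R]_n) (g h : 'rV[Cx R]_n).
Variables (i j : 'I_n) (s1 s2 : R).

Definition star_op : schroedinger R n :=
  Schroedinger (fun=> 0) l V alpha1 alpha2 (diag_mx g) (diag_mx h).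

(* The interval [a, b] of edge k with u(a) = 0 and p u(b) + q u'(b) = 0. *)
Definition interval_op (k : 'I_n) (a b : R) (p q : Cx R) : schroedinger R 1 :=
  Schroedinger (fun=> a) (fun=> b) (fun=> V k) 1%:M 0 p%:M q%:M.

Definition Omega1_op : schroedinger R 1 :=
  interval_op j s1 (l j) (g 0 j) (h 0 j).

Definition tOmega1_op : schroedinger R 1 :=
  if i == j then interval_op i s2 s1 1 0
  else interval_op i s2 (l i) (g 0 i) (h 0 i).

(* Edge i ends at s2 and, if j <> i, edge j ends at s1. On these edges the
   end condition is 1 u + 0 u' = 0. *)
Definition tOmega2_op : schroedinger R n :=
  let cut k := (k == i) || (k == j) in
  Schroedinger (fun=> 0)
    (fun k => if k == i then s2 else if k == j then s1 else l k) V
    alpha1 alpha2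
    (diag_mx (\row_k if cut k then 1 else g 0 k))
    (diag_mx (\row_k if cut k then 0 else h 0 k)).

Definition vec2 (x y : Cx R) : 'cV[Cx R]_2 :=
  \col_(k < 2) if k == 0 then x else y.

(* In the problems below, row k of the right-hand side at the far ends belongs
   to the end condition of edge k: on a cut edge it prescribes u_k there. *)

Definition M1_same (z : Cx R) (M : 'M[Cx R]_2) : Prop :=
  forall f1 f2 : Cx R, exists u du : gfun R 1,
    bvp tOmega1_op z f2%:M f1%:M u du /\
    M *m vec2 f1 f2 = vec2 (du 0 s1) (- du 0 s2).

Definition M2_same (z : Cx R) (M : 'M[Cx R]_2) : Prop :=
  forall f1 f2 : Cx R, exists (u du : gfun R 1) (w dw : gfun R n),
    [/\ bvp Omega1_op z f1%:M 0 u du,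
        bvp tOmega2_op z 0 (f2 *: delta_mx j 0) w dw &
        M *m vec2 f1 f2 = vec2 (- du 0 s1) (dw j s2)].

Definition M1_diff (z : Cx R) (M : 'M[Cx R]_2) : Prop :=
  forall f1 f2 : Cx R, exists u du w dw : gfun R 1,
    [/\ bvp Omega1_op z f1%:M 0 u du,
        bvp tOmega1_op z f2%:M 0 w dw &
        M *m vec2 f1 f2 = vec2 (- du 0 s1) (- dw 0 s2)].

Definition M2_diff (z : Cx R) (M : 'M[Cx R]_2) : Prop :=
  forall f1 f2 : Cx R, exists u du : gfun R n,
    bvp tOmega2_op z 0 (f1 *: delta_mx j 0 + f2 *: delta_mx i 0) u du /\
    M *m vec2 f1 f2 = vec2 (du j s1) (du i s2).

Definition is_M1 := if i == j then M1_same else M1_diff.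
Definition is_M2 := if i == j then M2_same else M2_diff.

(* F is the meromorphic extension of det (M1 + M2). For z in the three resolvent
   sets the problems have unique solutions, so M1 and M2 are determined, and F
   is determined because the spectra are discrete. *)
Definition two_sided_det (F : Cx R -> Cx R) : Prop :=
  meromorphic F /\
  forall z, resolvent Omega1_op z -> resolvent tOmega1_op z ->
    resolvent tOmega2_op z ->
    exists M1 M2 : 'M[Cx R]_2,
      [/\ is_M1 z M1, is_M2 z M2 & F z = \det (M1 + M2)].

End Splitting.

(* Main.v *)
(* On edge k let u_k(., z) be the solution of - u'' + V_k u = z u with fixed real
   data at the far end that satisfy the far condition; it is a power series in z.
   Inserting the u_k into the conditions at the near ends yields a matrix A(z),
   entire in z, whose kernel is isomorphic to the eigenspace of z. By the
   Lagrange identity and the self-adjointness of the conditions det A has no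
   nonreal zeros, and at a real t, where the Wronskian of u_k with its
   z-derivative is positive, a zero of order exactly dim ker A(t). As u_k' / u_k
   at the near end tends to - oo with z, there are no zeros near - oo. So the
   zeros of det A are the eigenvalues, with multiplicities.

   At a cut, expand u_k in the solutions with data (0, 1) and (1, 0) there. By
   multilinearity of the determinant and Cramer's rule,
     det A_Omega = det A_Omega1 * det A_tOmega1 * det A_tOmega2 * det (M1 + M2),
   and comparing orders of vanishing at every t <= lam proves the theorem. *)
Require Import Defs.
From mathcomp Require Import all_boot all_order all_algebra.
From mathcomp Require Import perm complex ring lra zify finmap.
From mathcomp Require Import all_classical all_reals all_analysis measurable_realfun.
Set Implicit Arguments.
Unset Strict Implicit.
Unset Printing Implicit Defensive.
Import Order.TTheory GRing.Theory Num.Theory.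
Import numFieldNormedType.Exports.
Local Open Scope classical_set_scope.
Local Open Scope ring_scope.

(** * Real analysis and power series *)

(** As [V] is only integrable, u'' exists merely almost everywhere. Let [P] be a primitive of [V]
    and v = u' - P u. The equation becomes u' = P u + v, v' = - (P^2 + z) u - P v, whose
    coefficients are continuous. Hence the coefficients of the power series in z are differentiable
    real functions on the whole line, z enters only through the weights z^k, and inequalities
    between solutions follow from the mean value theorem. [V] itself comes back only when P u is
    differentiated almost everywhere. Uniqueness follows from the constancy of Wronskians. No Cauchy
    theory is used: divided differences of the power series are differentiated by hand, and the
    order of a zero of det A comes from linear algebra. What must be shown there is that ker A(t) is
    nondegenerate for A'(t); the Lagrange identity at the vertex reduces this to the positivity of
    the Wronskians on the single edges. *)

Section RealAnalysis.
Context {R : realType}.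
Implicit Types (f g h F G : R -> R) (a b c x y : R).
Notation mu := (@lebesgue_measure R).

Lemma is_derive_continuous f x d : is_derive x (1 : R) f d -> {for x, continuous f}.
Proof. by case=> + _; move=> /derivable1_diffP /differentiable_continuous. Qed.

Lemma is_derive_ext f g x d d' : is_derive x (1 : R) f d ->
  (forall y, f y = g y) -> d = d' -> is_derive x (1 : R) g d'.
Proof. by move=> fd /funext <- <-. Qed.

Lemma MVT_is_derive f (df : R -> R) a b :
  (forall x, is_derive x (1 : R) f (df x)) -> a <= b ->
  exists2 c, a <= c <= b & f b - f a = df c * (b - a).
Proof.
move=> fd ab; have [|c] := MVT_segment ab (fun x _ => fd x); last by exists c.
by apply: continuous_subspaceT => x; exact: is_derive_continuous (fd x).
Qed.

Lemma is_derive_nondecreasing f (df : R -> R) a b :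
  (forall x, is_derive x (1 : R) f (df x)) -> a <= b ->
  (forall x, a <= x <= b -> 0 <= df x) -> f a <= f b.
Proof.
move=> fd ab df0; rewrite -subr_ge0.
have [c cab ->] := MVT_is_derive fd ab.
by rewrite mulr_ge0 ?subr_ge0 ?df0.
Qed.

Lemma is_derive_lipschitz f (df : R -> R) a b m :
  (forall x, is_derive x (1 : R) f (df x)) ->
  (forall x, a <= x <= b -> `|df x| <= m) ->
  forall x y, a <= x <= b -> a <= y <= b -> `|f y - f x| <= m * `|y - x|.
Proof.
move=> fd dfm.
suff H x y : x <= y -> a <= x <= b -> a <= y <= b -> `|f y - f x| <= m * `|y - x|.
  move=> x y xab yab; case/orP: (le_total x y) => xy; first exact: H.
  by rewrite distrC (distrC y); apply: H.
move=> xy /andP[ax xb] /andP[ay yb].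
have [c /andP[xc cy] ->] := MVT_is_derive fd xy.
by rewrite normrM ler_wpM2r ?dfm// (le_trans ax xc) (le_trans cy yb).
Qed.

Lemma is_derive0_constant f : (forall x, is_derive x (1 : R) f 0) ->
  forall x y, f x = f y.
Proof.
move=> fd; suff H x y : x <= y -> f x = f y.
  by move=> x y; case/orP: (le_total x y) => xy; [exact: H | rewrite (H y x)].
move=> xy; have [c _ ] := MVT_is_derive (df := fun=> 0) fd xy.
by rewrite mul0r => /eqP; rewrite subr_eq0 => /eqP.
Qed.

(** One of the two intervals is always empty, so this is the signed integral from [c] to [x] on
    either side of [c]. *)
Definition prim c f x : R :=
  (\int[mu]_(t in `]c, x]) f t) - (\int[mu]_(t in `]x, c]) f t).

Lemma prim_base c f : prim c f c = 0.
Proof. by rewrite /prim subrr. Qed.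

Lemma continuous_itv_integrable f a b : continuous f ->
  mu.-integrable `[a, b] (EFin \o f).
Proof.
move=> cf; apply: continuous_compact_integrable; first exact: segment_compact.
exact: continuous_subspaceT.
Qed.

(** Integrals from one common left end are the form in which the fundamental theorem of calculus
    applies. *)
Lemma prim_split c f x a b : mu.-integrable `[a, b] (EFin \o f) ->
  a <= x <= b -> a <= c <= b ->
  prim c f x = (\int[mu]_(t in `[a, x]) f t) - (\int[mu]_(t in `[a, c]) f t).
Proof.
move=> fi /andP[ax xb] /andP[ac cb]; rewrite /prim.
have iS y : y <= b -> mu.-integrable `[a, y] (EFin \o f).
  move=> yb; apply: integrableS fi => //; apply: subset_itvl.
  by rewrite bnd_simp.
case: (leP c x) => [cx|/ltW xc].
  rewrite (@Rintegral_itvB _ f (BLeft a) (BRight x) c (iS _ xb)) ?bnd_simp//.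
  by rewrite [in X in _ - X]set_itv_ge ?bnd_simp -?leNgt// Rintegral_set0 subr0.
rewrite -[RHS]opprB.
rewrite (@Rintegral_itvB _ f (BLeft a) (BRight c) x (iS _ cb)) ?bnd_simp//.
by rewrite [in X in X - _]set_itv_ge ?bnd_simp -?leNgt// Rintegral_set0 sub0r.
Qed.

Lemma is_derive_prim c f x : continuous f -> is_derive x (1 : R) (prim c f) (f x).
Proof.
(* The margin 1 makes [x] an interior point of the interval, on whichever side of [c] it lies. *)
move=> cf; pose a := Num.min x c - 1; pose b := Num.max x c + 1.
have ax : a < x by rewrite ltrBlDr (@le_lt_trans _ _ x) ?ge_min ?lexx// ltrDl.
have ac : a <= c.
  by rewrite lerBlDr (@le_trans _ _ c) ?lerDl// ge_min lexx orbT.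
have xb : x < b by rewrite (@le_lt_trans _ _ (Num.max x c)) ?le_max ?lexx// ltrDl.
have cb : c <= b.
  by rewrite (@le_trans _ _ (Num.max x c)) ?lerDl// le_max lexx orbT.
pose G y := (\int[mu]_(t in `[a, y]) f t) - (\int[mu]_(t in `[a, c]) f t).
have fi := continuous_itv_integrable a b cf.
have [dG GE] := continuous_FTC1_closed xb fi ax (cf x).
apply: (@near_eq_is_derive _ _ _ G).
  near=> y; rewrite /G (prim_split fi) ?ac ?cb//.
  apply/andP; split; apply: ltW; near: y; [exact: lt_nbhsr|exact: lt_nbhsl].
rewrite -[f x]subr0; apply: is_deriveB.
by rewrite -GE derive1E; apply/derivableP.
Unshelve. all: by end_near. Qed.

End RealAnalysis.

(** * Term-by-term limits and derivatives of series with a geometric bound *)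

Section Series.
Context {R : realType}.
Implicit Types (u w : nat -> R) (F f : nat -> R -> R).

Lemma cvg_near_le (T : Type) (A : set_system T) {PA : ProperFilter A}
    (f : T -> R) (l M : R) :
  f @ A --> l -> (\forall t \near A, f t <= M) -> l <= M.
Proof.
move=> fl fM; rewrite -(cvg_lim (@Rhausdorff R) fl); apply: limr_le => //.
by apply/cvg_ex; exists l.
Qed.

Definition half_geom (C : R) u := forall k, `|u k| <= C * 2^-1 ^+ k.

Lemma half_geom_ge0 C u : half_geom C u -> 0 <= C.
Proof. by move=> /(_ 0%N); rewrite expr0 mulr1; exact: le_trans. Qed.

Lemma half_geom_cvg C u : half_geom C u -> cvgn (series u).
Proof.
move=> uC; apply: normed_cvg.
apply: (series_le_cvg (v_ := geometric C 2^-1)) => [n|n|n|] //=.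
- by rewrite mulr_ge0 ?(half_geom_ge0 uC)// exprn_ge0.
- by apply: is_cvg_geometric_series; rewrite ger0_norm ?invf_lt1 ?ltr1n.
Qed.

Lemma half_geom_tail C u n : half_geom C u ->
  `|limn (series u) - series u n| <= 2 * C * 2^-1 ^+ n.
Proof.
move=> uC; have C0 := half_geom_ge0 uC.
have cu := half_geom_cvg uC.
(* The exact geometric partial sum makes the induction close; dropping its second term leaves the
   tail bound. *)
have part m : `|series u (n + m)%N - series u n| <= 2 * C * (2^-1 ^+ n - 2^-1 ^+ (n + m)).
  elim: m => [|m IH]; first by rewrite addn0 !subrr normr0 mulr0.
  rewrite addnS seriesSr addrAC.
  apply: (le_trans (ler_normD _ _)).
  apply: (le_trans (lerD IH (uC _))).
  rewrite exprS le_eqVlt; apply/orP; left; apply/eqP; by field.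
have : (fun m => `|series u (n + m)%N - series u n|) @ \oo -->
    `|limn (series u) - series u n|.
  apply: cvg_norm; apply: cvgB; last exact: cvg_cst.
  by apply: cvg_comp cu; exact: cvg_addnl.
move=> cl; apply: (cvg_near_le cl).
apply: nearW => m; apply: (le_trans (part m)).
by rewrite ler_wpM2l ?mulr_ge0// gerBl exprn_ge0.
Qed.

Lemma half_geom_lim C u : half_geom C u -> `|limn (series u)| <= 2 * C.
Proof.
move=> uC; have := half_geom_tail 0 uC.
by rewrite /series/= big_geq// subr0 expr0 mulr1.
Qed.

(** Tannery's theorem: the common geometric bound makes the tails small uniformly in [t], and passes
    to [l] in the limit, so only a finite sum has to converge. *)
Lemma half_geom_uniform_lim (T : Type) (A : set_system T) {PA : ProperFilter A}
    (q : nat -> T -> R) (l : nat -> R) C :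
  (forall k, q k @ A --> l k) -> (\forall t \near A, half_geom C (q^~ t)) ->
  (fun t => limn (series (q^~ t))) @ A --> limn (series l).
Proof.
move=> ql qC.
have lC : half_geom C l.
  move=> k; apply: (cvg_near_le (cvg_norm (ql k))).
  by apply: filterS qC => t /(_ k).
have C0 := half_geom_ge0 lC.
apply/cvgrPdist_le => /= e e0.
have [n nP] : exists n, 2 * C * 2^-1 ^+ n <= e / 3.
  have : (fun n => 2 * C * 2^-1 ^+ n) @ \oo --> (0 : R).
    by apply: cvg_geometric; rewrite ger0_norm ?invf_lt1 ?ltr1n.
  move=> /cvgrPdist_le/(_ (e / 3)); rewrite divr_gt0// => /(_ isT)[n _ /(_ n)].
  move=> /(_ (leqnn n)); rewrite sub0r normrN ger0_norm; first by exists n.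
  by rewrite !mulr_ge0// exprn_ge0.
have sl : (fun t => series (q^~ t) n) @ A --> series l n.
  elim: (n) => [|m IH].
    by under eq_fun do rewrite /series/= big_geq//; rewrite /series/= big_geq//; exact: cvg_cst.
  by under eq_fun do rewrite seriesSr; rewrite seriesSr; apply: cvgD.
move/cvgrPdist_le : sl => /(_ (e / 3)); rewrite divr_gt0// => /(_ isT) sl.
near=> t.
have qt : half_geom C (q^~ t) by near: t.
have st : `|series l n - series (q^~ t) n| <= e / 3 by near: t.
have := le_trans (half_geom_tail n lC) nP.
have := le_trans (half_geom_tail n qt) nP.
rewrite distrC => h1 h2.
rewrite (_ : _ - _ = (limn (series l) - series l n)
  + (series l n - series (q^~ t) n)
  + (series (q^~ t) n - limn (series (q^~ t)))); last by ring.
apply: (le_trans (ler_normD _ _)).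
apply: (le_trans (lerD (ler_normD _ _) (lexx _))).
rewrite (_ : e = e / 3 + e / 3 + e / 3); last by field.
by rewrite lerD ?lerD.
Unshelve. all: by end_near. Qed.

Definition locally_half_geom F :=
  forall L : R, exists C, forall x : R, `|x| <= L -> half_geom C (F^~ x).

(** By the mean value theorem the difference quotients of [F k] obey the bound of [f k], so the
    limit h -> 0 passes through the sum. *)
Lemma is_derive_series F f :
  (forall k x, is_derive x (1 : R) (F k) (f k x)) ->
  locally_half_geom F -> locally_half_geom f ->
  forall x, is_derive x (1 : R) (fun y => limn (series (F^~ y)))
    (limn (series (f^~ x))).
Proof.
move=> Ff FC fC x.
have [C1 C1P] := FC (`|x| + 1); have [C2 C2P] := fC (`|x| + 1).
have xL : `|x| <= `|x| + 1 by rewrite lerDl.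
suff H : (fun h => h^-1 *: (limn (series (F^~ (h *: 1 + x))) -
       limn (series (F^~ x)))) @ 0^' --> limn (series (f^~ x)).
  apply: DeriveDef; first by apply/cvg_ex; eexists; exact: H.
  by rewrite /derive; apply: cvg_lim.
pose q k (h : R) := h^-1 * (F k (h + x) - F k x).
have nL : \forall h \near (0 : R)^', `|h + x| <= `|x| + 1.
  have : \forall h \near (0 : R), `|h| <= 1.
    apply/nbhs_normP; exists 1 => //= h /=.
    by rewrite sub0r normrN => /ltW.
  move=> /(nbhs_dnbhs (x := (0 : R))); apply: filterS => h h1.
  by rewrite addrC (le_trans (ler_normD _ _))// lerD2l.
apply: (@cvg_trans _ ((fun h => limn (series (q^~ h))) @ 0^')).
  apply: near_eq_cvg; near=> h.
  have hL : `|h + x| <= `|x| + 1 by near: h.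
  have c1 := half_geom_cvg (C1P _ hL).
  have c2 := half_geom_cvg (C1P _ xL).
  rewrite /= [h *: _]mulr1 -(lim_seriesB c1 c2) -lim_seriesZ.
    by congr (limn (series _)); apply/funext.
  exact: is_cvg_seriesB.
apply: (half_geom_uniform_lim (C := C2)).
  move=> k; case: (Ff k x) => /cvg_ex[/= l Hl] <-.
  rewrite /derive (cvg_lim _ Hl)//; apply: cvg_trans Hl; apply: near_eq_cvg.
  by near=> h; rewrite /q [h *: _]mulr1.
near=> h; move=> k; rewrite /q /=.
have hL : `|h + x| <= `|x| + 1 by near: h.
have h0 : h != 0 by near: h; exact: nbhs_dnbhs_neq.
rewrite normrM normfV ler_pdivrMl ?normr_gt0// mulrC.
have := @is_derive_lipschitz _ _ _ (- (`|x| + 1)) (`|x| + 1) (C2 * 2^-1 ^+ k) (Ff k) _ x (h + x).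
rewrite addrK; apply; rewrite -?ler_norml//.
by move=> y; rewrite -ler_norml => yL; exact: C2P.
Unshelve. all: by end_near. Qed.
End Series.

(** * Power series in a parameter and Picard iteration *)

Section Volterra.
Context {R : realType}.
Implicit Types (u w : nat -> R) (F G f : nat -> R -> R) (p : R -> R).

Lemma is_derive_translate_exp (c : R) k x :
  is_derive x (1 : R) (fun t : R => (t - c) ^+ k.+1 / k.+1%:R) ((x - c) ^+ k).
Proof.
have d1 : is_derive x (1 : R) (fun t : R => t - c) (1 : R).
  by rewrite -[X in is_derive _ _ _ X]subr0; apply: is_deriveB.
have d2 := @is_deriveX R R _ k.+1 _ _ _ d1.
have := @is_deriveZ _ _ _ _ k.+1%:R^-1 _ _ _ d2.
rewrite -[_ *: (_ *: _)]/(_ * (_ * _ * _)) mulr1 mulKf ?pnatr_eq0//=.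
congr (is_derive _ _ _ _); apply/funext => t /=.
by rewrite mulrC -[_ *: _]/(_ * _) exprfctE mulrC.
Qed.

Lemma continuous_locally_bounded p (L : R) : continuous p ->
  exists2 M, 0 <= M & forall x, `|x| <= L -> `|p x| <= M.
Proof.
move=> cp; have [L0|L0] := leP 0 L; last first.
  exists 0 => // x xL; have := le_lt_trans xL L0.
  by rewrite ltNge normr_ge0.
have LL : - L <= L by rewrite ge0_cp.
have cn : {within `[- L, L], continuous (fun x => `|p x|)}.
  apply: continuous_subspaceT => x.
  by apply: continuous_comp; [exact: cp | exact: norm_continuous].
have [c _ cP] := EVT_max LL cn; exists `|p c| => // x.
by rewrite ler_norml => xL; apply: cP; rewrite in_itv.
Qed.

(** On coefficient sequences of power series in z this is multiplication by z. *)
Definition lag F k x := if k is k'.+1 then F k' x else 0.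

(** The growth of weights such as t^k, their derivatives in t, and the parts Re z^k and Im z^k. *)
Definition subgeom w := exists K r : R, 0 <= r /\ forall k, `|w k| <= K * r ^+ k.

(** Infinite radius of convergence, locally uniformly in [x]; such a family can be summed against
    every [subgeom] weight. *)
Definition decays F := forall L r : R, 0 <= r ->
  exists C : R, forall k x, `|x| <= L -> `|F k x| * r ^+ k <= C.

(** For w_k = t^k this is the value at t of the power series with coefficients F_k(x). Other weights
    give its derivative in t, or its real and imaginary parts at a complex point. *)
Definition wsum w F x := limn (series (fun k => w k * F k x)).

Lemma decays_half_geom w F : subgeom w -> decays F ->
  locally_half_geom (fun k x => w k * F k x).
Proof.
move=> [K [r [r0 wK]]] dF L; have [C CP] := dF L (2 * r) (mulr_ge0 (ler0n _ _) r0).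
have K0 : 0 <= K by have := wK 0%N; rewrite expr0 mulr1; exact: le_trans.
exists (K * C) => x xL k.
rewrite normrM (le_trans (ler_wpM2r (normr_ge0 _) (wK k)))//.
rewrite -2!mulrA ler_wpM2l// mulrC.
rewrite (_ : r ^+ k = (2 * r) ^+ k * 2^-1 ^+ k); last first.
  by rewrite -exprMn mulrAC divff ?mul1r.
by rewrite mulrA ler_wpM2r ?CP// exprn_ge0.
Qed.

Lemma wsum_cvg w F x : subgeom w -> decays F ->
  cvgn (series (fun k => w k * F k x)).
Proof.
move=> sw dF; have [C CP] := decays_half_geom sw dF `|x|.
exact: half_geom_cvg (CP x (lexx _)).
Qed.

Lemma decaysD F G : decays F -> decays G -> decays (fun k x => F k x + G k x).
Proof.
move=> dF dG L r r0; have [C CP] := dF L r r0; have [D DP] := dG L r r0.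
exists (C + D) => k x xL; apply: (le_trans (ler_wpM2r _ (ler_normD _ _))).
  exact: exprn_ge0.
by rewrite mulrDl lerD ?CP ?DP.
Qed.

Lemma decaysM p F : continuous p -> decays F -> decays (fun k x => p x * F k x).
Proof.
move=> cp dF L r r0; have [C CP] := dF L r r0.
have [M M0 MP] := continuous_locally_bounded L cp.
exists (M * C) => k x xL; rewrite normrM -mulrA.
by rewrite ler_pM ?MP ?CP// mulr_ge0// exprn_ge0.
Qed.

Lemma decaysN F : decays F -> decays (fun k x => - F k x).
Proof.
by move=> dF L r r0; have [C CP] := dF L r r0; exists C => k x; rewrite normrN; exact: CP.
Qed.

Lemma decays_lag F : decays F -> decays (lag F).
Proof.
move=> dF L r r0; have [C CP] := dF L r r0; exists (`|C| * r) => -[|k] x xL /=.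
  by rewrite normr0 mul0r mulr_ge0.
by rewrite exprSr mulrA ler_wpM2r// (le_trans (CP _ _ xL))// ler_norm.
Qed.

Lemma wsumDr w F G x : subgeom w -> decays F -> decays G ->
  wsum w (fun k x => F k x + G k x) x = wsum w F x + wsum w G x.
Proof.
move=> sw dF dG; rewrite /wsum -lim_seriesD; try exact: wsum_cvg.
by congr (limn (series _)); apply/funext => k; rewrite mulrDr.
Qed.

Lemma wsumDl u w F x : subgeom u -> subgeom w -> decays F ->
  wsum (fun k => u k + w k) F x = wsum u F x + wsum w F x.
Proof.
move=> su sw dF; rewrite /wsum -lim_seriesD; try exact: wsum_cvg.
by congr (limn (series _)); apply/funext => k; rewrite mulrDl.
Qed.

Lemma wsumMr w p F x : subgeom w -> decays F ->
  wsum w (fun k x => p x * F k x) x = p x * wsum w F x.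
Proof.
move=> sw dF; rewrite /wsum -[RHS](@lim_seriesZ R); last exact: wsum_cvg.
by congr (limn (series _)); apply/funext => k; rewrite mulrCA.
Qed.

Lemma wsumMl a w F x : subgeom w -> decays F ->
  wsum (fun k => a * w k) F x = a * wsum w F x.
Proof.
move=> sw dF; rewrite /wsum -[RHS](@lim_seriesZ R); last exact: wsum_cvg.
by congr (limn (series _)); apply/funext => k; rewrite -mulrA.
Qed.

Lemma wsumNr w F x : subgeom w -> decays F ->
  wsum w (fun k x => - F k x) x = - wsum w F x.
Proof.
move=> sw dF; rewrite -mulN1r -(wsumMr (fun=> -1))//; congr (wsum w _ x).
by apply/funext => k; apply/funext => y; rewrite mulN1r.
Qed.

Lemma lim_series_shift u : u 0%N = 0 -> cvgn (series u) ->
  limn (series (fun k => u k.+1)) = limn (series u).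
Proof.
move=> u0 cu; apply/cvg_lim => //.
have -> : series (fun k => u k.+1) = (fun n => series u n.+1).
  by apply/funext => n; rewrite /series/= [RHS]big_nat_recl// u0 add0r.
by rewrite (cvg_shiftS (series u)).
Qed.

Lemma subgeom_shift w : subgeom w -> subgeom (fun k => w k.+1).
Proof.
move=> [K [r [r0 wK]]]; exists (K * r), r; split=> // k.
by rewrite -mulrA -exprS.
Qed.

Lemma wsum_lag w F x : subgeom w -> decays F ->
  wsum w (lag F) x = wsum (fun k => w k.+1) F x.
Proof.
move=> sw dF; rewrite /wsum.
rewrite -(@lim_series_shift (fun k => w k * lag F k x))//=; first by rewrite mulr0.
apply: wsum_cvg => //; exact: decays_lag.
Qed.

Lemma is_derive_wsum w F f x : subgeom w -> decays F -> decays f ->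
  (forall k x, is_derive x (1 : R) (F k) (f k x)) ->
  is_derive x (1 : R) (wsum w F) (wsum w f x).
Proof.
move=> sw dF df Ff.
by apply: is_derive_series (decays_half_geom sw dF) (decays_half_geom sw df) x.
Qed.

Lemma subgeom1 : subgeom (fun=> 1).
Proof. by exists 1, 1; split=> // k; rewrite expr1n mulr1 normr1. Qed.

(** On each side of [c] the difference between the bound and [s * F] is monotone and vanishes at
    [c]; the sign [s] treats the upper and the lower bound at once. *)
Lemma pow_bound (F f : R -> R) (c m L : R) n :
  (forall x, is_derive x (1 : R) F (f x)) -> F c = 0 -> `|c| <= L ->
  (forall x, `|x| <= L -> `|f x| <= m * `|x - c| ^+ n) ->
  forall x, `|x| <= L -> `|F x| <= m * `|x - c| ^+ n.+1 / n.+1%:R.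
Proof.
move=> Ff Fc; rewrite ler_norml => /andP[cL1 cL2] fm x.
rewrite ler_norml => /andP[xL1 xL2].
have side (s : R) : `|s| = 1 -> s * F x <= m * `|x - c| ^+ n.+1 / n.+1%:R.
  move=> s1.
  have sf t : `|t| <= L -> - (m * `|t - c| ^+ n) <= s * f t <= m * `|t - c| ^+ n.
    by move=> tL; rewrite -ler_norml normrM s1 mul1r; exact: fm.
  have [cx|/ltW xc] := leP c x.
    have D y : is_derive y (1 : R) (fun t => m * ((t - c) ^+ n.+1 / n.+1%:R) - s * F t)
       (m * (y - c) ^+ n - s * f y).
      apply: is_deriveB; apply: is_deriveZ.
      exact: is_derive_translate_exp.
    have := is_derive_nondecreasing D cx.
    rewrite Fc subrr expr0n/= mul0r !mulr0 subrr subr_ge0.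
    rewrite ger0_norm ?subr_ge0// mulrA; apply=> y /andP[cy yx].
    have yL : `|y| <= L by rewrite ler_norml (le_trans cL1 cy) (le_trans yx xL2).
    by have /andP[_] := sf y yL; rewrite subr_ge0 ger0_norm ?subr_ge0.
  (* Left of [c] the factor (-1)^n turns (t - c)^n into its absolute value. *)
  have D y : is_derive y (1 : R) (fun t => m * (-1) ^+ n * ((t - c) ^+ n.+1 / n.+1%:R) + s * F t)
       (m * (-1) ^+ n * (y - c) ^+ n + s * f y).
    apply: is_deriveD; apply: is_deriveZ.
    exact: is_derive_translate_exp.
  have := is_derive_nondecreasing D xc.
  rewrite Fc subrr expr0n/= mul0r !mulr0 addr0 => H.
  rewrite -subr_ge0 -oppr_le0 opprB.
  apply: le_trans (H _).
    rewrite addrC lerD2r ler0_norm ?subr_le0// (exprNn (x - c)) (exprS (-1)).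
    by rewrite mulN1r !mulNr !mulrN !mulNr opprK !mulrA.
  move=> y /andP[xy yc].
  have yL : `|y| <= L by rewrite ler_norml (le_trans xL1 xy) (le_trans yc cL2).
  have /andP[+ _] := sf y yL; rewrite ler0_norm ?subr_le0// (exprNn (y - c)) mulrA.
  by rewrite -subr_ge0 opprK addrC.
rewrite ler_norml; apply/andP; split.
  by rewrite -[F x]opprK lerN2 -mulN1r; apply: side; rewrite normrN normr1.
by rewrite -[F x]mul1r; apply: side; rewrite normr1.
Qed.
End Volterra.

(** * Existence of the coefficient functions *)

Section Volterra_equations.
Context {R : realType}.
Implicit Types (p q c : R).

(** Picard iteration: with a parameter in front of the right-hand side, the k-th iterate is the
    coefficient of its k-th power, whence [lag] and the zero data for k > 0. The bound K (M |x -
    c|)^k / k! yields the decay. *)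
Lemma volterra_series (b11 b12 b21 b22 : R -> R) c p q :
  continuous b11 -> continuous b12 -> continuous b21 -> continuous b22 ->
  exists y w : nat -> R -> R,
  [/\ forall k x, is_derive x (1 : R) (y k)
        (lag (fun k x => b11 x * y k x + b12 x * w k x) k x),
      forall k x, is_derive x (1 : R) (w k)
        (lag (fun k x => b21 x * y k x + b22 x * w k x) k x),
      y 0%N c = p /\ w 0%N c = q,
      forall k, y k.+1 c = 0 /\ w k.+1 c = 0 &
      decays y /\ decays w].
Proof.
move=> c11 c12 c21 c22.
pose Z := fix Z k : (R -> R) * (R -> R) := if k is k'.+1 then
  (prim c (fun x => b11 x * (Z k').1 x + b12 x * (Z k').2 x),
   prim c (fun x => b21 x * (Z k').1 x + b22 x * (Z k').2 x))
  else (cst p, cst q).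
pose y k := (Z k).1; pose w k := (Z k).2.
have cZ k : continuous (y k) /\ continuous (w k).
  elim: k => [|k [cy cw]]; first by split=> x; exact: cst_continuous.
  split=> x; apply: is_derive_continuous; apply: is_derive_prim => t.
    by apply: cvgD; apply: cvgM; [exact: c11|exact: cy|exact: c12|exact: cw].
  by apply: cvgD; apply: cvgM; [exact: c21|exact: cy|exact: c22|exact: cw].
have dy k x : is_derive x (1 : R) (y k)
    (lag (fun k x => b11 x * y k x + b12 x * w k x) k x).
  case: k => [|k] /=; first exact: is_derive_cst.
  have [cy cw] := cZ k; apply: is_derive_prim => t.
  by apply: cvgD; apply: cvgM; [exact: c11|exact: cy|exact: c12|exact: cw].
have dw k x : is_derive x (1 : R) (w k)
    (lag (fun k x => b21 x * y k x + b22 x * w k x) k x).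
  case: k => [|k] /=; first exact: is_derive_cst.
  have [cy cw] := cZ k; apply: is_derive_prim => t.
  by apply: cvgD; apply: cvgM; [exact: c21|exact: cy|exact: c22|exact: cw].
exists y, w; split=> //; first by move=> k; rewrite /y/w/= !prim_base.
suff H (L r : R) : 0 <= r -> exists C : R, forall k x, `|x| <= L ->
    `|y k x| * r ^+ k <= C /\ `|w k x| * r ^+ k <= C.
  by split=> L r r0; have [C CP] := H L r r0; exists C => k x xL;
    have [] := CP k x xL.
move=> r0; pose L1 := Num.max L `|c|.
have [M11 M110 B11] := continuous_locally_bounded L1 c11.
have [M12 M120 B12] := continuous_locally_bounded L1 c12.
have [M21 M210 B21] := continuous_locally_bounded L1 c21.
have [M22 M220 B22] := continuous_locally_bounded L1 c22.
pose M := M11 + M12 + M21 + M22; pose K := `|p| + `|q|.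
have M0 : 0 <= M by rewrite !addr_ge0.
have K0 : 0 <= K by rewrite addr_ge0.
have cL1 : `|c| <= L1 by rewrite le_max lexx orbT.
have bnd k : forall x, `|x| <= L1 ->
    `|y k x| <= K * M ^+ k / k`!%:R * `|x - c| ^+ k /\
    `|w k x| <= K * M ^+ k / k`!%:R * `|x - c| ^+ k.
  elim: k => [|k IH].
    by move=> x _; rewrite /y/w/= !expr0 fact0 divr1 !mulr1 /K lerDl lerDr.
  have step (u b b' : R -> R) : (forall x, is_derive x (1 : R) u (b x * y k x + b' x * w k x)) ->
      u c = 0 -> (forall x, `|x| <= L1 -> `|b x| + `|b' x| <= M) ->
      forall x, `|x| <= L1 -> `|u x| <= K * M ^+ k.+1 / k.+1`!%:R * `|x - c| ^+ k.+1.
    move=> du uc bM x xL.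
    have := pow_bound (m := M * (K * M ^+ k / k`!%:R)) (n := k) du uc cL1 _ xL.
    rewrite (_ : M * _ * _ / _ = K * M ^+ k.+1 / k.+1`!%:R * `|x - c| ^+ k.+1).
      apply=> t tL; have [Hy Hw] := IH t tL.
      apply: (le_trans (ler_normD _ _)); rewrite !normrM -[leRHS]mulrA.
      apply: (@le_trans _ _ ((`|b t| + `|b' t|) * (K * M ^+ k / k`!%:R * `|t - c| ^+ k))).
        by rewrite mulrDl lerD ?ler_wpM2l.
      by rewrite ler_wpM2r ?bM// (le_trans _ Hy).
    by rewrite factS natrM (exprS M) invfM; move: (k.+1%:R^-1) (k`!%:R^-1) (_ ^+ k.+1) => i1 i2 e; ring.
  move=> x xL; split; [apply: (step _ b11 b12) | apply: (step _ b21 b22)] => //.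
  - exact: prim_base.
  - move=> t tL; apply: (le_trans (lerD (B11 _ tL) (B12 _ tL))).
    by rewrite /M -!addrA lerD2l lerDl addr_ge0.
  - exact: prim_base.
  - move=> t tL; apply: (le_trans (lerD (B21 _ tL) (B22 _ tL))).
    by rewrite /M -addrA lerDr addr_ge0.
(* For |x| <= L1 this majorises M |x - c| r, and s^k / k! <= exp s holds for all k. *)
pose s := M * (L1 + `|c|) * r.
have L10 : 0 <= L1 by rewrite (le_trans _ cL1).
have s0 : 0 <= s by rewrite !mulr_ge0// addr_ge0.
have sexp k : s ^+ k / k`!%:R <= expR s.
  case: k => [|k]; first by rewrite expr0 fact0 divr1 (le_trans _ (expR_ge1Dx _))// lerDl.
  by rewrite (le_trans _ (expR_ge1Dxn k s0))// lerDr.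
exists (K * expR s) => k x xL.
have xL1 : `|x| <= L1 by rewrite le_max xL.
have fin : K * M ^+ k / k`!%:R * `|x - c| ^+ k * r ^+ k <= K * expR s.
  rewrite -!mulrA ler_wpM2l// (le_trans _ (sexp k))// /s !exprMn.
  rewrite -mulrA [leRHS]mulrC !mulrA.
  rewrite ler_wpM2r ?exprn_ge0// [leRHS]mulrC mulrA [leLHS]mulrAC.
  rewrite [leRHS](_ : _ = M ^+ k / k`!%:R * (L1 + `|c|) ^+ k); last by ring.
  rewrite [leLHS](_ : _ = M ^+ k / k`!%:R * `|x - c| ^+ k); last by ring.
  rewrite ler_wpM2l ?divr_ge0 ?exprn_ge0// lerXn2r ?nnegrE ?addr_ge0//.
  by rewrite (le_trans (ler_normB _ _))// lerD2r.
have [Hy Hw] := bnd k x xL1.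
by split; apply: le_trans fin; rewrite ler_wpM2r ?exprn_ge0.
Qed.

(* The coefficients of z^k in the solution of u' = P u + v,
   v' = - (P^2 + z) u - P v with u(c) = p and v(c) = q. *)
Definition coef_family (P : R -> R) c p q (a b : nat -> R -> R) : Prop :=
  [/\ forall k x, is_derive x (1 : R) (a k) (P x * a k x + b k x),
      forall k x, is_derive x (1 : R) (b k)
        (- (P x ^+ 2 * a k x) - P x * b k x - lag a k x),
      a 0%N c = p /\ b 0%N c = q,
      forall k, a k.+1 c = 0 /\ b k.+1 c = 0 &
      decays a /\ decays b].

(** The system at z = 0: the constant weights 1 set the Picard parameter to 1, and they are
    invariant under the shift that [lag] causes. *)
Lemma linear_system (P : R -> R) c p q : continuous P ->
  exists u v : R -> R,
  [/\ forall x, is_derive x (1 : R) u (P x * u x + v x),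
      forall x, is_derive x (1 : R) v (- (P x ^+ 2 * u x) - P x * v x),
      u c = p & v c = q].
Proof.
move=> cP.
have c1 : continuous (fun _ : R => 1 : R) by move=> x; exact: cst_continuous.
have c2 : continuous (fun x => - (P x ^+ 2)).
  by move=> x; apply: cvgN; apply: cvgM; exact: cP.
have c3 : continuous (fun x => - P x) by move=> x; apply: cvgN; exact: cP.
have [y [w [dy dw [yc wc] ywc [Dy Dw]]]] := volterra_series c p q cP c1 c2 c3.
have s1 := @subgeom1 R.
have D1 := decaysD (decaysM cP Dy) (decaysM c1 Dw).
have D2 := decaysD (decaysM c2 Dy) (decaysM c3 Dw).
have at_c (F : nat -> R -> R) r : F 0%N c = r -> (forall k, F k.+1 c = 0) ->
    wsum (fun=> 1) F c = r.
  move=> F0 FS; rewrite /wsum; apply/cvg_lim => //.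
  rewrite -(cvg_shiftS (series _)).
  apply: cvg_near_cst; apply: nearW => n /=.
  rewrite /series/= big_nat_recl//= F0 mul1r big1 ?addr0// => k _.
  by rewrite FS mulr0.
exists (wsum (fun=> 1) y), (wsum (fun=> 1) w); split.
- move=> x; have := @is_derive_wsum R _ _ _ x s1 Dy (decays_lag D1) dy.
  rewrite wsum_lag// wsumDr//; [|exact: decaysM|exact: decaysM].
  by rewrite !wsumMr// mul1r.
- move=> x; have := @is_derive_wsum R _ _ _ x s1 Dw (decays_lag D2) dw.
  rewrite wsum_lag// wsumDr//; [|exact: decaysM|exact: decaysM].
  by rewrite !wsumMr// !mulNr.
- by apply: at_c => // k; have [] := ywc k.
- by apply: at_c => // k; have [] := ywc k.
Qed.

(** Variation of constants with two solutions at z = 0 of Wronskian 1: the ansatz u = u1 y + u2 w, v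
    = v1 y + v2 w gives y' = z u2 u and w' = - z u1 u. Picard iteration in the factor z then
    produces the coefficients of z^k. *)
Lemma coef_family_exists (P : R -> R) c p q : continuous P ->
  exists a b, coef_family P c p q a b.
Proof.
move=> cP.
have [u1 [v1 [du1 dv1 u1c v1c]]] := linear_system c 1 0 cP.
have [u2 [v2 [du2 dv2 u2c v2c]]] := linear_system c 0 1 cP.
have cu1 x := is_derive_continuous (du1 x).
have cu2 x := is_derive_continuous (du2 x).
have cv1 x := is_derive_continuous (dv1 x).
have cv2 x := is_derive_continuous (dv2 x).
have det1 x : u1 x * v2 x - u2 x * v1 x = 1.
  have D t : is_derive t (1 : R) (u1 * v2 - u2 * v1) 0.
    apply: is_derive_ext (is_deriveB (is_deriveM (du1 t) (dv2 t))
      (is_deriveM (du2 t) (dv1 t))) _ _ => //.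
    by rewrite /GRing.scale/=; ring.
  have := is_derive0_constant D x c.
  rewrite -[LHS]/(u1 x * v2 x - u2 x * v1 x) -[RHS]/(u1 c * v2 c - u2 c * v1 c) => ->.
  by rewrite u1c v2c u2c mul0r subr0 mulr1.
have cM (f g : R -> R) : continuous f -> continuous g -> continuous (fun x => f x * g x).
  by move=> cf cg x; apply: cvgM; [exact: cf|exact: cg].
have cMN (f g : R -> R) : continuous f -> continuous g -> continuous (fun x => - (f x * g x)).
  by move=> cf cg x; apply: cvgN; apply: cvgM; [exact: cf|exact: cg].
have [y [w [dy dw [yc wc] ywc [Dy Dw]]]] := volterra_series c p q
  (cM _ _ cu2 cu1) (cM _ _ cu2 cu2) (cMN _ _ cu1 cu1) (cMN _ _ cu1 cu2).
exists (fun k x => u1 x * y k x + u2 x * w k x), (fun k x => v1 x * y k x + v2 x * w k x).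
split.
- move=> k x; apply: is_derive_ext (is_deriveD (is_deriveM (du1 x) (dy k x))
    (is_deriveM (du2 x) (dw k x))) _ _ => //.
  by rewrite /GRing.scale/=; case: k => [|k] /=; ring.
- move=> k x; apply: is_derive_ext (is_deriveD (is_deriveM (dv1 x) (dy k x))
    (is_deriveM (dv2 x) (dw k x))) _ _ => //.
  rewrite /GRing.scale/=; case: k => [|k] /=; first by ring.
  (* The lagged term is multiplied by 1 = u1 v2 - u2 v1; both sides then agree as polynomials. *)
  by rewrite -[X in _ = _ - X]mul1r -(det1 x); ring.
- by rewrite u1c u2c v1c v2c yc wc !mul1r !mul0r addr0 add0r.
- by move=> k; have [-> ->] := ywc k; rewrite !mulr0 addr0.
- by split; apply: decaysD; apply: decaysM.
Qed.
End Volterra_equations.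

(** * Complex numbers with a real-valued modulus *)

Section ComplexNumbers.
Context {R : realType}.
Implicit Types (x y : R) (z w : Cx R).
Notation Re := (@complex.Re R).
Notation Im := (@complex.Im R).

(** The norm on [Cx R] takes its values in [Cx R]; estimates are made with the same modulus as an
    element of [R]. *)
Definition nrm z : R := Normc.normc z.

Arguments nrm : simpl never.
Arguments cplx : simpl never.

Lemma nrmE z : `|z| = cplx (nrm z). Proof. by []. Qed.

Lemma cplx_is_additive : {morph @cplx R : x y / x + y}.
Proof. by move=> x y; rewrite /cplx rmorphD. Qed.
Lemma cplxD x y : cplx (x + y) = cplx x + cplx y.
Proof. exact: cplx_is_additive. Qed.
Lemma cplxM x y : cplx (x * y) = cplx x * cplx y.
Proof. by rewrite /cplx rmorphM. Qed.
Lemma cplxN x : cplx (- x) = - cplx x.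
Proof. by rewrite /cplx rmorphN. Qed.
Lemma cplxB x y : cplx (x - y) = cplx x - cplx y.
Proof. by rewrite cplxD cplxN. Qed.
Lemma cplxX x n : cplx (x ^+ n) = cplx x ^+ n.
Proof. by rewrite /cplx rmorphXn. Qed.
Lemma cplx0 : cplx 0 = 0 :> Cx R. Proof. by []. Qed.
Lemma cplx1 : cplx 1 = 1 :> Cx R. Proof. by []. Qed.
Lemma cplx_inj : injective (@cplx R).
Proof. exact: complexI. Qed.
Lemma cplx_eq0 x : (cplx x == 0) = (x == 0).
Proof. by rewrite -cplx0 (inj_eq cplx_inj). Qed.

Lemma le_cplx x y : (cplx x <= cplx y) = (x <= y).
Proof. exact: lecR. Qed.
Lemma lt_cplx x y : (cplx x < cplx y) = (x < y).
Proof. exact: ltcR. Qed.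

Lemma cReD z w : Re (z + w) = Re z + Re w. Proof. by case: z => a b; case: w => c d. Qed.
Lemma cImD z w : Im (z + w) = Im z + Im w. Proof. by case: z => a b; case: w => c d. Qed.
Lemma cReN z : Re (- z) = - Re z. Proof. by case: z. Qed.
Lemma cImN z : Im (- z) = - Im z. Proof. by case: z. Qed.
Lemma cReM z w : Re (z * w) = Re z * Re w - Im z * Im w.
Proof. by case: z => a b; case: w => c d. Qed.
Lemma cImM z w : Im (z * w) = Re z * Im w + Im z * Re w.
Proof. by case: z => a b; case: w => c d. Qed.
Lemma complex_eta z : z = cplx (Re z) + 'i%C * cplx (Im z).
Proof. exact: complexE. Qed.
Lemma complex_ext z w : Re z = Re w -> Im z = Im w -> z = w.
Proof. by case: z => a b; case: w => c d /= -> ->. Qed.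

Lemma nrm_ge0 z : 0 <= nrm z.
Proof. by rewrite -le_cplx -nrmE; exact: normr_ge0. Qed.
Lemma nrmM z w : nrm (z * w) = nrm z * nrm w.
Proof. exact: Normc.normcM. Qed.
Lemma nrmD z w : nrm (z + w) <= nrm z + nrm w.
Proof. by rewrite -le_cplx cplxD -!nrmE; exact: ler_normD. Qed.
Lemma nrmN z : nrm (- z) = nrm z.
Proof. by apply: cplx_inj; rewrite -!nrmE normrN. Qed.
Lemma nrm0 : nrm 0 = 0.
Proof. by apply: cplx_inj; rewrite -!nrmE normr0. Qed.
Lemma nrm1 : nrm 1 = 1.
Proof. by apply: cplx_inj; rewrite -!nrmE normr1. Qed.
Lemma nrm_eq0 z : (nrm z == 0) = (z == 0).
Proof. by rewrite -cplx_eq0 -nrmE normr_eq0. Qed.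
Lemma nrmV z : nrm z^-1 = (nrm z)^-1.
Proof. exact: Normc.normcV. Qed.
Lemma nrmX z n : nrm (z ^+ n) = nrm z ^+ n.
Proof. by elim: n => [|n IH]; rewrite ?nrm1// !exprS nrmM IH. Qed.
Lemma nrm_cplx x : nrm (cplx x) = `|x|.
Proof. by rewrite /nrm /cplx/= expr0n addr0 sqrtr_sqr. Qed.
Lemma nrm_distC z w : nrm (z - w) = nrm (w - z).
Proof. by rewrite -nrmN opprB. Qed.
Lemma nrm_dist z w : `|nrm z - nrm w| <= nrm (z - w).
Proof.
have H u v : nrm u - nrm v <= nrm (u - v).
  by rewrite lerBlDr -{1}(subrK v u) nrmD.
by rewrite ler_norml lerNl opprB {1}nrm_distC !H.
Qed.
Lemma normRe_le z : `|Re z| <= nrm z.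
Proof. by rewrite -le_cplx -nrmE; exact: normc_ge_Re. Qed.
Lemma normIm_le z : `|Im z| <= nrm z.
Proof.
rewrite (_ : Im z = Re (- 'i%C * z)); last by rewrite cReM /= oppr0 mul0r sub0r mulN1r opprK.
by rewrite (le_trans (normRe_le _))// nrmM nrmN (_ : nrm 'i%C = 1) ?mul1r//
  /nrm/= expr0n/= add0r expr1n sqrtr1.
Qed.
Lemma nrm_le_ReIm z : nrm z <= `|Re z| + `|Im z|.
Proof.
rewrite [z in nrm z]complex_eta (le_trans (nrmD _ _))// nrm_cplx lerD2l nrmM nrm_cplx.
by rewrite (_ : nrm 'i%C = 1) ?mul1r// /nrm/= expr0n/= add0r expr1n sqrtr1.
Qed.

Lemma gt0_cplx (e : Cx R) : 0 < e -> exists2 d : R, 0 < d & e = cplx d.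
Proof.
case: e => a b; rewrite ltcE/= => /andP[/eqP-> a0].
by exists a.
Qed.

Lemma cvg_nrmP (T : Type) (F : set_system T) {FF : Filter F} (f : T -> Cx R) (l : Cx R) :
  f @ F --> l <-> forall e : R, 0 < e -> \forall t \near F, nrm (l - f t) <= e.
Proof.
split=> [/cvgrPdist_le H e e0|H].
  have := H (cplx e); rewrite -cplx0 lt_cplx => /(_ e0).
  by apply: filterS => t; rewrite nrmE le_cplx.
apply/cvgrPdist_le => e /gt0_cplx[d d0 ->].
by apply: filterS (H d d0) => t; rewrite nrmE le_cplx.
Qed.

Lemma near0_nrm (e : R) : 0 < e -> \forall h \near (0 : Cx R), nrm h <= e.
Proof.
move=> e0; have H := (@cvg_nrmP _ (nbhs (0 : Cx R)) _ id 0).1 cvg_id e e0.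
by near=> h; rewrite -nrmN -sub0r; near: h; exact: H.
Unshelve. all: by end_near.
Qed.

Lemma nrm_derivable (f : Cx R -> (Cx R)^o) z d (C e : R) : 0 < e ->
  (forall h, nrm h <= e -> nrm (f (z + h) - f z - h * d) <= C * nrm h ^+ 2) ->
  derivable f z 1.
Proof.
move=> e0 H; apply/cvg_ex; exists d; apply/cvg_nrmP => r r0.
near=> h.
have h0 : h != 0 by near: h; exact: nbhs_dnbhs_neq.
have he : nrm h <= e by near: h; apply: nbhs_dnbhs; exact: near0_nrm.
have hr : nrm h <= r / (`|C| + 1).
  by near: h; apply: nbhs_dnbhs; apply: near0_nrm; rewrite divr_gt0// ltr_pwDr.
have := H h he; rewrite (_ : h *: 1 = h); last by rewrite /GRing.scale/= mulr1.
rewrite /= (addrC h) => {}H.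
rewrite -nrmN opprB (_ : _ - d = h^-1 * (f (z + h) - f z - h * d)); last first.
  by rewrite mulrBr mulKf.
rewrite nrmM nrmV ler_pdivrMl ?lt_def ?nrm_eq0 ?h0 ?nrm_ge0//.
apply: (le_trans H); rewrite expr2 mulrA [leRHS]mulrC ler_wpM2r ?nrm_ge0//.
rewrite ler_pdivlMr ?ltr_pwDr// in hr; apply: le_trans hr.
by rewrite mulrC ler_wpM2l ?nrm_ge0// (le_trans (ler_norm _))// lerDl.
Unshelve. all: by end_near. Qed.

End ComplexNumbers.
Arguments nrm : simpl never.
Arguments cplx : simpl never.

(** * Entire functions *)

Section EntireSeries.
Context {R : realType}.
Implicit Types (a b : Cx R) (c d : nat -> Cx R) (F : nat -> R -> R) (x : R) (z w : Cx R).
Notation Re := (@complex.Re R).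
Notation Im := (@complex.Im R).

Definition csubgeom c := exists K r : R, 0 <= r /\ forall k, nrm (c k) <= K * r ^+ k.

(** The functions stay real and only the weights are complex, so the lemmas on [wsum] apply to each
    part. *)
Definition csum c F x : Cx R :=
  Complex (wsum (fun k => Re (c k)) F x) (wsum (fun k => Im (c k)) F x).

Lemma csubgeom_Re c : csubgeom c -> subgeom (fun k => Re (c k)).
Proof.
move=> [K [r [r0 H]]]; exists K, r; split=> // k.
exact: le_trans (normRe_le _) (H k).
Qed.

Lemma csubgeom_Im c : csubgeom c -> subgeom (fun k => Im (c k)).
Proof.
move=> [K [r [r0 H]]]; exists K, r; split=> // k.
exact: le_trans (normIm_le _) (H k).
Qed.

Lemma csubgeomD c d : csubgeom c -> csubgeom d -> csubgeom (fun k => c k + d k).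
Proof.
move=> [K [r [r0 H]]] [K' [r' [r'0 H']]].
have K0 : 0 <= K by have := H 0%N; rewrite expr0 mulr1; apply: le_trans; exact: nrm_ge0.
have K'0 : 0 <= K' by have := H' 0%N; rewrite expr0 mulr1; apply: le_trans; exact: nrm_ge0.
exists (K + K'), (r + r'); split=> [|k]; first exact: addr_ge0.
apply: (le_trans (nrmD _ _)); rewrite mulrDl lerD//.
  apply: (le_trans (H k)); rewrite ler_wpM2l// lerXn2r ?nnegrE ?addr_ge0//.
  by rewrite lerDl.
apply: (le_trans (H' k)); rewrite ler_wpM2l// lerXn2r ?nnegrE ?addr_ge0//.
by rewrite lerDr.
Qed.

Lemma csubgeomZ a c : csubgeom c -> csubgeom (fun k => a * c k).
Proof.
move=> [K [r [r0 H]]]; exists (nrm a * K), r; split=> // k.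
by rewrite nrmM -mulrA ler_wpM2l// nrm_ge0.
Qed.

Lemma csumD c d F x : csubgeom c -> csubgeom d -> decays F ->
  csum (fun k => c k + d k) F x = csum c F x + csum d F x.
Proof.
move=> sc sd dF; apply: complex_ext; rewrite ?cReD ?cImD /=.
  rewrite -wsumDl//; [|exact: csubgeom_Re|exact: csubgeom_Re].
  by congr (wsum _ F x); apply/funext => k; rewrite cReD.
rewrite -wsumDl//; [|exact: csubgeom_Im|exact: csubgeom_Im].
by congr (wsum _ F x); apply/funext => k; rewrite cImD.
Qed.

Lemma subgeomZ (a : R) (u : nat -> R) : subgeom u -> subgeom (fun k => a * u k).
Proof.
move=> [K [r [r0 H]]]; exists (`|a| * K), r; split=> // k.
by rewrite normrM -mulrA ler_wpM2l.
Qed.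

Lemma csumZ a c F x : csubgeom c -> decays F ->
  csum (fun k => a * c k) F x = a * csum c F x.
Proof.
move=> sc dF.
have sR := csubgeom_Re sc; have sI := csubgeom_Im sc.
apply: complex_ext => /=.
  rewrite [RHS]cReM /= -mulNr -!wsumMl// -wsumDl//; try exact: subgeomZ.
  by congr (wsum _ F x); apply/funext => k; rewrite cReM mulNr.
rewrite [RHS]cImM /= -!wsumMl// -wsumDl//; try exact: subgeomZ.
by congr (wsum _ F x); apply/funext => k; rewrite cImM.
Qed.

(** The constant does not depend on the weights. With the Taylor remainders of z^k as weights and e
    = |h|^3 this is the Taylor estimate of the sum. *)
Lemma csum_bound F x (r : R) : decays F -> 0 <= r ->
  exists C : R, forall c (e : R), 0 <= e -> (forall k, nrm (c k) <= e * r ^+ k) ->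
    nrm (csum c F x) <= C * e.
Proof.
move=> dF r0; have [C CP] := dF `|x| (2 * r) (mulr_ge0 (ler0n _ _) r0).
(* One factor 2 is the sum of 2^-k, the other counts the real and the imaginary part. *)
exists (4 * C) => c e e0 ce.
have H (u : nat -> R) : (forall k, `|u k| <= nrm (c k)) -> `|wsum u F x| <= 2 * C * e.
  move=> uc; rewrite -mulrA; apply: half_geom_lim => k.
  rewrite normrM (le_trans (ler_wpM2r (normr_ge0 _) (le_trans (uc k) (ce k))))//.
  rewrite (_ : r ^+ k = (2 * r) ^+ k * 2^-1 ^+ k); last first.
    by rewrite -exprMn mulrAC divff ?mul1r.
  have h : 0 <= C - `|F k x| * (2 * r) ^+ k by rewrite subr_ge0 CP.
  rewrite -subr_ge0.
  rewrite (_ : _ - _ = e * (C - `|F k x| * (2 * r) ^+ k) * 2^-1 ^+ k); last by ring.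
  by rewrite !mulr_ge0// exprn_ge0.
apply: (le_trans (nrm_le_ReIm _)) => /=.
rewrite (_ : 4 * C * e = 2 * C * e + 2 * C * e); last by ring.
by apply: lerD; apply: H => k; [exact: normRe_le|exact: normIm_le].
Qed.

(** The derivative of z^k, written by the product rule for z times z^k so that inductions on k
    close; [ddpow] is half the second derivative. *)
Fixpoint dpow (T : comNzRingType) (z : T) k : T :=
  if k is k'.+1 then z * dpow z k' + z ^+ k' else 0.

Fixpoint ddpow (T : comNzRingType) (z : T) k : T :=
  if k is k'.+1 then z * ddpow z k' + dpow z k' else 0.

(** The rate [nrm z + 2] serves the powers, both derivatives and, for |h| <= 1, the remainder: an
    induction step spends at most [nrm z + 1] on the old term and 1 on the new one. *)
Lemma nrm_pow_le z k : nrm (z ^+ k) <= (nrm z + 2) ^+ k.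
Proof.
by rewrite nrmX lerXn2r ?nnegrE ?addr_ge0 ?nrm_ge0// lerDl.
Qed.

Lemma nrm_dpow_le z k : nrm (dpow z k) <= (nrm z + 2) ^+ k.
Proof.
elim: k => [|k IH]; first by rewrite [nrm _]nrm0 expr0.
rewrite /=.
rewrite (le_trans (nrmD _ _))// nrmM exprS.
apply: (@le_trans _ _ ((nrm z + 1) * (nrm z + 2) ^+ k)).
  by rewrite mulrDl mul1r lerD ?nrm_pow_le// ler_wpM2l ?nrm_ge0.
by rewrite ler_wpM2r ?exprn_ge0 ?addr_ge0 ?nrm_ge0// lerD2l ler1n.
Qed.

Lemma nrm_ddpow_le z k : nrm (ddpow z k) <= (nrm z + 2) ^+ k.
Proof.
elim: k => [|k IH]; first by rewrite [nrm _]nrm0 expr0.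
rewrite /=.
rewrite (le_trans (nrmD _ _))// nrmM exprS.
apply: (@le_trans _ _ ((nrm z + 1) * (nrm z + 2) ^+ k)).
  by rewrite mulrDl mul1r lerD ?nrm_dpow_le// ler_wpM2l ?nrm_ge0.
by rewrite ler_wpM2r ?exprn_ge0 ?addr_ge0 ?nrm_ge0// lerD2l ler1n.
Qed.

(** The remainder is written with sums and scalar factors only, so that [csumD] and [csumZ] can take
    it apart. *)
Lemma nrm_pow_taylor_le z h k : nrm h <= 1 ->
  nrm ((z + h) ^+ k + - 1 * (z ^+ k + (h * dpow z k + h ^+ 2 * ddpow z k))) <=
  nrm h ^+ 3 * (nrm z + 2) ^+ k.
Proof.
move=> h1; elim: k => [|k IH].
  rewrite [X in nrm X](_ : _ = 0); last by rewrite /=; ring.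
  by rewrite nrm0 mulr_ge0// exprn_ge0// nrm_ge0.
set T := (X in nrm X <= _) in IH.
(* Recursion for the remainder: multiplying by z + h produces everything except the cubic term. *)
rewrite (_ : (z + h) ^+ k.+1 + _ = (z + h) * T + h ^+ 3 * ddpow z k); last first.
  by rewrite /T /= !exprS; ring.
rewrite (le_trans (nrmD _ _))// (nrmM (z + h)) (nrmM (h ^+ 3)) nrmX (exprS (nrm z + 2)).
apply: (@le_trans _ _ ((nrm z + 1) * (nrm h ^+ 3 * (nrm z + 2) ^+ k) +
    nrm h ^+ 3 * (nrm z + 2) ^+ k)).
  apply: lerD; last by rewrite ler_wpM2l ?exprn_ge0 ?nrm_ge0// nrm_ddpow_le.
  rewrite ler_pM ?nrm_ge0// (le_trans (nrmD _ _))// lerD2l//.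
rewrite le_eqVlt; apply/orP; left; apply/eqP.
by ring.
Qed.

Lemma csubgeom_pow z : csubgeom (fun k => z ^+ k).
Proof.
exists 1, (nrm z + 2); split=> [|k]; first by rewrite addr_ge0// nrm_ge0.
by rewrite mul1r nrm_pow_le.
Qed.
Lemma csubgeom_dpow z : csubgeom (dpow z).
Proof.
exists 1, (nrm z + 2); split=> [|k]; first by rewrite addr_ge0// nrm_ge0.
by rewrite mul1r nrm_dpow_le.
Qed.
Lemma csubgeom_ddpow z : csubgeom (ddpow z).
Proof.
exists 1, (nrm z + 2); split=> [|k]; first by rewrite addr_ge0// nrm_ge0.
by rewrite mul1r nrm_ddpow_le.
Qed.

Lemma csum_taylor F x z : decays F -> exists C : R, forall h, nrm h <= 1 ->
  nrm (csum (fun k => (z + h) ^+ k) F x - csum (fun k => z ^+ k) F x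
    - h * csum (dpow z) F x - h ^+ 2 * csum (ddpow z) F x) <= C * nrm h ^+ 3.
Proof.
move=> dF; have r0 : 0 <= nrm z + 2 by rewrite addr_ge0// nrm_ge0.
have [C CP] := csum_bound x dF r0; exists C => h h1.
have := CP _ _ (exprn_ge0 3 (nrm_ge0 h)) (fun k => nrm_pow_taylor_le z k h1).
have S1 := csubgeom_pow z; have S2 := csubgeom_dpow z; have S3 := csubgeom_ddpow z.
have S4 := csubgeom_pow (z + h).
have Z2 := csubgeomZ h S2; have Z3 := csubgeomZ (h ^+ 2) S3.
have D := csubgeomD Z2 Z3; have D' := csubgeomD S1 D.
rewrite csumD ?csumZ//; last exact: csubgeomZ.
rewrite csumD// csumD// !csumZ// mulN1r !opprD !addrA; exact.
Qed.

Definition entire (f : Cx R -> Cx R) := forall z, derivable (f : Cx R -> (Cx R)^o) z 1.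

(* The divided difference of f at t extends to an entire function with value
   f1 at t. *)
Definition smooth_at (f : Cx R -> Cx R) (t f1 : Cx R) : Prop :=
  exists q : Cx R -> Cx R,
    [/\ forall z, f z = f t + (z - t) * q z, q t = f1 & entire q].

Lemma cderivableM (f g : Cx R -> (Cx R)^o) (z : Cx R) : derivable f z 1 -> derivable g z 1 ->
  derivable (fun w => f w * g w : (Cx R)^o) z 1.
Proof. move=> df dg; exact: (@derivableM (Cx R) (Cx R)^o f g z 1 df dg). Qed.
Lemma cderivableV (f : Cx R -> (Cx R)^o) (z : Cx R) : f z != 0 -> derivable f z 1 ->
  derivable (fun w => (f w)^-1 : (Cx R)^o) z 1.
Proof. move=> f0 df; exact: (@derivableV (Cx R) (Cx R)^o f z 1 f0 df). Qed.
Lemma cderivableD (f g : Cx R -> (Cx R)^o) (z : Cx R) : derivable f z 1 -> derivable g z 1 ->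
  derivable (fun w => f w + g w : (Cx R)^o) z 1.
Proof. move=> df dg; exact: (@derivableD (Cx R) (Cx R)^o _ f g z 1 df dg). Qed.
Lemma cderivableB (f g : Cx R -> (Cx R)^o) (z : Cx R) : derivable f z 1 -> derivable g z 1 ->
  derivable (fun w => f w - g w : (Cx R)^o) z 1.
Proof. move=> df dg; exact: (@derivableB (Cx R) (Cx R)^o _ f g z 1 df dg). Qed.
Lemma cderivable_subr (t z : Cx R) : derivable (fun w => w - t : (Cx R)^o) z 1.
Proof. exact: (@cderivableB id (cst t) z (@derivable_id _ _ _ _) (@derivable_cst _ _ _ _ _ _)). Qed.

Lemma derivable_near_neq0 (f : Cx R -> (Cx R)^o) z : derivable f z 1 ->
  f z != 0 -> \forall w \near z, f w != 0.
Proof.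
move=> /derivable1_diffP /differentiable_continuous cf fz.
have e0 : 0 < nrm (f z) / 2 by rewrite divr_gt0// lt_def nrm_eq0 fz nrm_ge0.
have H := (@cvg_nrmP R (Cx R) (nbhs z) _ f (f z)).1 cf _ e0.
near=> w; apply/negP => /eqP fw.
have : nrm (f z - f w) <= nrm (f z) / 2 by near: w; exact: H.
by rewrite fw subr0 ler_pdivlMr// -subr_ge0 mulr_natr mulr2n opprD addrA subrr
  sub0r oppr_ge0 leNgt lt_def nrm_eq0 fz nrm_ge0.
Unshelve. all: by end_near.
Qed.

(** A cubic remainder is needed because division by z - t loses one order, and the divided
    difference must still be differentiable at t, with derivative [f2 t]. *)
Definition taylor2 (f f1 f2 : Cx R -> Cx R) := forall z, exists C : R,
  forall h, nrm h <= 1 -> nrm (f (z + h) - f z - h * f1 z - h ^+ 2 * f2 z) <= C * nrm h ^+ 3.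

Lemma taylor2_entire f f1 f2 : taylor2 f f1 f2 -> entire f.
Proof.
move=> H z; have [C CP] := H z.
apply: (@nrm_derivable _ _ z (f1 z) (`|C| + nrm (f2 z)) 1) => // h h1.
rewrite (_ : _ - _ = (f (z + h) - f z - h * f1 z - h ^+ 2 * f2 z) + h ^+ 2 * f2 z);
  last by rewrite subrK.
rewrite (le_trans (nrmD _ _))// mulrDl nrmM nrmX [X in _ + X]mulrC lerD//.
rewrite (le_trans (CP h h1))// exprS mulrA ler_wpM2r ?exprn_ge0 ?nrm_ge0//.
rewrite (@le_trans _ _ (`|C| * nrm h))// ?ler_wpM2r ?nrm_ge0 ?ler_norm//.
by rewrite -[leRHS]mulr1 ler_wpM2l.
Qed.

Lemma taylor2_smooth f f1 f2 t : taylor2 f f1 f2 -> smooth_at f t (f1 t).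
Proof.
move=> H; have fE := taylor2_entire H; have [C CP] := H t.
exists (fun z => if z == t then f1 t else (f z - f t) / (z - t)); split.
- move=> z; case: eqVneq => [->|zt]; first by rewrite subrr mul0r addr0.
  by rewrite mulrC divfK ?subr_eq0// addrC subrK.
- by rewrite eqxx.
move=> z; have [->|zt] := eqVneq z t.
  apply: (@nrm_derivable _ _ t (f2 t) C 1) => // h h1.
  rewrite eqxx; have [->|h0] := eqVneq h 0.
    by rewrite addr0 eqxx subrr mul0r subrr nrm0 expr0n mulr0.
  have -> : (t + h == t) = false by rewrite -[X in _ == X]addr0 (inj_eq (addrI t)) (negPf h0).
  rewrite -(ler_pM2l (x := nrm h)) ?lt_def ?nrm_eq0 ?h0 ?nrm_ge0// -nrmM.
  rewrite (mulrC _ (C * _)) -mulrA -exprSr; apply: le_trans (CP h h1).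
  rewrite le_eqVlt; apply/orP; left; apply/eqP; congr nrm.
  have -> : t + h - t = h by ring.
  by field.
have dsub := @cderivable_subr t z.
apply: (@near_eq_derivable _ _ _ (fun w => (f w - f t) / (w - t))).
  near=> w; rewrite ifN//; near: w.
  by near=> w; rewrite -subr_eq0; near: w; apply: (derivable_near_neq0 dsub); rewrite subr_eq0.
apply: cderivableM; first by apply: cderivableB; [exact: fE|exact: derivable_cst].
by apply: cderivableV => //; rewrite subr_eq0.
Unshelve. all: by end_near. Qed.

Lemma csum_smooth F x t : decays F ->
  smooth_at (fun z => csum (fun k => z ^+ k) F x) t (csum (dpow t) F x).
Proof.
move=> dF; pose f1 z := csum (dpow z) F x.
apply: (@taylor2_smooth _ f1 (fun z => csum (ddpow z) F x)) => z.
exact: csum_taylor.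
Qed.

Lemma smooth_lin a b f g t f1 g1 : smooth_at f t f1 -> smooth_at g t g1 ->
  smooth_at (fun z => a * f z + b * g z) t (a * f1 + b * g1).
Proof.
move=> [p [fp p1 ep]] [q [gq q1 eq]].
exists (fun z => a * p z + b * q z); split.
- by move=> z; rewrite fp gq; ring.
- by rewrite p1 q1.
move=> z; apply: cderivableD; apply: cderivableM.
- exact: derivable_cst.
- exact: ep.
- exact: derivable_cst.
- exact: eq.
Qed.

Lemma smooth_entire f t f1 : smooth_at f t f1 -> entire f.
Proof.
move=> [p [fp _ ep]] z; rewrite (_ : f = fun z => f t + (z - t) * p z); last exact/funext.
apply: cderivableD; first exact: derivable_cst.
by apply: cderivableM (ep z); exact: cderivable_subr.
Qed.

End EntireSeries.

(** * Absolutely continuous functions *)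

Section AbsoluteContinuity.
Context {R : realType}.
Implicit Types (a b x y : R) (f g : R -> Cx R).
Notation mu := (@lebesgue_measure R).

Lemma cplx_sum (I : Type) (s : seq I) (F : I -> R) :
  \sum_(i <- s) cplx (F i) = cplx (\sum_(i <- s) F i).
Proof. by elim/big_rec2: _ => // i y1 y2 _ ->; rewrite cplxD. Qed.

Definition fine_intervals (m : nat) a b (x y : 'I_m -> R) : Prop :=
  (forall k, [&& a <= x k, x k <= y k & y k <= b]) /\
  (forall k k', k != k' -> (y k <= x k') || (y k' <= x k)).

Lemma abs_contP a b f : abs_cont a b f <->
  forall e : R, 0 < e -> exists2 d : R, 0 < d & forall m (x y : 'I_m -> R),
    fine_intervals a b x y -> \sum_k (y k - x k) < d ->
    \sum_k nrm (f (y k) - f (x k)) < e.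
Proof.
have E m (x y : 'I_m -> R) : \sum_k `|f (y k) - f (x k)| =
    cplx (\sum_k nrm (f (y k) - f (x k))) by rewrite -cplx_sum.
split=> H e e0; have [d d0 dP] := H e e0; exists d => // m x y.
  by case=> xy dis s; have := dP m x y xy dis s; rewrite E lt_cplx.
by move=> xy dis s; rewrite E lt_cplx; exact: dP.
Qed.

Lemma fine_intervals_sub m a b a' b' (x y : 'I_m -> R) : a <= a' -> b' <= b ->
  fine_intervals a' b' x y -> fine_intervals a b x y.
Proof.
move=> aa bb [xy dis]; split=> // k; have /and3P[ax -> yb] := xy k.
by rewrite (le_trans aa ax) (le_trans yb bb).
Qed.

Lemma abs_cont_sub a b a' b' f : a <= a' -> b' <= b -> abs_cont a b f -> abs_cont a' b' f.
Proof.
move=> aa bb /abs_contP H; apply/abs_contP => e e0.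
have [d d0 dP] := H e e0; exists d => // m x y xy.
exact: dP (fine_intervals_sub aa bb xy).
Qed.

Lemma abs_contD a b f g : abs_cont a b f -> abs_cont a b g ->
  abs_cont a b (fun x => f x + g x).
Proof.
move=> /abs_contP F /abs_contP G; apply/abs_contP => e e0.
have e2 : 0 < e / 2 by rewrite divr_gt0.
have [d d0 dP] := F _ e2; have [d' d'0 d'P] := G _ e2.
exists (Num.min d d'); first by rewrite lt_min d0.
move=> m x y xy; rewrite lt_min => /andP[s1 s2].
rewrite [e]splitr; apply: le_lt_trans (ltrD (dP _ _ _ xy s1) (d'P _ _ _ xy s2)).
rewrite -big_split/=; apply: ler_sum => k _.
by rewrite opprD addrACA nrmD.
Qed.

Lemma abs_cont_unif a b f e : abs_cont a b f -> 0 < e -> exists2 d : R, 0 < d &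
  forall x y, a <= x <= b -> a <= y <= b -> `|y - x| < d -> nrm (f y - f x) < e.
Proof.
move=> /abs_contP F e0; have [d d0 dP] := F e e0; exists d => //.
move=> x y xab yab.
wlog xy : x y xab yab / x <= y.
  move=> H; case/orP: (le_total x y) => xy; first exact: H.
  by rewrite distrC nrm_distC; exact: H.
rewrite ger0_norm ?subr_ge0// => yx.
have := dP 1%N (fun=> x) (fun=> y); rewrite !big_ord1; apply=> //.
split=> [k|k k']; last by rewrite !ord1 eqxx.
by case/andP: xab => -> _; rewrite xy; case/andP: yab.
Qed.

Lemma abs_cont_bounded a b f : abs_cont a b f ->
  exists2 M : R, 0 <= M & forall x, a <= x <= b -> nrm (f x) <= M.
Proof.
move=> acf; have [ab|ab] := leP a b; last first.
  by exists 0 => // x /andP[ax xb]; move: (le_trans ax xb); rewrite leNgt ab.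
have cf : {within `[a, b], continuous (fun x => nrm (f x))}.
  apply/subspace_continuousP => x /= xab; apply/cvgrPdist_lt => e e0.
  have [d d0 dP] := abs_cont_unif acf e0.
  rewrite /prop_near1 /within /=; apply/nbhs_ballP; exists d => //= y xy yab.
  apply: (@le_lt_trans _ _ (nrm (f x - f y))); last first.
    by apply: dP => //; rewrite -?in_itv//.
  exact: nrm_dist.
have [c cab cP] := EVT_max ab cf.
exists (nrm (f c)); first exact: nrm_ge0.
by move=> x xab; apply: cP; rewrite in_itv.
Qed.

Lemma abs_contM a b f g : abs_cont a b f -> abs_cont a b g ->
  abs_cont a b (fun x => f x * g x).
Proof.
move=> F G; have [M M0 fM] := abs_cont_bounded F; have [N N0 gN] := abs_cont_bounded G.
move/abs_contP: F => F; move/abs_contP: G => G; apply/abs_contP => e e0.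
have eM : 0 < e / 2 / (M + 1) by rewrite !divr_gt0// ltr_wpDl.
have eN : 0 < e / 2 / (N + 1) by rewrite !divr_gt0// ltr_wpDl.
have [d d0 dP] := F _ eN; have [d' d'0 d'P] := G _ eM.
exists (Num.min d d'); first by rewrite lt_min d0.
move=> m x y xy; rewrite lt_min => /andP[s1 s2].
have h1 := dP _ _ _ xy s1; have h2 := d'P _ _ _ xy s2.
rewrite ltr_pdivlMr ?ltr_wpDl// in h1; rewrite ltr_pdivlMr ?ltr_wpDl// in h2.
rewrite [e]splitr; apply: le_lt_trans (ltrD h1 h2).
rewrite !mulr_suml -big_split/=; apply: ler_sum => k _.
rewrite (_ : _ - _ = (f (y k) - f (x k)) * g (y k) + f (x k) * (g (y k) - g (x k))); last by ring.
have /and3P[ax xyk yb] := xy.1 k.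
rewrite (le_trans (nrmD _ _))// !nrmM lerD//.
  by rewrite ler_wpM2l ?nrm_ge0// (le_trans (gN _ _)) ?lerDl// (le_trans ax).
rewrite mulrC ler_wpM2l ?nrm_ge0// (le_trans (fM _ _)) ?lerDl// ax.
exact: le_trans yb.
Qed.

Lemma abs_cont_lipschitz a b f (K : R) :
  (forall x y, a <= x <= b -> a <= y <= b -> nrm (f y - f x) <= K * `|y - x|) ->
  abs_cont a b f.
Proof.
move=> fK; apply/abs_contP => e e0.
have K0 : 0 < `|K| + 1 by rewrite ltr_wpDl.
exists (e / (`|K| + 1)); first exact: divr_gt0.
move=> m x y [xy _] s; rewrite ltr_pdivlMr// mulrC in s.
apply: le_lt_trans s; rewrite mulr_sumr; apply: ler_sum => k _.
have /and3P[ax xyk yb] := xy k.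
have ge0 : 0 <= y k - x k by rewrite subr_ge0.
have xab : a <= x k <= b by rewrite ax (le_trans xyk).
have yab : a <= y k <= b by rewrite yb (le_trans ax).
rewrite (le_trans (fK _ _ xab yab))// ger0_norm// ler_wpM2r//.
by rewrite (le_trans (ler_norm _))// lerDl.
Qed.

Lemma abs_cont_cst a b c : abs_cont a b (fun=> c).
Proof.
by apply: (@abs_cont_lipschitz _ _ _ 0) => x y _ _; rewrite subrr nrm0 mul0r.
Qed.

Lemma abs_contZ a b c f : abs_cont a b f -> abs_cont a b (fun x => c * f x).
Proof. by move=> F; apply: abs_contM => //; exact: abs_cont_cst. Qed.

Lemma abs_cont_C1 a b (F G : R -> R) : continuous G ->
  (forall x, is_derive x (1 : R) F (G x)) -> abs_cont a b (fun x => cplx (F x)).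
Proof.
move=> cG FG.
have [M M0 GM] := continuous_locally_bounded (`|a| + `|b|) cG.
apply: (@abs_cont_lipschitz _ _ _ M) => x y xab yab.
rewrite -cplxB nrm_cplx; apply: (is_derive_lipschitz FG _ xab yab) => t /andP[at_ tb].
apply: GM; rewrite ler_norml; apply/andP; split.
  rewrite (le_trans _ at_)// lerNl (le_trans (ler_norm _))// normrN.
  by rewrite lerDl.
by rewrite (le_trans tb)// (le_trans (ler_norm _))// lerDr.
Qed.

(** Without division the case y = x needs no exclusion, and increments can be added. *)
Lemma has_derivP a b f x d : has_deriv a b f x d <->
  forall e : R, 0 < e -> exists2 r : R, 0 < r & forall y, a <= y <= b ->
    `|y - x| < r -> nrm (f y - f x - d * cplx (y - x)) <= e * `|y - x|.
Proof.
split=> [/cvg_nrmP H e e0|H].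
  have := H e e0; rewrite /prop_near1 /within/=.
  move=> /nbhs_ballP[r/= r0 rP]; exists r => // y yab yx.
  have [->|yx0] := eqVneq y x; first by rewrite !subrr cplx0 mulr0 subr0 nrm0 normr0 mulr0.
  have yx1 : cplx (y - x) != 0 by rewrite cplx_eq0 subr_eq0.
  have := rP y; rewrite /ball/= distrC => /(_ yx yx0 yab).
  have yx2 : 0 < `|y - x| by rewrite normr_gt0 subr_eq0.
  move=> h; rewrite -(ler_pM2r yx2) in h; apply: le_trans h.
  rewrite -(nrm_cplx (y - x)) -nrmM -[leRHS]nrmN le_eqVlt; apply/orP; left; apply/eqP.
  by congr nrm; rewrite mulrBl mulfVK// opprB.
apply/cvg_nrmP => e e0; have [r r0 rP] := H e e0.
rewrite /prop_near1 /within/=; apply/nbhs_ballP; exists r => //= y xy yx0 yab.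
have yx1 : cplx (y - x) != 0 by rewrite cplx_eq0 subr_eq0.
rewrite /ball/= distrC in xy; have h := rP y yab xy.
rewrite -(ler_pM2r (x := `|y - x|)) ?normr_gt0 ?subr_eq0//; apply: le_trans h.
rewrite -(nrm_cplx (y - x)) -nrmM -[leLHS]nrmN le_eqVlt; apply/orP; left; apply/eqP.
by congr nrm; rewrite mulrBl mulfVK// opprB.
Qed.

Lemma has_deriv_sub a b a' b' f x d : a <= a' -> b' <= b ->
  has_deriv a b f x d -> has_deriv a' b' f x d.
Proof.
move=> aa bb /has_derivP H; apply/has_derivP => e e0.
have [r r0 rP] := H e e0; exists r => // y /andP[ay yb]; apply: rP.
by rewrite (le_trans aa ay) (le_trans yb bb).
Qed.

Lemma has_deriv_cplx a b (F : R -> R) x d : is_derive x (1 : R) F d ->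
  has_deriv a b (fun y => cplx (F y)) x (cplx d).
Proof.
move=> [/cvg_ex[/= l Hl] Fd]; have ld : l = d.
  by rewrite -Fd /derive; apply/esym/cvg_lim.
rewrite {}ld in Hl; apply/has_derivP => e e0.
move/cvgrPdist_le : Hl => /(_ e e0) /nbhs_ballP[r/= r0 rP].
exists r => // y _ yx.
have [->|yx0] := eqVneq y x; first by rewrite !subrr cplx0 mulr0 subr0 nrm0 normr0 mulr0.
have yx1 : y - x != 0 by rewrite subr_eq0.
have := rP (y - x); rewrite /ball/= sub0r normrN => /(_ yx yx1).
rewrite [_ *: 1]mulr1 subrK -cplxB -cplxM -cplxB nrm_cplx.
have yx2 : 0 < `|y - x| by rewrite normr_gt0.
move=> h; rewrite -(ler_pM2r yx2) in h; apply: le_trans h.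
rewrite -normrM -[leRHS]normrN le_eqVlt; apply/orP; left; apply/eqP.
by congr (`|_|); rewrite /GRing.scale/= mulrBl (mulrC (y - x)^-1) mulfVK// opprB.
Qed.

Lemma has_deriv_continuous a b f x d : has_deriv a b f x d ->
  f @ within [set y | a <= y <= b] x^' --> f x.
Proof.
move=> /has_derivP /(_ 1 ltr01)[r r0 rP]; apply/cvg_nrmP => e e0.
rewrite /prop_near1 /within/=; apply/nbhs_ballP.
have K0 : 0 < nrm d + 1 by rewrite ltr_wpDl ?nrm_ge0.
exists (Num.min r (e / (nrm d + 1))); first by rewrite /= lt_min r0 divr_gt0.
move=> y; rewrite /ball/= lt_min distrC => /andP[yr ye] _ yab.
rewrite nrm_distC (_ : f y - f x = (f y - f x - d * cplx (y - x)) + d * cplx (y - x));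
  last by rewrite subrK.
rewrite (le_trans (nrmD _ _))// nrmM nrm_cplx.
apply: (le_trans (lerD (rP y yab yr) (lexx _))).
by rewrite -mulrDl addrC mulrC -ler_pdivlMr// ltW.
Qed.

Lemma has_derivD a b f g x d d' : has_deriv a b f x d -> has_deriv a b g x d' ->
  has_deriv a b (fun y => f y + g y) x (d + d').
Proof.
move=> F G; rewrite /has_deriv.
under eq_fun do rewrite opprD addrACA mulrDl.
exact: (cvgD F G).
Qed.

Lemma has_derivM a b f g x d d' : has_deriv a b f x d -> has_deriv a b g x d' ->
  has_deriv a b (fun y => f y * g y) x (d * g x + f x * d').
Proof.
move=> F G; rewrite /has_deriv.
rewrite (_ : (fun y => _) = (fun y => (f y - f x) / cplx (y - x) * g y +
  f x * ((g y - g x) / cplx (y - x)))); last by apply/funext => y; ring.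
exact: (cvgD (cvgM F (has_deriv_continuous G)) (cvgM (cvg_cst (f x)) G)).
Qed.

Lemma has_deriv_cst a b c x : has_deriv a b (fun=> c) x 0.
Proof.
apply/has_derivP => e e0; exists 1 => // y _ _.
by rewrite !subrr mul0r subr0 nrm0 mulr_ge0// ltW.
Qed.

Lemma has_derivZ a b c f x d : has_deriv a b f x d ->
  has_deriv a b (fun y => c * f y) x (c * d).
Proof.
by move=> F; have := has_derivM (has_deriv_cst a b c x) F; rewrite mul0r add0r.
Qed.

End AbsoluteContinuity.
Arguments has_derivZ {R a b} c {f x d} _.
Arguments abs_contZ {R a b} c {f} _.
Arguments abs_contD {R a b f g} _ _.
Arguments abs_contM {R a b f g} _ _.

(** * Absolutely continuous functions with zero derivative almost everywhere *)

Section LebesguePart.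
Context {R : realType}.
Implicit Types (a b x y : R) (f g : R -> Cx R).
Notation mu := (@lebesgue_measure R).

(** Half-open intervals, because neighbours may share an endpoint. *)
Lemma fine_intervals_trivIset m a b (x y : 'I_m -> R) : fine_intervals a b x y ->
  trivIset setT (fun k => `]x k, y k]%classic).
Proof.
move=> [xy dis]; apply/trivIsetP => k k' _ _ kk'.
apply/seteqP; split=> // t /=; rewrite !in_itv/= => -[/andP[t1 t2] /andP[t3 t4]].
case/orP: (dis k k' kk') => H.
  by move: (le_lt_trans (le_trans t2 H) t3); rewrite ltxx.
by move: (le_lt_trans (le_trans t4 H) t1); rewrite ltxx.
Qed.

Lemma fine_intervals_measure m a b (x y : 'I_m -> R) : fine_intervals a b x y ->
  mu (\big[setU/set0]_(k < m) `]x k, y k]%classic) = (\sum_k (y k - x k))%:E.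
Proof.
move=> xy; rewrite measure_bigsetU_ord//; last exact: fine_intervals_trivIset xy.
rewrite -sumEFin; apply: eq_bigr => k _.
have /and3P[_ + _] := xy.1 k; rewrite le_eqVlt => /predU1P[->|lt].
  by rewrite set_itv_ge ?bnd_simp ?ltxx// measure0 subrr.
etransitivity; first exact: lebesgue_measure_itv.
by rewrite /= lte_fin lt EFinB.
Qed.

Lemma fine_intervals_in_measure m a b (x y : 'I_m -> R) (U : set R) : measurable U ->
  fine_intervals a b x y -> (forall k, `]x k, y k]%classic `<=` U) ->
  ((\sum_k (y k - x k))%:E <= mu U)%E.
Proof.
move=> mU xy xyU; rewrite -(fine_intervals_measure xy).
apply: le_measure; rewrite ?inE//.
  by apply: bigsetU_measurable => k _; exact: measurable_itv.
by elim/big_ind: _ => // A B AU BU t [/AU|/BU].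
Qed.

(* Cousin's argument: a fine partition of [a, b] whose intervals either carry
   a small increment of f or lie in a small open neighbourhood of the null set. *)
Lemma abs_cont_constant a b f : a <= b -> abs_cont a b f ->
  {ae mu, forall x, a <= x <= b -> has_deriv a b f x 0} -> f b = f a.
Proof.
move=> ab /abs_contP acf [N [mN N0 subN]].
suff H (e : R) : 0 < e -> nrm (f b - f a) <= e * (b - a + 1).
  apply/eqP; rewrite -subr_eq0 -nrm_eq0 eq_le nrm_ge0 andbT.
  apply/ler_addgt0Pl => e e0; rewrite addr0.
  have ba0 : 0 < b - a + 1 by rewrite ltr_wpDl ?subr_ge0.
  have := H (e / (b - a + 1)) (divr_gt0 e0 ba0).
  by rewrite divfK// gt_eqF.
have {}N0 : mu N = 0%E := N0.
move=> e0; have [d d0 dP] := acf e e0.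
have [U [oU NU Ud]] : exists U, [/\ open U, N `<=` U & (mu U < d%:E)%E].
  have [|U [oU NU Ud]] := lebesgue_regularity_outer mN _ d0.
    exact: (@eq_ind_r _ 0%E (fun t => (t < +oo)%E) (ltry 0) _ N0).
  exists U; split=> //; rewrite (le_lt_trans _ Ud)//.
  have mU := open_measurable oU.
  rewrite [leLHS](_ : _ = mu ((U `\` N) `|` N)); last by rewrite setUC setDUK.
  rewrite (le_trans (measureU2 _ _ _))//; first exact: measurableD.
  by rewrite -[X in (_ + X <= _)%E]/(mu N) N0 adde0.
(* The newest interval stands at the head of [s], which fixes the order in [pairwise]. Increments
   outside [s] are charged to [e * (x - a)]; those over [s] total less than [e], because the measure
   of [U] is below [d]. *)
pose ok x (s : seq (R * R)) :=
  [/\ all (fun I => [&& a <= I.1, I.1 <= I.2 & I.2 <= x]) s,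
      pairwise (fun I J => J.2 <= I.1) s,
      (forall I, I \in s -> `]I.1, I.2]%classic `<=` U) &
      nrm (f x - f a) <= e * (x - a) + \sum_(I <- s) nrm (f I.2 - f I.1)].
suff [s [s1 s2 s3 s4]] : exists s, ok b s.
  apply: (le_trans s4); rewrite (mulrDr e (b - a)) mulr1 lerD2l.
  pose xs (k : 'I_(size s)) := (nth (a, a) s k).1.
  pose ys (k : 'I_(size s)) := (nth (a, a) s k).2.
  have fs : fine_intervals a b xs ys.
    split=> [k|k k' kk'].
      by move/(all_nthP (a, a)) : s1 => /(_ k (ltn_ord k)).
    move/(pairwiseP (a, a)) : s2 => s2.
    have [lt|gt|/val_inj eq] := ltngtP k k'; last by rewrite eq eqxx in kk'.
      by apply/orP; right; apply: s2 => //; rewrite inE /=; exact: ltn_ord.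
    by apply/orP; left; apply: s2 => //; rewrite inE /=; exact: ltn_ord.
  rewrite (big_nth (a, a)) big_mkord; apply/ltW/dP => //.
  rewrite -lte_fin; apply: le_lt_trans Ud.
  apply: (fine_intervals_in_measure (open_measurable oU) fs) => k.
  by apply: s3; exact: mem_nth.
pose S := [set x | a <= x <= b /\ exists s, ok x s].
have Sa : S a.
  split; first by rewrite lexx ab.
  by exists [::]; split=> //; rewrite !subrr nrm0 mulr0 big_nil addr0.
have supS : has_sup S by split; [exists a | exists b => x [/andP[]]].
pose c := sup S.
have ac : a <= c by apply: ub_le_sup => //; case: supS.
have cb : c <= b by apply: ge_sup; [exists a | move=> x [/andP[]]].
have cab : a <= c <= b by rewrite ac cb.
(* Passing across [c]: if [c] is in [U], the interval from p to q is added to [s]; otherwise [c] is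
   outside [N], and the zero derivative at [c] bounds the increment by e (q - p). *)
have [r r0 rP] : exists2 r : R, 0 < r & forall p q, a <= p -> p <= c -> c <= q -> q <= b ->
    c - r < p -> q < c + r -> (exists s, ok p s) -> exists s, ok q s.
  have [cU|cU] := pselect (U c).
    move: (open_nbhs_nbhs (conj oU cU)) => /nbhs_ballP[r/= r0 rU].
    exists r => // p q ap pc cq qb rp qr [s [s1 s2 s3 s4]].
    have pq := le_trans pc cq.
    exists ((p, q) :: s); split => /=.
    - rewrite ap pq lexx/=; apply: sub_all s1 => I /and3P[-> -> Ip] /=.
      exact: le_trans Ip pq.
    - by rewrite s2 andbT; apply: sub_all s1 => I /and3P[].
    - move=> I; rewrite inE => /predU1P[->|]; last exact: s3.
      move=> t /=; rewrite in_itv/= => /andP[pt tq]; apply: rU.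
      rewrite /ball/= ltr_distlC (lt_trans rp pt)/=.
      exact: le_lt_trans tq qr.
    - rewrite big_cons.
      rewrite (_ : f q - f a = (f q - f p) + (f p - f a)); last by rewrite addrA subrK.
      apply: (le_trans (nrmD _ _)).
      rewrite addrCA lerD2l; apply: (le_trans s4); apply: lerD => //.
      by rewrite ler_wpM2l ?lerD2r// ltW.
  have cN : ~ N c by move=> /NU.
  have hc : has_deriv a b f c 0.
    by apply: contrapT => H; apply: cN; apply: subN => /(_ cab).
  move/has_derivP : hc => /(_ e e0)[r r0 rP].
  exists r => // p q ap pc cq qb rp qr [s [s1 s2 s3 s4]].
  have pq := le_trans pc cq.
  exists s; split => //.
    by apply: sub_all s1 => I /and3P[-> -> Ip] /=; exact: le_trans Ip pq.
  rewrite (_ : f q - f a = (f q - f c) - (f p - f c) + (f p - f a)); last by ring.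
  apply: (le_trans (nrmD _ _)).
  have hq : nrm (f q - f c) <= e * (q - c).
    have := rP q; rewrite (le_trans ac cq) qb => /(_ isT).
    rewrite mul0r subr0 ger0_norm ?subr_ge0//; apply.
    by rewrite ltrBlDl.
  have hp : nrm (f p - f c) <= e * (c - p).
    have := rP p; rewrite (le_trans pc cb) ap => /(_ isT).
    rewrite mul0r subr0 distrC ger0_norm ?subr_ge0//; apply.
    by rewrite ltrBlDr -ltrBlDl.
  apply: (le_trans (lerD (nrmD _ _) s4)); rewrite nrmN addrA lerD2r.
  apply: (le_trans (lerD (lerD hq hp) (lexx _))).
  by rewrite le_eqVlt; apply/orP; left; apply/eqP; ring.
have [p [/andP[ap pb] Sp] pc] := sup_adherent r0 supS.
have p_le_c : p <= c.
  by apply: ub_le_sup; [case: supS | split; [rewrite ap pb|]].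
(* Since [q] is admissible, q <= sup S = c; this excludes c + r / 2 and leaves q = b. *)
pose q := Num.min b (c + r / 2).
have cq : c <= q by rewrite le_min cb lerDl divr_ge0// ltW.
have qb : q <= b by rewrite ge_min lexx.
have qr : q < c + r.
  by rewrite gt_min; apply/orP; right; rewrite ltrD2l ltr_pdivrMr// ltr_pMr// ltr1n.
have Sq := rP p q ap p_le_c cq qb pc qr Sp.
have q_le_c : q <= c.
  by apply: ub_le_sup; [case: supS | split => //; rewrite (le_trans ac cq) qb].
suff -> : b = q by [].
move: q_le_c; rewrite /q; case: (leP b (c + r / 2)) => // _.
by rewrite leNgt ltrDl divr_gt0.
Qed.

End LebesguePart.

(** * Solutions on an edge *)

Section PotentialPrimitive.
Context {R : realType}.
Notation mu := (@lebesgue_measure R).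

(** Extending [V] by 0 outside [A] gives a primitive that is continuous on the whole line, as the
    Picard iteration requires. Its absolute continuity is that of the integral; its derivative comes
    from Lebesgue differentiation. *)
Lemma integrable_primitive (A : set R) (V : R -> R) : measurable A ->
  mu.-integrable A (EFin \o V) ->
  exists P : R -> R,
  [/\ continuous P,
      forall a b, abs_cont a b (fun x => cplx (P x)) &
      {ae mu, forall x, A x -> is_derive x (1 : R) P (V x)}].
Proof.
move=> mA iV; pose W := V \_ A.
have iW : mu.-integrable setT (EFin \o W).
  rewrite /W -restrict_EFin; apply/(integrable_restrict mu mA measurableT).
  by rewrite setTI.
have iWA B : measurable B -> mu.-integrable B (EFin \o W).
  by move=> mB; apply: integrableS iW.
pose P x := (\int[mu]_(t in `]-oo, x]) W t).
have Pdiff x y : x <= y -> P y - P x = \int[mu]_(t in `]x, y]) W t.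
  move=> xy; rewrite /P.
  rewrite (@Rintegral_itvB _ W -oo%O (BRight y) x) ?bnd_simp//.
  exact: iWA.
have absP x y : x <= y -> `|P y - P x| <= \int[mu]_(t in `]x, y]) `|W t|.
  move=> xy; rewrite Pdiff//; apply: le_normr_Rintegral => //.
  exact: iWA.
have Psmall e : 0 < e -> exists2 d : R, 0 < d & forall B, measurable B ->
    (mu B < d%:E)%E -> \int[mu]_(t in B) `|W t| < e.
  move=> e0; have [d [d0 dP]] := integral_normr_continuous iW e0.
  by exists d.
have acP a b : abs_cont a b (fun x => cplx (P x)).
  apply/abs_contP => e e0; have [d d0 dP] := Psmall e e0.
  exists d => // m x y xy s.
  set B := \big[setU/set0]_(k < m) `]x k, y k]%classic.
  have mB : measurable B.
    by apply: bigsetU_measurable => k _; exact: measurable_itv.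
  have Bd : (mu B < d%:E)%E by rewrite (fine_intervals_measure xy) lte_fin.
  apply: le_lt_trans (dP B mB Bd).
  have -> : \int[mu]_(t in B) `|W t| = \sum_k \int[mu]_(t in `]x k, y k]) `|W t|.
    have iN C : measurable C -> mu.-integrable C (EFin \o (fun t => `|W t|)).
      by move=> mC; exact: (integrable_abse (iWA C mC)).
    have fN C : measurable C -> (\int[mu]_(t in C) `|W t|%:E)%E \is a fin_num.
      by move=> mC; exact: (integrable_fin_num mC (iN C mC)).
    apply: EFin_inj; rewrite -sumEFin /Rintegral fineK ?fN//.
    rewrite integral_bigsetU_EFin//.
    - by apply: eq_bigr => k _; rewrite fineK// fN.
    - exact: index_enum_uniq.
    - by apply: sub_trivIset (fine_intervals_trivIset xy).
    - by have /integrableP[] := iN B mB.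
  apply: ler_sum => k _; rewrite -cplxB nrm_cplx; apply: absP.
  by have /and3P[] := xy.1 k.
have cP : continuous P.
  move=> x; apply/cvgrPdist_lt => e e0.
  have [d d0 dP] := abs_cont_unif (acP (x - 1) (x + 1)) e0.
  have m0 : 0 < Num.min d 1 by rewrite lt_min d0 ltr01.
  apply/nbhs_ballP; exists (Num.min d 1) => //= y; rewrite /ball/= lt_min => /andP[yd y1].
  rewrite -nrm_cplx cplxB; apply: dP => //.
    by move: y1; rewrite ltr_distlC => /andP[/ltW-> /ltW->].
  by rewrite lerBlDr !lerDl ler01.
exists P; split => //.
have locW : locally_integrable setT W by apply: open_integrable_locally => //; exact: openT.
have := @FTC1Ny R W (fun y => iWA _ (measurable_itv `]-oo, y])) locW.
apply: filterS; first exact: (ae_filter_ringOfSetsType mu).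
move=> x [dP PE] Ax.
rewrite (_ : V x = 'D_1 P x); first exact/derivableP.
by rewrite -derive1E PE /W patchT// inE.
Qed.
End PotentialPrimitive.

(** * Strict monotonicity from a derivative that may have zeros *)

Section StrictMonotone.
Context {R : realType}.
Implicit Types (f g : R -> R) (a b : R).

Lemma continuous_near_neq0 g x : {for x, continuous g} -> g x != 0 ->
  exists2 r : R, 0 < r & forall y, `|y - x| <= r -> g y != 0.
Proof.
move=> cg gx.
have : \forall y \near x, g y != 0 by exact: cvgr_neq0 cg gx.
move=> /nbhs_ballP[r/= r0 rP]; exists (r / 2); first by rewrite divr_gt0.
move=> y yx; apply: rP; rewrite /ball/= distrC (le_lt_trans yx)//.
by rewrite ltr_pdivrMr// ltr_pMr// ltr1n.
Qed.

(** In the applications [g] contains the square of a solution and may vanish at points. Strictness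
    comes from a short interval around one point where [g] is nonzero. *)
Lemma is_derive_strict_decreasing f g a b : a < b ->
  (forall x, is_derive x (1 : R) f (- g x)) -> continuous g ->
  (forall x, a <= x <= b -> 0 <= g x) ->
  (exists2 x, a <= x <= b & g x != 0) -> f b < f a.
Proof.
move=> ab fg cg g0 [x /andP[ax xb] gx].
have Nf y : is_derive y (1 : R) (- f) (g y).
  by rewrite -[g y]opprK; apply: is_deriveN.
have mono y z : a <= y -> y <= z -> z <= b -> f z <= f y.
  move=> ay yz zb; rewrite -lerN2.
  apply: (is_derive_nondecreasing Nf yz) => t /andP[yt tz].
  by rewrite g0// (le_trans ay yt) (le_trans tz zb).
have gx0 : 0 < g x by rewrite lt_def gx g0// ax xb.
have [r r0 rP] := continuous_near_neq0 (cg x) gx.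
pose p := Num.max a (x - r); pose q := Num.min b (x + r).
have px : p <= x by rewrite ge_max ax gerBl ltW.
have xq : x <= q by rewrite le_min xb lerDl ltW.
have pq : p < q.
  rewrite /p /q gt_max !lt_min ab (le_lt_trans ax) ?ltrDl//=.
  by rewrite (lt_le_trans _ xb) ?gtrBl//= (lt_trans (y := x)) ?gtrBl ?ltrDl.
have ap : a <= p by rewrite le_max lexx.
have qb : q <= b by rewrite ge_min lexx.
have [c /andP[pc cq] E] := MVT_is_derive fg (ltW pq).
have gc : 0 < g c.
  rewrite lt_def g0 ?(le_trans ap pc) ?(le_trans cq qb)// andbT.
  apply: rP; rewrite ler_norml; apply/andP; split.
    by rewrite lerBrDl; apply: le_trans pc; rewrite le_max lexx orbT.
  by rewrite lerBlDl; apply: (le_trans cq); rewrite ge_min lexx orbT.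
have : f q - f p < 0 by rewrite E mulNr oppr_lt0 mulr_gt0 ?subr_gt0.
rewrite subr_lt0 => fqp.
apply: (le_lt_trans (mono q b _ qb (lexx b))); first exact: le_trans ap (ltW pq).
by apply: (lt_le_trans fqp); apply: mono => //; exact: le_trans (ltW pq) qb.
Qed.

Lemma is_derive_zero_itv f g a b : a < b ->
  (forall x, is_derive x (1 : R) f (g x)) -> continuous g ->
  (forall x, a <= x <= b -> f x = 0) -> g b = 0.
Proof.
move=> ab fg cg f0; apply: contrapT => /eqP gb.
have [r r0 rP] := continuous_near_neq0 (cg b) gb.
pose p := Num.max a (b - r).
have pb : p < b by rewrite gt_max ab gtrBl.
have ap : a <= p by rewrite le_max lexx.
have [c /andP[pc cb] E] := MVT_is_derive fg (ltW pb).
have : g c != 0.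
  apply: rP; rewrite distrC ger0_norm ?subr_ge0// lerBlDl -lerBlDr.
  by apply: le_trans pc; rewrite le_max lexx orbT.
move: E; rewrite (f0 b) ?(f0 p) ?ap ?(ltW pb) ?(ltW ab) ?lexx//.
by rewrite subrr => /esym/eqP; rewrite mulf_eq0 subr_eq0 (gt_eqF pb) orbF => ->.
Qed.

End StrictMonotone.

(** * Wronskian and Riccati inequalities on an edge *)

Section RealSolutions.
Context {R : realType}.
Variables (P : R -> R) (c p q : R) (a b : nat -> R -> R).
Hypotheses (cP : continuous P) (fam : coef_family P c p q a b).
Implicit Types (w : nat -> R).

Let da : decays a. Proof. by case: fam => _ _ _ _ []. Qed.
Let db : decays b. Proof. by case: fam => _ _ _ _ []. Qed.

Lemma wsum_base w : wsum w a c = w 0%N * p /\ wsum w b c = w 0%N * q.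
Proof.
case: fam => _ _ [a0 b0] abS _.
have H (F : nat -> R -> R) r : F 0%N c = r -> (forall k, F k.+1 c = 0) ->
    wsum w F c = w 0%N * r.
  move=> F0 FS; rewrite /wsum; apply/cvg_lim => //.
  rewrite -(cvg_shiftS (series _)).
  apply: cvg_near_cst; apply: nearW => n /=.
  rewrite /series/= big_nat_recl//= F0 big1 ?addr0// => k _.
  by rewrite FS mulr0.
by split; apply: H => // k; have [] := abS k.
Qed.

Lemma is_derive_wsum_u w x : subgeom w ->
  is_derive x (1 : R) (wsum w a) (P x * wsum w a x + wsum w b x).
Proof.
move=> sw; case: fam => aE _ _ _ _.
have := @is_derive_wsum R w a _ x sw da (decaysD (decaysM cP da) db) aE.
by rewrite wsumDr ?wsumMr//; exact: decaysM.
Qed.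

Lemma is_derive_wsum_v w x : subgeom w ->
  is_derive x (1 : R) (wsum w b)
    (- (P x ^+ 2 * wsum w a x) - P x * wsum w b x - wsum (fun k => w k.+1) a x).
Proof.
move=> sw; case: fam => _ bE _ _ _.
have cP2 : continuous (fun x => P x ^+ 2).
  by move=> y; apply: cvgM; exact: cP.
have d1 := decaysN (decaysM cP2 da); have d2 := decaysN (decaysM cP db).
have d3 := decaysN (decays_lag da).
have := @is_derive_wsum R w b _ x sw db (decaysD (decaysD d1 d2) d3) bE.
rewrite wsumDr//; last exact: decaysD.
rewrite wsumDr// !wsumNr//; try exact: decays_lag; try exact: decaysM.
by rewrite !wsumMr// wsum_lag.
Qed.

Lemma continuous_wsum_u w : subgeom w -> continuous (wsum w a).
Proof. by move=> sw x; apply: is_derive_continuous (is_derive_wsum_u x sw). Qed.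

Lemma continuous_wsum_v w : subgeom w -> continuous (wsum w b).
Proof. by move=> sw x; apply: is_derive_continuous (is_derive_wsum_v x sw). Qed.

Lemma continuous_wsum_du w : subgeom w ->
  continuous (fun x => P x * wsum w a x + wsum w b x).
Proof.
move=> sw x; apply: cvgD; last exact: continuous_wsum_v.
by apply: cvgM; [exact: cP|exact: continuous_wsum_u].
Qed.

Section BasedAtRightEnd.
Variable lo : R.
Hypotheses (loc : lo < c) (pq : (p != 0) || (q != 0)).

(** As u' = P u + v, vanishing on the whole edge would force both data at [c] to be 0. Only the term
    k = 0 contributes to these data, so the argument covers the weights Re z^k as well. *)
Lemma wsum_not_zero w : subgeom w -> w 0%N != 0 ->
  exists2 x, lo <= x <= c & wsum w a x != 0.
Proof.
move=> sw w0; apply: contrapT => H.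
have a0 x : lo <= x <= c -> wsum w a x = 0.
  by move=> xc; apply/eqP/negPn/negP => ax; apply: H; exists x.
have := is_derive_zero_itv loc (fun x => is_derive_wsum_u x sw)
  (continuous_wsum_du sw) a0.
have ac : wsum w a c = 0 by rewrite a0// lexx ltW.
have [aE bE] := wsum_base w.
rewrite ac mulr0 add0r bE => /eqP; rewrite mulf_eq0 (negPf w0)/= => /eqP q0.
move: ac; rewrite aE => /eqP; rewrite mulf_eq0 (negPf w0)/= => /eqP p0.
by move: pq; rewrite p0 q0 eqxx.
Qed.

Lemma subgeom_exp (t : R) : subgeom (fun k => t ^+ k).
Proof. by exists 1, `|t|; split=> // k; rewrite mul1r normrX. Qed.

Lemma subgeom_dpow (t : R) : subgeom (dpow t).
Proof.
have E k : dpow (cplx t) k = cplx (dpow t k).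
  by elim: k => //= k ->; rewrite cplxD cplxM cplxX.
have [K [r [r0 H]]] := csubgeom_dpow (cplx t).
by exists K, r; split=> // k; rewrite -nrm_cplx -E.
Qed.

Lemma wsum_exp_shift (t : R) x :
  wsum (fun k => t ^+ k.+1) a x = t * wsum (fun k => t ^+ k) a x.
Proof.
rewrite -wsumMl//; last exact: subgeom_exp.
by congr (wsum _ _ _); apply/funext => k; rewrite exprS.
Qed.

Lemma wsum_dpow_shift (t : R) x :
  wsum (fun k => dpow t k.+1) a x = t * wsum (dpow t) a x + wsum (fun k => t ^+ k) a x.
Proof.
have s1 := subgeom_dpow t; have s2 := subgeom_exp t.
rewrite -wsumMl// -wsumDl//; exact: subgeomZ.
Qed.

(** With dots for derivatives in t, the Lagrange identity gives that the x-derivative of u v. - v u.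
    is - u^2. The bracket is 0 at [c], where the data do not depend on t, so at [lo] it is the
    integral of u^2. *)
Lemma wronskian_dpow_gt0 (t : R) :
  0 < wsum (fun k => t ^+ k) a lo * wsum (dpow t) b lo
    - wsum (fun k => t ^+ k) b lo * wsum (dpow t) a lo.
Proof.
have s1 := subgeom_dpow t; have s2 := subgeom_exp t.
set u := wsum (fun k => t ^+ k) a; set v := wsum (fun k => t ^+ k) b.
set u1 := wsum (dpow t) a; set v1 := wsum (dpow t) b.
have [u1c v1c] := wsum_base (dpow t).
have D x : is_derive x (1 : R) (fun x => u x * v1 x - v x * u1 x) (- (u x ^+ 2)).
  apply: is_derive_ext (is_deriveB
    (is_deriveM (is_derive_wsum_u x s2) (is_derive_wsum_v x s1))
    (is_deriveM (is_derive_wsum_v x s2) (is_derive_wsum_u x s1))) _ _ => //.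
  by rewrite wsum_exp_shift wsum_dpow_shift /GRing.scale/= -/u -/v -/u1 -/v1; ring.
have cu : continuous (fun x => u x ^+ 2).
  by move=> x; apply: cvgM; exact: (continuous_wsum_u s2).
have := is_derive_strict_decreasing loc D cu.
rewrite /u1 /v1 u1c v1c /= !mul0r !mulr0 subrr; apply.
  by move=> x _; exact: sqr_ge0.
have [x xc ux] := wsum_not_zero s2 (oner_neq0 R).
by exists x => //; rewrite sqrf_eq0.
Qed.

(** A Riccati comparison: for t far below 0 the function - (u v + rho u^2) is strictly decreasing
    and vanishes at [c], hence is positive at [lo], where rho = - m. Strictness also excludes u(lo)
    = 0. *)
Lemma eventually_negative (m : R) : exists K : R, forall t : R, t < K ->
  wsum (fun k => t ^+ k) a lo != 0 /\
  wsum (fun k => t ^+ k) a lo * wsum (fun k => t ^+ k) b lo <=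
    m * wsum (fun k => t ^+ k) a lo ^+ 2.
Proof.
(* [rho] is the linear function with the value - m at [lo] and - q / p at [c]; the latter makes u v
   + rho u^2 vanish at [c]. *)
pose r1 := - q / p; pose s := (r1 + m) / (c - lo).
pose rho x := s * (x - lo) - m.
have crho : continuous rho.
  by move=> x; apply: cvgB; [apply: cvgM; [exact: cvg_cst|apply: cvgB; [exact: cvg_id|exact: cvg_cst]]|exact: cvg_cst].
have cF : continuous (fun x => P x ^+ 2 - s - 2 * rho x * P x + rho x ^+ 2).
  move=> x; apply: cvgD; last by apply: cvgM; exact: crho.
  apply: cvgB; last by apply: cvgM; [apply: cvgM; [exact: cvg_cst|exact: crho]|exact: cP].
  by apply: cvgB; [apply: cvgM; exact: cP|exact: cvg_cst].
have [M M0 MP] := continuous_locally_bounded (Num.max `|lo| `|c|) cF.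
exists (- M) => t tM; have st := subgeom_exp t.
set u := wsum (fun k => t ^+ k) a; set v := wsum (fun k => t ^+ k) b.
pose F x := P x ^+ 2 - s - 2 * rho x * P x + rho x ^+ 2.
(* The derivative of u v + rho u^2 after completing the square; for t < - M neither term is
   negative. *)
pose G x := (v x + rho x * u x) ^+ 2 + (- t - F x) * u x ^+ 2.
have D x : is_derive x (1 : R) (fun x => - (u x * v x + rho x * (u x * u x))) (- G x).
  have drho : is_derive x (1 : R) rho s.
    apply: is_derive_ext (is_deriveB (is_deriveZ s (is_deriveB (is_derive_id x (1 : R))
       (is_derive_cst lo x (1 : R)))) (is_derive_cst m x (1 : R))) _ _ => //.
    by rewrite /GRing.scale/= !subr0 mulr1.
  have du := is_derive_wsum_u x st; have dv := is_derive_wsum_v x st.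
  apply: is_derive_ext (is_deriveN (is_deriveD (is_deriveM du dv)
     (is_deriveM drho (is_deriveM du du)))) _ _ => //.
  by rewrite wsum_exp_shift /G /F /GRing.scale/= -/u -/v -[(u * u) x]/(u x * u x); ring.
have cu : continuous u := continuous_wsum_u st.
have cv : continuous v := continuous_wsum_v st.
have cG : continuous G.
  move=> x; apply: cvgD.
    by apply: cvgM; apply: cvgD; try exact: cv; apply: cvgM; by [exact: crho|exact: cu].
  apply: cvgM; last by apply: cvgM; exact: cu.
  by apply: cvgB; [exact: cvg_cst|exact: cF].
have F0 x : lo <= x <= c -> 0 < - t - F x.
  move=> /andP[lx xc]; rewrite subr_gt0; apply: (le_lt_trans (ler_norm _)).
  apply: (@le_lt_trans _ _ M); last by rewrite ltrNr.
  apply: MP; rewrite ler_norml le_max; apply/andP; split.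
    by rewrite lerNl le_max (@le_trans _ _ (- lo)) ?lerN2// -normrN ler_norm.
  by rewrite (le_trans xc (ler_norm _)) orbT.
have [x xc ux] := wsum_not_zero st (oner_neq0 R).
have := is_derive_strict_decreasing loc D cG.
have [uc vc] := wsum_base (fun k => t ^+ k).
have -> : - (u c * v c + rho c * (u c * u c)) = 0.
  rewrite /u /v uc vc expr0 !mul1r /rho /s divfK ?subr_eq0 ?gt_eqF//.
  (* For p = 0 the quotient [r1] is 0 by convention, and the value vanishes because u(c) = 0. *)
  rewrite addrK /r1; have [->|p0] := eqVneq p 0; first by rewrite !(mul0r, mulr0) addr0 oppr0.
  by field.
rewrite /rho subrr mulr0 sub0r => H.
have {}H : u lo * v lo < m * u lo ^+ 2.
  rewrite -subr_gt0 (_ : _ - _ = - (u lo * v lo + - m * (u lo * u lo))); last by ring.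
  apply: H.
    by move=> y yc; rewrite addr_ge0 ?sqr_ge0// mulr_ge0 ?sqr_ge0// ltW// F0.
  exists x => //; rewrite gt_eqF// ltr_wpDl ?sqr_ge0// mulr_gt0 ?F0//.
  by rewrite lt_def sqr_ge0 andbT sqrf_eq0.
split; last exact: ltW.
by apply/eqP => u0; move: H; rewrite u0 mul0r expr0n/= mulr0 ltxx.
Qed.

End BasedAtRightEnd.
End RealSolutions.

(** * Solutions at complex z: Wronskians and the power series family *)

Section ComplexSolutions.
Context {R : realType}.
Notation mu := (@lebesgue_measure R).
Notation Re := (@complex.Re R).
Notation Im := (@complex.Im R).
Implicit Types (V : R -> R) (a b : R) (z : Cx R) (u du : R -> Cx R).

Definition solves V a b z u du : Prop :=
  [/\ abs_cont a b u, abs_cont a b du,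
      forall x, a <= x <= b -> has_deriv a b u x (du x) &
      {ae mu, forall x, a <= x <= b -> exists2 d2, has_deriv a b du x d2 &
        - d2 + cplx (V x) * u x = z * u x}].

Lemma solves_lin V a b z u du w dw (c d : Cx R) : solves V a b z u du ->
  solves V a b z w dw ->
  solves V a b z (fun x => c * u x + d * w x) (fun x => c * du x + d * dw x).
Proof.
move=> [u1 u2 u3 u4] [w1 w2 w3 w4]; split.
- by apply: abs_contD; apply: abs_contZ.
- by apply: abs_contD; apply: abs_contZ.
- by move=> x xab; apply: has_derivD; apply: has_derivZ; [exact: u3|exact: w3].
move: u4 w4; apply: filterS2; first exact: (ae_filter_ringOfSetsType mu).
move=> x ux wx xab; have [d2 D E] := ux xab; have [e2 D' E'] := wx xab.
exists (c * d2 + d * e2); first by apply: has_derivD; apply: has_derivZ.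
rewrite (_ : z * _ = c * (z * u x) + d * (z * w x)); last by ring.
by rewrite -E -E'; ring.
Qed.

Lemma solves_sub V a b a' b' z u du : a <= a' -> b' <= b -> solves V a b z u du ->
  solves V a' b' z u du.
Proof.
move=> aa bb [u1 u2 u3 u4].
have sub x : a' <= x <= b' -> a <= x <= b.
  by move=> /andP[ax xb]; rewrite (le_trans aa ax) (le_trans xb bb).
split.
- exact: (abs_cont_sub aa bb u1).
- exact: (abs_cont_sub aa bb u2).
- by move=> x xab; exact: (has_deriv_sub aa bb (u3 x (sub x xab))).
move: u4; apply: filterS; first exact: (ae_filter_ringOfSetsType mu).
move=> x ux xab; have [d2 D E] := ux (sub x xab).
by exists d2 => //; exact: (has_deriv_sub aa bb D).
Qed.

(** The terms with V and z cancel in u w'' - u'' w, so the Wronskian is absolutely continuous with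
    derivative 0 almost everywhere. *)
Lemma solves_wronskian V a b z u du w dw : a <= b ->
  solves V a b z u du -> solves V a b z w dw ->
  u a * dw a - du a * w a = u b * dw b - du b * w b.
Proof.
move=> ab [u1 u2 u3 u4] [w1 w2 w3 w4].
pose W x := u x * dw x + - 1 * (du x * w x).
have WE x : u x * dw x - du x * w x = W x by rewrite /W mulN1r.
rewrite !WE; apply/esym; apply: abs_cont_constant => //.
  by apply: abs_contD; [exact: abs_contM|apply: abs_contZ; exact: abs_contM].
move: u4 w4; apply: filterS2; first exact: (ae_filter_ringOfSetsType mu).
move=> x ux wx xab; have [d2 D E] := ux xab; have [e2 D' E'] := wx xab.
have := has_derivD (has_derivM (u3 x xab) D')
  (has_derivZ (- 1) (has_derivM D (w3 x xab))).
congr (has_deriv _ _ _ _ _).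
have -> : d2 = cplx (V x) * u x - z * u x by rewrite -E; ring.
have -> : e2 = cplx (V x) * w x - z * w x by rewrite -E'; ring.
by ring.
Qed.

Section Family.
Variables (V : R -> R) (a b c p q : R) (P : R -> R) (al be : nat -> R -> R).
Hypotheses (cP : continuous P) (acP : abs_cont a b (fun x => cplx (P x))).
Hypothesis dP : {ae mu, forall x, a <= x <= b -> is_derive x (1 : R) P (V x)}.
Hypothesis fam : coef_family P c p (q - P c * p) al be.

Let da : decays al. Proof. by case: fam => _ _ _ _ []. Qed.
Let db : decays be. Proof. by case: fam => _ _ _ _ []. Qed.

Definition fam_u x z := csum (fun k => z ^+ k) al x.
Definition fam_v x z := csum (fun k => z ^+ k) be x.
(** [fam_v] plays the part of u' - P u, hence its value [q - P c * p] at [c] in the hypothesis on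
    the coefficients. *)
Definition fam_du x z := cplx (P x) * fam_u x z + fam_v x z.

Let sR z := csubgeom_Re (csubgeom_pow z).
Let sI z := csubgeom_Im (csubgeom_pow z).

Lemma csum_eta d F x : csum d F x =
  cplx (wsum (fun k => Re (d k)) F x) + 'i%C * cplx (wsum (fun k => Im (d k)) F x).
Proof. exact: complex_eta. Qed.

Lemma fam_base z : fam_u c z = cplx p /\ fam_du c z = cplx q.
Proof.
have [u1 v1] := wsum_base fam (fun k => Re (z ^+ k)).
have [u2 v2] := wsum_base fam (fun k => Im (z ^+ k)).
have uE : fam_u c z = cplx p.
  by rewrite /fam_u csum_eta u1 u2 expr0 /= mul1r mul0r cplx0 mulr0 addr0.
split=> //; rewrite /fam_du uE /fam_v csum_eta v1 v2 expr0 /= mul1r mul0r cplx0 mulr0 addr0.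
by rewrite -cplxM -cplxD addrC subrK.
Qed.

Lemma has_deriv_fam_u x z : has_deriv a b (fam_u^~ z) x (fam_du x z).
Proof.
have D1 := has_deriv_cplx a b (is_derive_wsum_u cP fam x (sR z)).
have D2 := has_deriv_cplx a b (is_derive_wsum_u cP fam x (sI z)).
have := has_derivD D1 (has_derivZ 'i%C D2).
rewrite /fam_u; under [X in _ -> has_deriv _ _ X _ _]eq_fun do rewrite csum_eta.
congr (has_deriv _ _ _ _ _); rewrite /fam_du /fam_u /fam_v !csum_eta !cplxD !cplxM.
by ring.
Qed.

Lemma has_deriv_fam_v x z : has_deriv a b (fam_v^~ z) x
  (- (cplx (P x) ^+ 2 * fam_u x z) - cplx (P x) * fam_v x z - z * fam_u x z).
Proof.
have D1 := has_deriv_cplx a b (is_derive_wsum_v cP fam x (sR z)).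
have D2 := has_deriv_cplx a b (is_derive_wsum_v cP fam x (sI z)).
have := has_derivD D1 (has_derivZ 'i%C D2).
rewrite /fam_v; under [X in _ -> has_deriv _ _ X _ _]eq_fun do rewrite csum_eta.
congr (has_deriv _ _ _ _ _).
have -> : z * fam_u x z = csum (fun k => z ^+ k.+1) al x.
  by rewrite -csumZ//; [congr (csum _ _ _); apply/funext => k; rewrite exprS|exact: csubgeom_pow].
rewrite /fam_u !csum_eta !cplxD !cplxN !cplxM ?cplxX.
by ring.
Qed.

Lemma abs_cont_csum_u z : abs_cont a b (fam_u^~ z).
Proof.
rewrite /fam_u; under eq_fun do rewrite csum_eta.
have C w (sw : subgeom w) := abs_cont_C1 a b (continuous_wsum_du cP fam sw)
  (fun x => is_derive_wsum_u cP fam x sw).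
exact: (abs_contD (C _ (sR z)) (abs_contZ _ (C _ (sI z)))).
Qed.

Lemma abs_cont_csum_v z : abs_cont a b (fam_v^~ z).
Proof.
have cont (w : nat -> R) : subgeom w -> continuous (fun x =>
   - (P x ^+ 2 * wsum w al x) - P x * wsum w be x - wsum (fun k => w k.+1) al x).
  move=> sw x; apply: cvgB; last exact: (continuous_wsum_u cP fam (subgeom_shift sw)).
  apply: cvgB.
    apply: cvgN; apply: cvgM; last exact: (continuous_wsum_u cP fam sw).
    by apply: cvgM; exact: cP.
  by apply: cvgM; [exact: cP | exact: (continuous_wsum_v cP fam sw)].
rewrite /fam_v; under eq_fun do rewrite csum_eta.
have C w (sw : subgeom w) := abs_cont_C1 a b (cont w sw)
  (fun x => is_derive_wsum_v cP fam x sw).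
exact: (abs_contD (C _ (sR z)) (abs_contZ _ (C _ (sI z)))).
Qed.

(** Here [V] returns: almost everywhere (P u + v)' = V u + P u' + v', and inserting u' and v' leaves
    (V - z) u. *)
Lemma solves_fam z : solves V a b z (fam_u^~ z) (fam_du^~ z).
Proof.
split.
- exact: abs_cont_csum_u.
- apply: abs_contD; last exact: abs_cont_csum_v.
  by apply: abs_contM => //; exact: abs_cont_csum_u.
- by move=> x _; exact: has_deriv_fam_u.
move: dP; apply: filterS; first exact: (ae_filter_ringOfSetsType mu).
move=> x Px xab; have DP := has_deriv_cplx a b (Px xab).
eexists.
  exact (has_derivD (has_derivM DP (@has_deriv_fam_u x z)) (@has_deriv_fam_v x z)).
by rewrite /fam_du; ring.
Qed.

End Family.
End ComplexSolutions.

(** * Existence, uniqueness and Herglotz properties on one edge *)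

Section EdgeSolutions.
Context {R : realType}.
Notation mu := (@lebesgue_measure R).
Notation Re := (@complex.Re R).
Notation Im := (@complex.Im R).
Implicit Types (V : R -> R) (a b p q : R) (z : Cx R).

Definition edge (a b : R) : set R := [set x | a <= x <= b].

Lemma edgeE a b : edge a b = `[a, b]%classic.
Proof. by apply/seteqP; split=> x /=; rewrite in_itv. Qed.

Lemma measurable_edge a b : measurable (edge a b).
Proof. by rewrite edgeE; exact: measurable_itv. Qed.

Lemma solves_exists V a b c p q z : mu.-integrable (edge a b) (EFin \o V) ->
  exists u du, [/\ solves V a b z u du, u c = cplx p & du c = cplx q].
Proof.
move=> iV; have [P [cP acP dP]] := integrable_primitive (measurable_edge a b) iV.
have [al [be fam]] := coef_family_exists c p (q - P c * p) cP.
have [E1 E2] := fam_base fam z.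
exists (fam_u al^~ z), (fam_du P al be ^~ z); split=> //.
exact: (solves_fam cP (acP a b) dP fam z).
Qed.

(** Uniqueness without Gronwall's inequality: the Wronskian with the solution having data (p, q) at
    [x] is 0 at [b], hence at [x]. The data (0, 1) and (1, 0) isolate [u x] and [du x]. *)
Lemma solves_zero V a b z u du : mu.-integrable (edge a b) (EFin \o V) ->
  solves V a b z u du -> u b = 0 -> du b = 0 ->
  forall x, a <= x <= b -> u x = 0 /\ du x = 0.
Proof.
move=> iV S ub dub x /andP[ax xb].
have W p q : cplx q * u x = cplx p * du x.
  have [w [dw [S' wx dwx]]] := solves_exists x p q z iV.
  have := solves_wronskian xb (solves_sub ax (lexx b) S) (solves_sub ax (lexx b) S').
  rewrite ub dub !mul0r subrr wx dwx => /eqP; rewrite subr_eq0 => /eqP.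
  by rewrite mulrC => ->; rewrite mulrC.
split; first by have := W 0 1; rewrite cplx1 cplx0 mul1r mul0r.
by have := W 1 0; rewrite cplx1 cplx0 mul1r mul0r.
Qed.

Lemma solves_unique V a b z u du w dw : mu.-integrable (edge a b) (EFin \o V) ->
  solves V a b z u du -> solves V a b z w dw -> u b = w b -> du b = dw b ->
  forall x, a <= x <= b -> u x = w x /\ du x = dw x.
Proof.
move=> iV Su Sw E1 E2 x xab.
have S := solves_lin 1 (- 1) Su Sw.
have B1 : 1 * u b + - 1 * w b = 0 by rewrite E1 mul1r mulN1r subrr.
have B2 : 1 * du b + - 1 * dw b = 0 by rewrite E2 mul1r mulN1r subrr.
have [/eqP] := solves_zero iV S B1 B2 xab.
rewrite !mul1r !mulN1r subr_eq0 => /eqP -> /eqP.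
by rewrite subr_eq0 => /eqP ->.
Qed.

(** Stated without division, [es_smooth], [es_nonreal] and [es_negative] say that u' / u at [a] is a
    Herglotz function of z: it increases on the real axis away from its poles, its imaginary part
    has the sign of that of z, and it tends to - oo with z. *)
Record edge_solution V a b p q (u du : R -> Cx R -> Cx R) : Prop := EdgeSolution {
  es_solves : forall z, solves V a b z (u^~ z) (du^~ z);
  es_base : forall z, u b z = cplx p;
  es_dbase : forall z, du b z = cplx q;
  es_smooth : exists U1 DU1 : Cx R -> Cx R,
    [/\ forall t, smooth_at (u a) t (U1 t),
        forall t, smooth_at (du a) t (DU1 t) &
        forall t : R, exists r s r1 s1 : R,
          [/\ u a (cplx t) = cplx r, du a (cplx t) = cplx s,
              U1 (cplx t) = cplx r1, DU1 (cplx t) = cplx s1 &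
              0 < r * s1 - s * r1]];
  es_nonreal : forall z, Im z != 0 ->
    0 < Im z * (Re (u a z) * Im (du a z) - Im (u a z) * Re (du a z));
  es_negative : forall m : R, exists K : R, forall t : R, t < K -> exists r s : R,
    [/\ u a (cplx t) = cplx r, du a (cplx t) = cplx s, r != 0 & r * s <= m * r ^+ 2];
  es_nonzero : forall z, exists2 x, a <= x <= b & u x z != 0 }.

Lemma csum_real (w : nat -> R) (F : nat -> R -> R) x :
  csum (fun k => cplx (w k)) F x = cplx (wsum w F x).
Proof.
apply: complex_ext => //=; rewrite /wsum.
rewrite (_ : (fun k => _) = cst 0); last by apply/funext => k; rewrite /= mul0r.
apply/cvg_lim => //; rewrite (_ : series _ = cst 0); first exact: cvg_cst.
by apply/funext => n; rewrite /series/= big1.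
Qed.

Lemma dpow_cplx (t : R) k : dpow (cplx t) k = cplx (dpow t k).
Proof. by elim: k => //= k ->; rewrite cplxD cplxM cplxX. Qed.

Lemma edge_solution_exists V a b p q : a < b -> mu.-integrable (edge a b) (EFin \o V) ->
  (p != 0) || (q != 0) -> exists u du, edge_solution V a b p q u du.
Proof.
move=> ab iV pq; have [P [cP acP dP]] := integrable_primitive (measurable_edge a b) iV.
pose q' := q - P b * p.
have [al [be fam]] := coef_family_exists b p q' cP.
have pq' : (p != 0) || (q' != 0).
  by rewrite /q'; case: eqVneq pq => //= ->; rewrite mulr0 subr0.
have da : decays al by case: fam => _ _ _ _ [].
have db : decays be by case: fam => _ _ _ _ [].
have uR t x : fam_u al x (cplx t) = cplx (wsum (fun k => t ^+ k) al x).
  by rewrite -csum_real; congr (csum _ _ _); apply/funext => k; rewrite cplxX.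
have vR t x : fam_v be x (cplx t) = cplx (wsum (fun k => t ^+ k) be x).
  by rewrite -csum_real; congr (csum _ _ _); apply/funext => k; rewrite cplxX.
have duR t x : fam_du P al be x (cplx t) =
    cplx (P x * wsum (fun k => t ^+ k) al x + wsum (fun k => t ^+ k) be x).
  by rewrite /fam_du uR vR -cplxM -cplxD.
exists (fam_u al), (fam_du P al be); split.
- by move=> z; exact: (solves_fam cP (acP a b) dP fam z).
- by move=> z; have [] := fam_base fam z.
- by move=> z; have [] := fam_base fam z.
- pose U1 t := csum (dpow t) al a; pose V1 t := csum (dpow t) be a.
  exists U1, (fun t => cplx (P a) * U1 t + 1 * V1 t); split.
  + by move=> t; exact: csum_smooth.
  + move=> t; have := smooth_lin (cplx (P a)) 1 (csum_smooth a t da) (csum_smooth a t db).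
    by rewrite /fam_du; under eq_fun do rewrite mul1r.
  + move=> t; have := wronskian_dpow_gt0 cP fam ab pq' t.
    set u := wsum _ al a; set v1 := wsum _ be a; set v := wsum _ be a; set u1 := wsum _ al a.
    move=> H; exists u, (P a * u + v), u1, (P a * u1 + v1); split.
    * exact: uR.
    * exact: duR.
    * by rewrite /U1 -csum_real; congr (csum _ _ _); apply/funext => k; rewrite dpow_cplx.
    * rewrite mul1r cplxD cplxM; congr (_ * _ + _).
        by rewrite /U1 -csum_real; congr (csum _ _ _); apply/funext => k; rewrite dpow_cplx.
      by rewrite /V1 -csum_real; congr (csum _ _ _); apply/funext => k; rewrite dpow_cplx.
    * by rewrite (_ : _ - _ = u * v1 - v * u1) //; ring.
- move=> z z0.
  have sR := csubgeom_Re (csubgeom_pow z); have sI := csubgeom_Im (csubgeom_pow z).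
  pose ur := wsum (fun k => Re (z ^+ k)) al; pose ui := wsum (fun k => Im (z ^+ k)) al.
  pose vr := wsum (fun k => Re (z ^+ k)) be; pose vi := wsum (fun k => Im (z ^+ k)) be.
  (* The terms with [P] cancel because [P] is real. *)
  rewrite (_ : _ - _ = ur a * vi a - ui a * vr a); last first.
    by rewrite /fam_du cReD cImD cReM cImM /= -/(ur a) -/(ui a) -/(vr a) -/(vi a); ring.
  have shR x : wsum (fun k => Re (z ^+ k.+1)) al x = Re z * ur x - Im z * ui x.
    rewrite -[LHS]/(Re (csum (fun k => z ^+ k.+1) al x)).
    rewrite (_ : (fun k => _) = (fun k => z * z ^+ k)); last by apply/funext => k; rewrite exprS.
    by rewrite csumZ//; [rewrite cReM|exact: csubgeom_pow].
  have shI x : wsum (fun k => Im (z ^+ k.+1)) al x = Re z * ui x + Im z * ur x.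
    rewrite -[LHS]/(Im (csum (fun k => z ^+ k.+1) al x)).
    rewrite (_ : (fun k => _) = (fun k => z * z ^+ k)); last by apply/funext => k; rewrite exprS.
    by rewrite csumZ//; [rewrite cImM|exact: csubgeom_pow].
  (* The Lagrange identity for u and its conjugate; the bracket is 0 at [b], where the data are
     real. *)
  have D x : is_derive x (1 : R) (fun x => Im z * (ur x * vi x - ui x * vr x))
      (- (Im z ^+ 2 * (ur x ^+ 2 + ui x ^+ 2))).
    apply: is_derive_ext (is_deriveZ (Im z) (is_deriveB
      (is_deriveM (is_derive_wsum_u cP fam x sR) (is_derive_wsum_v cP fam x sI))
      (is_deriveM (is_derive_wsum_u cP fam x sI) (is_derive_wsum_v cP fam x sR)))) _ _ => //.
    by rewrite shR shI /GRing.scale/= -/ur -/ui -/vr -/vi; ring.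
  have cG : continuous (fun x => Im z ^+ 2 * (ur x ^+ 2 + ui x ^+ 2)).
    have cr : continuous ur := continuous_wsum_u cP fam sR.
    have ci : continuous ui := continuous_wsum_u cP fam sI.
    move=> x; apply: cvgM; first exact: cvg_cst.
    by apply: cvgD; apply: cvgM; [exact: cr|exact: cr|exact: ci|exact: ci].
  have := is_derive_strict_decreasing ab D cG.
  have [urb vrb] := wsum_base fam (fun k => Re (z ^+ k)).
  have [uib vib] := wsum_base fam (fun k => Im (z ^+ k)).
  rewrite /ur /ui /vr /vi urb vrb uib vib expr0 /= !mul0r mulr0 subrr mulr0; apply.
    by move=> x _; rewrite mulr_ge0 ?addr_ge0 ?sqr_ge0.
  have [x xab ux] := wsum_not_zero cP fam ab pq' sR (oner_neq0 R).
  exists x => //; rewrite mulf_neq0 ?expf_neq0// gt_eqF// ltr_wpDr ?sqr_ge0//.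
  by rewrite lt_def sqr_ge0 andbT sqrf_eq0.
(* Since u u' = P u^2 + u v, the bound [m] for u u' amounts to [m - P a] for u v. *)
- move=> m; have [K KP] := eventually_negative cP fam ab pq' (m - P a).
  exists K => t tK; have [u0 H] := KP t tK.
  set u := wsum _ al a in u0 H *; set v := wsum _ be a in H *.
  exists u, (P a * u + v); split=> //.
  rewrite -subr_ge0 (_ : _ - _ = (m - P a) * u ^+ 2 - u * v); last by ring.
  by rewrite subr_ge0.
- move=> z; have [x xab ux] := wsum_not_zero cP fam ab pq' (csubgeom_Re (csubgeom_pow z)) (oner_neq0 R).
  exists x => //; apply: contraNneq ux => u0.
  by rewrite -[wsum _ _ _]/(Re (fam_u al x z)) u0.
Qed.

End EdgeSolutions.

(** * Determinants of entire matrices *)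

Local Open Scope sesquilinear_scope.

Section HolomorphicDeterminants.
Context {R : realType}.
Notation C := (Cx R).

Lemma entire_cst (c : C) : entire (fun=> c).
Proof. by move=> z; exact: derivable_cst. Qed.

Lemma entireD (f g : C -> C) : entire f -> entire g -> entire (fun z => f z + g z).
Proof. by move=> ef eg z; exact: cderivableD (ef z) (eg z). Qed.

Lemma entireM (f g : C -> C) : entire f -> entire g -> entire (fun z => f z * g z).
Proof. by move=> ef eg z; exact: cderivableM (ef z) (eg z). Qed.

Lemma entire_sum (I : Type) (s : seq I) (f : I -> C -> C) :
  (forall i, entire (f i)) -> entire (fun z => \sum_(i <- s) f i z).
Proof.
move=> ef; elim: s => [|i s IH].
  by under eq_fun do rewrite big_nil; exact: entire_cst.
by under eq_fun do rewrite big_cons; exact: (entireD (ef i) IH).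
Qed.

Lemma entire_prod (I : Type) (s : seq I) (f : I -> C -> C) :
  (forall i, entire (f i)) -> entire (fun z => \prod_(i <- s) f i z).
Proof.
move=> ef; elim: s => [|i s IH].
  by under eq_fun do rewrite big_nil; exact: entire_cst.
by under eq_fun do rewrite big_cons; exact: (entireM (ef i) IH).
Qed.

Lemma entire_det m (A : C -> 'M[C]_m) : (forall i j, entire (fun z => A z i j)) ->
  entire (fun z => \det (A z)).
Proof.
move=> eA; rewrite /determinant; apply: entire_sum => s.
have H := @entire_prod 'I_m (index_enum _) (fun i z => A z i (s i)) (fun i => eA i (s i)).
exact: (@entireM (fun=> _) _ (@entire_cst _) H).
Qed.

Lemma entire_mulmx m n p (A : C -> 'M[C]_(m, n)) (B : 'M[C]_(n, p)) :
  (forall i j, entire (fun z => A z i j)) ->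
  forall i j, entire (fun z => (A z *m B) i j).
Proof.
move=> eA i j; under eq_fun do rewrite mxE.
exact: (@entire_sum _ _ (fun k z => A z i k * B k j) (fun k => @entireM _ (fun=> _) (eA i k) (@entire_cst _))).
Qed.

Lemma entire_mulmxr m n p (A : C -> 'M[C]_(n, p)) (B : 'M[C]_(m, n)) :
  (forall i j, entire (fun z => A z i j)) ->
  forall i j, entire (fun z => (B *m A z) i j).
Proof.
move=> eA i j; under eq_fun do rewrite mxE.
exact: (@entire_sum _ _ (fun k z => B i k * A z k j) (fun k => @entireM (fun=> _) _ (@entire_cst _) (eA k j))).
Qed.

Lemma prod_if_ge m r (x : C) :
  \prod_(j < m) (if (j < r)%N then 1 else x) = x ^+ (m - r).
Proof.
rewrite (eq_bigr (fun j : 'I_m => if ~~ (j < r)%N then x else 1)); last first.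
  by move=> j _; case: ifP.
rewrite -big_mkcond (eq_bigl (fun j : 'I_m => r <= j)%N) /=; last by move=> j; rewrite -leqNgt.
by rewrite -(big_geq_mkord r m xpredT (fun=> x)) prodr_const_nat.
Qed.

(* At a point t where ker A(t) is nondegenerate for the derivative A1, the
   columns of A(z) that vanish at t after Gaussian elimination can be divided
   by z - t exactly once. *)
Lemma det_order m (A : C -> 'M[C]_m) (A1 : 'M[C]_m) (t : C) :
  (forall i j, smooth_at (fun z => A z i j) t (A1 i j)) ->
  (forall x y : 'cV[C]_m, A t *m x = 0 -> A1 *m x = A t *m y -> x = 0) ->
  exists q : C -> C, [/\ forall z, \det (A z) = (z - t) ^+ (m - \rank (A t)) * q z,
    q t != 0 & entire q].
Proof.
move=> sA nd.
have /choice[Q0 Q0P] : forall ij : 'I_m * 'I_m, exists q : C -> C,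
    [/\ forall z, A z ij.1 ij.2 = A t ij.1 ij.2 + (z - t) * q z,
        q t = A1 ij.1 ij.2 & entire q] by move=> [i j]; exact: sA.
pose Q z : 'M[C]_m := \matrix_(i, j) Q0 (i, j) z.
have AQ z : A z = A t + (z - t) *: Q z.
  by apply/matrixP => i j; rewrite !mxE; have [->] := Q0P (i, j).
have Q1 : Q t = A1 by apply/matrixP => i j; rewrite !mxE; have [_ ->] := Q0P (i, j).
have eQ i j : entire (fun z => Q z i j).
  by under eq_fun do rewrite mxE; have [] := Q0P (i, j).
set r := \rank (A t); set L := col_ebase (A t); set U := row_ebase (A t).
have uL : L \in unitmx := col_ebase_unit _.
have uU : U \in unitmx := row_ebase_unit _.
have AE : A t = L *m pid_mx r *m U by rewrite mulmx_ebase.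
pose Q' z := invmx L *m Q z *m invmx U.
have eQ' i j : entire (fun z => Q' z i j).
  have e1 := @entire_mulmxr m m m Q (invmx L) eQ.
  exact: (@entire_mulmx m m m _ (invmx U) e1 i j).
(* In the bases [L] and [U] of A(t), the columns j >= r of A(z) are z - t times those of [Q']. [B]
   omits this factor and [D] restores it. *)
pose B z : 'M[C]_m := \matrix_(i, j)
  if (j < r)%N then (pid_mx r : 'M[C]_m) i j + (z - t) * Q' z i j else Q' z i j.
have eB i j : entire (fun z => B z i j).
  case jr: (j < r)%N; last first.
    by under eq_fun do rewrite mxE jr; exact: (eQ' i j).
  under eq_fun do rewrite mxE jr.
  have e1 : entire (fun z => z - t) by move=> z; exact: cderivable_subr.
  exact: (@entireD (fun=> _) _ (@entire_cst _) (@entireM _ (fun z => Q' z i j) e1 (eQ' i j))).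
pose D z : 'rV[C]_m := \row_j if (j < r)%N then 1 else z - t.
have pid0 (i j : 'I_m) : (r <= j)%N -> (pid_mx r : 'M[C]_m) i j = 0.
  by move=> rj; rewrite mxE; case: eqP => //= ->; rewrite ltnNge rj.
have AB z : A z = L *m (B z *m diag_mx (D z)) *m U.
  rewrite AQ [in LHS]AE (_ : Q z = L *m Q' z *m U); last first.
    by rewrite /Q' -[invmx L *m _ *m _]mulmxA (mulKVmx uL) (mulmxKV uU).
  rewrite scalemxAl scalemxAr -mulmxDl -mulmxDr; congr (_ *m _ *m _).
  apply/matrixP => i j; rewrite mul_mx_diag !mxE.
  case: (ltnP j r) => jr; first by rewrite mulr1.
  have := pid0 i j jr; rewrite mxE => ->.
  by rewrite add0r mulrC.
exists (fun z => \det L * \det (B z) * \det U); split.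
- move=> z; rewrite AB !det_mulmx det_diag.
  under eq_bigr do rewrite mxE.
  by rewrite prod_if_ge mulrA mulrAC mulrC.
- have dL : \det L != 0 by move: uL; rewrite unitmxE unitfE.
  have dU : \det U != 0 by move: uU; rewrite unitmxE unitfE.
  apply: mulf_neq0 dU; apply: (mulf_neq0 dL).
  apply/negP => /eqP B0.
  have /det0P[v v0 vB] : \det (B t)^T == 0 by rewrite det_tr B0.
  (* [x2] keeps the coordinates j >= r of a kernel vector of B(t). Carried back by [U], it lies in
     ker A(t) and [A1] maps it into the range of A(t), so [nd] makes it 0. Then [pid_mx r]
     annihilates [x], which clears the coordinates j < r. *)
  pose x := v^T; pose x2 : 'cV[C]_m := \col_j if (j < r)%N then 0 else x j 0.
  have Bx : B t *m x = 0 by apply: trmx_inj; rewrite trmx_mul trmxK vB trmx0.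
  have px2 : (pid_mx r : 'M[C]_m) *m x2 = 0.
    apply/matrixP => i j; rewrite !mxE big1// => k _; rewrite !mxE.
    case: (ltnP k r) => kr; first by rewrite mulr0.
    by have := pid0 i k kr; rewrite mxE => ->; rewrite mul0r.
  have Bx2 : (pid_mx r : 'M[C]_m) *m x + Q' t *m x2 = 0.
    rewrite -Bx; apply/matrixP => i j; rewrite ord1 !mxE -big_split/=.
    apply: eq_bigr => k _; rewrite [B t _ _]mxE subrr mul0r addr0 [x2 _ _]mxE.
    case: (ltnP k r) => kr; first by rewrite mulr0 addr0.
    by rewrite pid0// mul0r add0r.
  have AtU (y : 'cV[C]_m) : A t *m (invmx U *m y) = L *m (pid_mx r *m y).
    by rewrite AE -!mulmxA (mulKVmx uU).
  have x2E : invmx U *m x2 = 0.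
    apply: (nd _ (- (invmx U *m x))); first by rewrite AtU px2 mulmx0.
    rewrite mulmxN AtU -Q1 -mulmxN.
    have <- : L *m (Q' t *m x2) = Q t *m (invmx U *m x2).
      by rewrite /Q' -!mulmxA (mulKVmx uL).
    by congr (_ *m _); apply/eqP; rewrite -subr_eq0 opprK addrC; apply/eqP.
  have x20 : x2 = 0 by rewrite -(mulKVmx uU x2) x2E mulmx0.
  have px : (pid_mx r : 'M[C]_m) *m x = 0 by move: Bx2; rewrite x20 mulmx0 addr0.
  move/eqP: v0; apply; apply/matrixP => i k; rewrite ord1 [RHS]mxE.
  have xE : v 0 k = x k 0 by rewrite mxE.
  rewrite xE; case: (ltnP k r) => kr; last first.
    have := congr1 (fun M : 'cV_m => M k 0) x20; rewrite !mxE ifN ?mxE// -leqNgt//.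
  have := congr1 (fun M : 'cV_m => M k 0) px; rewrite [in X in X -> _]mxE.
  rewrite (bigD1 k)//= big1 => [|j jk]; rewrite !mxE.
    by rewrite eqxx kr mul1r addr0.
  by rewrite (_ : val k == val j = false) ?mul0r//; apply/eqP => /val_inj E; rewrite E eqxx in jk.
- exact: (@entireM _ (fun=> _) (@entireM (fun=> _) _ (@entire_cst _) (entire_det eB)) (@entire_cst _)).
Qed.
End HolomorphicDeterminants.

(** * Self-adjoint conditions as Lagrangian planes *)

Section Lagrangian.
Context {R : realType} {n : nat}.
Notation C := (Cx R).
Variables (A B : 'M[C]_n).
Hypothesis AB : selfadjoint_bc A B.

(** Dimension count: the pairs (- B^* v, A^* v) satisfy the condition because A B^* and B A^* agree,
    and both spaces have dimension n by the rank hypothesis. *)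
Lemma lagrangian_param (x y : 'cV[C]_n) : A *m x + B *m y = 0 ->
  exists v : 'cV[C]_n, x = - (B^t* *m v) /\ y = A^t* *m v.
Proof.
case: AB => rk sym xy.
pose M : 'M[C]_(n + n, n) := (row_mx A B)^T.
pose N : 'M[C]_(n, n + n) := row_mx (- map_mx Num.conj B) (map_mx Num.conj A).
have NM : N *m M = 0.
  rewrite /N /M tr_row_mx mul_row_col mulNmx addrC; apply/eqP; rewrite subr_eq0; apply/eqP.
  by have := congr1 trmx sym; rewrite !trmx_mul -!map_trmx !trmxK => ->.
have rM : \rank M = n by rewrite mxrank_tr.
have rN : \rank N = n.
  (* Up to conjugation [N] is [row_mx A B] times an invertible symplectic matrix, so it inherits the
     rank n. *)
  pose J : 'M[C]_(n + n) := block_mx 0 1%:M (- 1%:M) 0.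
  have uJ : row_free J.
    rewrite row_free_unit.
    have : J *m block_mx 0 (- 1%:M) 1%:M 0 = 1%:M.
      rewrite mulmx_block !mulmx0 !mul0mx !mulmx1 !mulmxN !mulNmx mulmx1 opprK.
      by rewrite ?add0r ?addr0 ?oppr0 -scalar_mx_block.
    by case/mulmx1_unit.
  have -> : N = map_mx Num.conj (row_mx A B *m J).
    rewrite mul_row_block !mulmx0 mulmxN !mulmx1 add0r addr0 map_row_mx.
    by rewrite /N map_mxN.
  by rewrite mxrank_map mxrankMfree.
have NK : (N == kermx M)%MS.
  have sub : (N <= kermx M)%MS by apply/sub_kermxP.
  by rewrite -(mxrank_leqif_eq sub) mxrank_ker rM rN addnK.
have : (row_mx x^T y^T <= N)%MS.
  rewrite (eqmxP NK); apply/sub_kermxP.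
  by rewrite /M tr_row_mx mul_row_col -!trmx_mul -raddfD/= xy trmx0.
move=> /submxP[v]; rewrite /N mul_mx_row => /eq_row_mx[E1 E2].
exists v^T; split; apply: trmx_inj.
  by rewrite E1 [RHS]linearN/= trmx_mul trmxK -map_trmx trmxK mulmxN.
by rewrite E2 trmx_mul trmxK -map_trmx trmxK.
Qed.

Lemma conjmx_mul m p q (M : 'M[C]_(m, p)) (N : 'M[C]_(p, q)) :
  (M *m N)^t* = N^t* *m M^t*.
Proof. by rewrite trmx_mul map_mxM. Qed.

Lemma conjmxK m p (M : 'M[C]_(m, p)) : (M^t*)^t* = M.
Proof. by apply/matrixP => i j; rewrite !mxE conjCK. Qed.

Lemma conjmxN m p (M : 'M[C]_(m, p)) : (- M)^t* = - M^t*.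
Proof. by apply/matrixP => i j; rewrite !mxE rmorphN. Qed.

(** In the parameters v and v' the two sides are - v^* B A^* v' and - v^* A B^* v'. *)
Lemma lagrangian_sym (x y x' y' : 'cV[C]_n) :
  A *m x + B *m y = 0 -> A *m x' + B *m y' = 0 -> x^t* *m y' = y^t* *m x'.
Proof.
move=> /lagrangian_param[v [-> ->]] /lagrangian_param[v' [-> ->]].
rewrite conjmxN !conjmx_mul !conjmxK mulNmx mulmxN; congr (- _).
by rewrite -!mulmxA; congr (_ *m _); rewrite !mulmxA; case: AB => _ ->.
Qed.

(* On the Lagrangian plane the form x^* y depends on x alone. *)
Lemma lagrangian_form : exists G : 'M[C]_n, forall x y : 'cV[C]_n,
  A *m x + B *m y = 0 -> x^t* *m y = x^t* *m (G *m x).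
Proof.
(* [T *m x] is some v' with x = - B^* v'. It differs from v by a vector of ker B^*, on which x^* A^*
   = - v^* B A^* = - v^* A B^* vanishes. *)
pose N := (B^t*)^T; pose T := - (pinvmx N)^T.
exists (A^t* *m T) => x y /lagrangian_param[v [xE ->]].
have BT : B^t* *m (T *m x) = B^t* *m v.
  rewrite xE /T !mulNmx !mulmxN opprK; apply: trmx_inj.
  rewrite (trmx_mul (B^t*)) (trmx_mul (pinvmx N)^T) (trmx_mul (B^t*) v) -/N trmxK.
  by have := @mulmxKpV _ _ _ _ (v^T *m N) N (submxMl _ _); rewrite !mulmxA.
rewrite xE conjmxN conjmx_mul conjmxK !mulNmx; congr (- _).
rewrite -xE -!mulmxA; congr (_ *m _); rewrite !mulmxA.
case: AB => _ <-; rewrite -!mulmxA; congr (_ *m _).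
by rewrite BT.
Qed.

End Lagrangian.

(** * Square norms of continuous functions *)

Section SquareIntegrability.
Context {R : realType} {m : nat}.
Notation mu := (@lebesgue_measure R).
Notation Re := (@complex.Re R).
Notation Im := (@complex.Im R).
Implicit Types (X : schroedinger R m) (f : R -> Cx R) (a b : R).

Lemma abs_cont_continuous a b f (F : Cx R -> R) : abs_cont a b f ->
  (forall z w, `|F z - F w| <= nrm (z - w)) ->
  {within edge a b, continuous (fun x => F (f x))}.
Proof.
move=> acf FL; apply/subspace_continuousP => x xab; apply/cvgrPdist_lt => e e0.
have [d d0 dP] := abs_cont_unif acf e0.
rewrite /prop_near1 /within /=; apply/nbhs_ballP; exists d => //= y xy yab.
by apply: (le_lt_trans (FL _ _)); apply: dP.
Qed.

Lemma continuous_Re_abs_cont a b f : abs_cont a b f ->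
  {within edge a b, continuous (fun x => Re (f x))}.
Proof.
move=> acf; apply: abs_cont_continuous => // z w.
by rewrite -cReN -cReD normRe_le.
Qed.

Lemma continuous_Im_abs_cont a b f : abs_cont a b f ->
  {within edge a b, continuous (fun x => Im (f x))}.
Proof.
move=> acf; apply: abs_cont_continuous => // z w.
by rewrite -cImN -cImD normIm_le.
Qed.

Lemma continuous_sq_abs_cont a b f : abs_cont a b f ->
  {within edge a b, continuous (fun x => Re (f x) ^+ 2 + Im (f x) ^+ 2)}.
Proof.
move=> acf; have cR := continuous_Re_abs_cont acf; have cI := continuous_Im_abs_cont acf.
by move=> x; apply: cvgD; apply: cvgM; [exact: cR|exact: cR|exact: cI|exact: cI].
Qed.

Lemma inL2_abs_cont X (f : gfun R m) :
  (forall k, abs_cont (lo X k) (hi X k) (f k)) -> inL2 X f.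
Proof.
move=> acf; split=> [k|].
  by split; apply: subspace_continuous_measurable_fun => //;
    [exact: measurable_edge|exact: continuous_Re_abs_cont|
     exact: measurable_edge|exact: continuous_Im_abs_cont].
rewrite /sqnorm; apply: lte_sum_pinfty => k _.
have /integrableP[_] : mu.-integrable (edge (lo X k) (hi X k))
    (EFin \o (fun x => Re (f k x) ^+ 2 + Im (f k x) ^+ 2)).
  apply: continuous_compact_integrable; last exact: continuous_sq_abs_cont.
  by rewrite edgeE; exact: segment_compact.
apply: le_lt_trans; rewrite le_eqVlt; apply/orP; left; apply/eqP.
by apply: eq_integral => x _; rewrite /= ger0_norm// addr_ge0 ?sqr_ge0.
Qed.

(** By continuity the integrand stays above half its value at [x] on an interval of positive
    length. *)
Lemma sqnorm_gt0 X (f : gfun R m) k x : lo X k < hi X k ->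
  abs_cont (lo X k) (hi X k) (f k) -> on_edge X k x -> f k x != 0 ->
  (0 < sqnorm X f)%E.
Proof.
move=> lohi acf /andP[lx xh] fx.
set a := lo X k in lohi acf lx *; set b := hi X k in lohi acf xh *.
have cg := continuous_sq_abs_cont acf.
set g := (fun x => Re (f k x) ^+ 2 + Im (f k x) ^+ 2) in cg.
have g0 y : 0 <= g y by rewrite addr_ge0 ?sqr_ge0.
have gx : 0 < g x.
  rewrite lt_def g0 andbT; apply: contra fx => /eqP/eqP.
  rewrite paddr_eq0 ?sqr_ge0// !sqrf_eq0 => /andP[/eqP r0 /eqP i0].
  by apply/eqP; apply: complex_ext.
have [r r0 rP] : exists2 r : R, 0 < r & forall y, a <= y <= b -> `|y - x| <= r -> g x / 2 <= g y.
  move/subspace_continuousP : cg => /(_ x); rewrite /edge/= lx xh => /(_ isT).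
  move=> /cvgrPdist_le/(_ (g x / 2)); rewrite divr_gt0// => /(_ isT).
  rewrite /prop_near1 /within/= => /nbhs_ballP[r/= r0 rP].
  exists (r / 2); first by rewrite divr_gt0.
  move=> y yab yx; have := rP y; rewrite /ball/= distrC => /(_ _ yab).
  rewrite (le_lt_trans yx) ?ltr_pdivrMr ?ltr_pMr ?ltr1n// => /(_ isT).
  by rewrite ler_norml => /andP[_ h]; have {}h : g x - g y <= g x / 2 := h; move: (g x) (g y) h => gx' gy'; lra.
pose p := Num.max a (x - r); pose q := Num.min b (x + r).
have px : p <= x by rewrite ge_max lx gerBl ltW.
have xq : x <= q by rewrite le_min xh lerDl ltW.
have pq : p < q.
  rewrite /p /q gt_max !lt_min lohi (le_lt_trans lx) ?ltrDl//=.
  by rewrite (lt_le_trans _ xh) ?gtrBl//= (lt_trans (y := x)) ?gtrBl ?ltrDl.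
have ap : a <= p by rewrite le_max lexx.
have qb : q <= b by rewrite ge_min lexx.
have sub : edge p q `<=` edge a b.
  by move=> y /andP[py yq]; rewrite /edge/= (le_trans ap py) (le_trans yq qb).
have mg : measurable_fun (edge a b) (fun y => (g y)%:E).
  apply/measurable_EFinP; apply: subspace_continuous_measurable_fun => //.
  exact: measurable_edge.
rewrite /sqnorm (bigD1 k)//=; apply: (@lt_le_trans _ _ (\int[mu]_(y in edge a b) (g y)%:E)%E).
  apply: (@lt_le_trans _ _ (\int[mu]_(y in edge p q) (g y)%:E)%E); last first.
    apply: ge0_subset_integral => //; try exact: measurable_edge.
    by move=> y _; rewrite lee_fin.
  apply: (@lt_le_trans _ _ (\int[mu]_(y in edge p q) (g x / 2)%:E)%E).
    rewrite integral_cst; last exact: measurable_edge.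
    rewrite edgeE [X in (_ < _ * X)%E](_ : _ = (q - p)%:E); last first.
      by etransitivity; [exact: lebesgue_measure_itv|rewrite /= lte_fin pq EFinB].
    by rewrite -EFinM lte_fin mulr_gt0 ?subr_gt0// divr_gt0.
  apply: ge0_le_integral => //.
  - exact: measurable_edge.
  - by move=> y _; rewrite lee_fin divr_ge0// ltW.
  - by apply: measurable_funS mg => //; exact: measurable_edge.
  - move=> y /andP[py yq]; rewrite lee_fin; apply: rP.
      by rewrite (le_trans ap py) (le_trans yq qb).
    rewrite ler_norml; apply/andP; split.
      by rewrite lerBrDl; apply: le_trans py; rewrite le_max lexx orbT.
    by rewrite lerBlDl; apply: (le_trans yq); rewrite ge_min lexx orbT.
rewrite leeDl//; apply: sume_ge0 => j _; apply: integral_ge0 => y _.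
by rewrite lee_fin addr_ge0 ?sqr_ge0.
Qed.

Lemma sqnorm_zero X : sqnorm X (fun _ _ => 0) = 0%E.
Proof.
rewrite /sqnorm big1// => k _; rewrite integral0_eq// => x _ /=.
by rewrite expr0n/= addr0.
Qed.

End SquareIntegrability.

(** * The characteristic determinant *)

Section Operator.
Context {R : realType} {m : nat}.
Notation mu := (@lebesgue_measure R).
Notation Re := (@complex.Re R).
Notation Im := (@complex.Im R).
Variable X : schroedinger R m.
Variables (p q : 'I_m -> R) (gam : 'I_m -> Cx R) (u du : 'I_m -> R -> Cx R -> Cx R).

(* The far condition of edge k is gam_k (q_k u(hi) - p_k u'(hi)) = 0, and u_k
   is the solution with (u_k, u_k')(hi) = (p_k, q_k), which satisfies it. *)
Record op_data : Prop := OpData {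
  od_lt : forall k, lo X k < hi X k;
  od_pot : forall k, mu.-integrable (edge (lo X k) (hi X k)) (EFin \o pot X k);
  od_al : selfadjoint_bc (al1 X) (al2 X);
  od_gam : forall k, gam k != 0;
  od_pq : forall k, (p k != 0) || (q k != 0);
  od_be1 : be1 X = diag_mx (\row_k (gam k * cplx (q k)));
  od_be2 : be2 X = diag_mx (\row_k (- (gam k * cplx (p k))));
  od_u : forall k, edge_solution (pot X k) (lo X k) (hi X k) (p k) (q k) (u k) (du k) }.

Hypothesis D : op_data.

Definition charmx (z : Cx R) : 'M[Cx R]_m :=
  \matrix_(i, k) (al1 X i k * u k (lo X k) z + al2 X i k * du k (lo X k) z).

Definition chardet (z : Cx R) : Cx R := \det (charmx z).

Lemma charmx_mul z (c : 'cV[Cx R]_m) :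
  charmx z *m c = al1 X *m (\col_k (c k 0 * u k (lo X k) z)) +
                  al2 X *m (\col_k (c k 0 * du k (lo X k) z)).
Proof.
apply/matrixP => i j; rewrite !mxE -big_split/=; apply: eq_bigr => k _.
by rewrite !mxE ord1; ring.
Qed.

Lemma far_conditionE (w dw : gfun R m) (d : 'cV[Cx R]_m) k :
  be1 X *m (\col_k w k (hi X k)) + be2 X *m (\col_k dw k (hi X k)) = d ->
  gam k * (cplx (q k) * w k (hi X k) - cplx (p k) * dw k (hi X k)) = d k 0.
Proof.
move=> <-; rewrite (od_be1 D) (od_be2 D) !mul_diag_mx !mxE; ring.
Qed.

Lemma far_condition (w dw : gfun R m) (d : 'cV[Cx R]_m) :
  (forall k, gam k * (cplx (q k) * w k (hi X k) - cplx (p k) * dw k (hi X k)) = d k 0) ->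
  be1 X *m (\col_k w k (hi X k)) + be2 X *m (\col_k dw k (hi X k)) = d.
Proof.
move=> H; apply/matrixP => i j; rewrite ord1 -H.
by rewrite (od_be1 D) (od_be2 D) !mul_diag_mx !mxE; ring.
Qed.

Lemma solves_of_regular z (w dw : gfun R m) k : regular X w dw ->
  diff_expr X w dw (fun k x => z * w k x) ->
  solves (pot X k) (lo X k) (hi X k) z (w k) (dw k).
Proof. by move=> rw dew; have [w1 w2 w3] := rw k; split=> //; exact: dew. Qed.

Lemma regular_of_solves z (w dw : gfun R m) :
  (forall k, solves (pot X k) (lo X k) (hi X k) z (w k) (dw k)) ->
  regular X w dw /\ diff_expr X w dw (fun k x => z * w k x).
Proof. by move=> S; split=> k; have [w1 w2 w3 w4] := S k. Qed.

Lemma proportional_data k (a b : Cx R) : cplx (q k) * a = cplx (p k) * b ->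
  exists c, a = c * cplx (p k) /\ b = c * cplx (q k).
Proof.
move=> E; have [p0|p0] := eqVneq (p k) 0.
  have q0 : q k != 0 by have := od_pq D k; rewrite p0 eqxx.
  have q1 : cplx (q k) != 0 by rewrite cplx_eq0.
  exists (b / cplx (q k)); rewrite divfK//; split=> //.
  move/eqP: E; rewrite p0 cplx0 mul0r mulf_eq0 (negPf q1)/= => /eqP ->.
  by rewrite mulr0.
have p1 : cplx (p k) != 0 by rewrite cplx_eq0.
exists (a / cplx (p k)); rewrite divfK//; split=> //.
by apply: (mulfI p1); rewrite -E; field.
Qed.

Lemma solution_combination z (w dw : gfun R m) :
  regular X w dw -> diff_expr X w dw (fun k x => z * w k x) ->
  (forall k, cplx (q k) * w k (hi X k) = cplx (p k) * dw k (hi X k)) ->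
  exists c : 'cV[Cx R]_m, forall k x, on_edge X k x ->
    w k x = c k 0 * u k x z /\ dw k x = c k 0 * du k x z.
Proof.
move=> rw dew E.
have /choice[c cP] : forall k, exists ck, w k (hi X k) = ck * cplx (p k) /\
    dw k (hi X k) = ck * cplx (q k) by move=> k; exact: proportional_data.
exists (\col_k c k) => k x xk; rewrite mxE.
have S := od_u D k; have [c1 c2] := cP k.
have := solves_unique (od_pot D k) (solves_of_regular k rw dew)
  (solves_lin (c k) 0 (es_solves S z) (es_solves S z)) _ _ xk.
by rewrite !mul0r !addr0 (es_base S) (es_dbase S); apply.
Qed.

Lemma lo_on_edge k : on_edge X k (lo X k).
Proof. by rewrite /on_edge/= lexx ltW// (od_lt D). Qed.

Lemma solution_solves z (c : 'cV[Cx R]_m) k : solves (pot X k) (lo X k) (hi X k) z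
  (fun x => c k 0 * u k x z) (fun x => c k 0 * du k x z).
Proof.
have S := es_solves (od_u D k) z; have := solves_lin (c k 0) 0 S S.
by congr (solves _ _ _ _ _ _); apply/funext => x; rewrite mul0r addr0.
Qed.

Lemma charmx_solution z (a c : 'cV[Cx R]_m) : charmx z *m c = a ->
  bvp X z a 0 (fun k x => c k 0 * u k x z) (fun k x => c k 0 * du k x z).
Proof.
move=> Ac.
have [r1 r2] := @regular_of_solves z (fun k x => c k 0 * u k x z)
    (fun k x => c k 0 * du k x z) (solution_solves z c).
split=> //; split; first by rewrite -charmx_mul.
apply: (@far_condition (fun k x => c k 0 * u k x z) (fun k x => c k 0 * du k x z)).
by move=> k; rewrite [RHS]mxE (es_base (od_u D k)) (es_dbase (od_u D k)); ring.
Qed.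

Lemma eigenspaceP z (w : gfun R m) : eigenspace_at X z w ->
  exists2 c : 'cV[Cx R]_m, charmx z *m c = 0 &
    forall k x, on_edge X k x -> w k x = c k 0 * u k x z.
Proof.
move=> [_ [dw [rw dew [bc1 bc2]]]].
have [k|c cP] := solution_combination rw dew.
  have := far_conditionE k bc2; rewrite mxE => /eqP.
  by rewrite mulf_eq0 (negPf (od_gam D k))/= subr_eq0 => /eqP.
exists c; last by move=> k x xk; have [] := cP k x xk.
rewrite charmx_mul; etransitivity; last exact: bc1.
have E k := cP k _ (lo_on_edge k).
by congr (al1 X *m _ + al2 X *m _); apply/matrixP => k j; rewrite !mxE; have [e1 e2] := E k; rewrite ?e1 ?e2.
Qed.

Lemma abs_cont_solution z (c : 'cV[Cx R]_m) k :
  abs_cont (lo X k) (hi X k) (fun x => c k 0 * u k x z).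
Proof. by apply: abs_contZ; have [] := es_solves (od_u D k) z. Qed.

Lemma eigenspace_charmx z (c : 'cV[Cx R]_m) : charmx z *m c = 0 ->
  eigenspace_at X z (fun k x => c k 0 * u k x z).
Proof.
move=> Ac; have [r1 r2 r3] := charmx_solution Ac; split.
  by apply: inL2_abs_cont => k; apply: abs_contZ; exact: abs_cont_solution.
by exists (fun k x => c k 0 * du k x z).
Qed.

(** Eigenfunctions are coefficient vectors acting edge by edge. Since no u_k vanishes identically on
    its edge, a basis of the kernel gives independent functions. *)
Lemma eigen_mult_charmx (z : Cx R) : eigen_mult X z (m - \rank (charmx z)).
Proof.
pose K := kermx (charmx z)^T.
rewrite -mxrank_tr -mxrank_ker -/K.
pose B := row_base K.
have BK i : charmx z *m (row i B)^T = 0.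
  apply: trmx_inj; rewrite trmx_mul trmxK trmx0; apply/sub_kermxP.
  by apply: submx_trans (row_sub _ _) _; rewrite eq_row_base.
exists (fun i k x => B i k * u k x z); split.
- move=> i; have := eigenspace_charmx (BK i).
  by congr (eigenspace_at X z _); apply/funext => k; apply/funext => x; rewrite !mxE.
- move=> c c0 i.
  have : (\row_j c j) *m B = 0.
    apply/matrixP => a k; rewrite ord1 [RHS]mxE {a}.
    have [x xk ux] := es_nonzero (od_u D k) z.
    have := c0 k x xk; under eq_bigr do rewrite mulrA.
    rewrite -mulr_suml => /eqP; rewrite mulf_eq0 (negPf ux) orbF => /eqP E.
    by rewrite mxE -[RHS]E; apply: eq_bigr => j _; rewrite mxE.
  move/eqP; rewrite mulmx_free_eq0 ?row_base_free// => /eqP E.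
  by have := congr1 (fun M : 'rV_ _ => M 0 i) E; rewrite !mxE.
- move=> w /eigenspaceP[c Ac wE].
  have : (c^T <= B)%MS.
    by rewrite eq_row_base; apply/sub_kermxP; rewrite -trmx_mul Ac trmx0.
  case/submxP => d dE; exists (fun j => d 0 j) => k x xk.
  rewrite wE// (_ : c k 0 = c^T 0 k); last by rewrite mxE.
  by rewrite dE mxE mulr_suml; apply: eq_bigr => j _; rewrite mulrA.
Qed.

Lemma chardet_entire : entire chardet.
Proof.
apply: entire_det => i k.
have [U1 [DU1 [s1 s2 _]]] := es_smooth (od_u D k).
have := smooth_entire (smooth_lin (al1 X i k) (al2 X i k) (s1 0) (s2 0)).
by under [X in _ -> entire X]eq_fun do rewrite mxE.
Qed.

Lemma chardet_eq0 z : chardet z = 0 -> exists2 c : 'cV[Cx R]_m, c != 0 & charmx z *m c = 0.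
Proof.
move=> E; have /det0P[v v0 vA] : \det (charmx z)^T == 0 by rewrite det_tr -/(chardet z) E.
exists v^T; first by rewrite -(inj_eq (@trmx_inj _ _ _)) trmxK trmx0.
by apply: trmx_inj; rewrite trmx_mul trmxK trmx0.
Qed.

(** A kernel vector gives an eigenfunction of positive norm, which the resolvent bound with
    right-hand side 0 forbids. *)
Lemma resolvent_chardet z : resolvent X z -> chardet z != 0.
Proof.
move=> [_ [K KP]]; apply/negP => /eqP /chardet_eq0[c c0 Ac].
have [k ck] : exists k, c k 0 != 0.
  apply/existsP; rewrite -negb_forall; apply: contra c0 => /forallP H.
  by apply/eqP/matrixP => i j; rewrite ord1 [RHS]mxE; apply/eqP.
pose w : gfun R m := fun k x => c k 0 * u k x z.
have z2 : inL2 X (fun _ _ => 0).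
  by apply: inL2_abs_cont => j; exact: abs_cont_cst.
have := KP w (fun _ _ => 0) z2; rewrite sqnorm_zero mule0.
have -> : op_sub X z w (fun _ _ => 0) = eigenspace_at X z w.
  rewrite /op_sub /eigenspace_at; congr (op X w _).
  by apply/funext => j; apply/funext => x; rewrite add0r.
move=> /(_ (eigenspace_charmx Ac)); apply/negP; rewrite -ltNge.
have [x xk ux] := es_nonzero (od_u D k) z.
apply: (sqnorm_gt0 (od_lt D k) (abs_cont_solution z c k) xk).
by rewrite mulf_neq0.
Qed.

Let herm (x y : 'cV[Cx R]_m) : Cx R := (x^t* *m y) 0 0.

Lemma hermE (x y : 'cV[Cx R]_m) : herm x y = \sum_k (x k 0)^* * y k 0.
Proof. by rewrite /herm mxE; apply: eq_bigr => k _; rewrite !mxE. Qed.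

Lemma Re_sum (F : 'I_m -> Cx R) : Re (\sum_k F k) = \sum_k Re (F k).
Proof. by apply: (big_morph Re) => // x y; rewrite cReD. Qed.
Lemma Im_sum (F : 'I_m -> Cx R) : Im (\sum_k F k) = \sum_k Im (F k).
Proof. by apply: (big_morph Im) => // x y; rewrite cImD. Qed.

(** The common last step of the three arguments about zeros: a Lagrange identity with positive edge
    weights forces the coefficients to be 0. *)
Lemma pos_sum_eq0 (F : 'I_m -> R) (c : 'cV[Cx R]_m) :
  (forall k, 0 < F k) -> \sum_k nrm (c k 0) ^+ 2 * F k = 0 -> c = 0.
Proof.
move=> F0 /eqP; rewrite psumr_eq0 => [/allP H|k _]; last first.
  by rewrite mulr_ge0 ?sqr_ge0// ltW.
apply/matrixP => k j; rewrite ord1 [RHS]mxE; apply/eqP.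
have := H k; rewrite mem_index_enum => /(_ isT).
by rewrite mulf_eq0 (gt_eqF (F0 k)) orbF sqrf_eq0 nrm_eq0.
Qed.

Lemma nrm2E (z : Cx R) : nrm z ^+ 2 = Re z ^+ 2 + Im z ^+ 2.
Proof.
rewrite /nrm; case: z => a b /=; rewrite sqr_sqrtr// addr_ge0 ?sqr_ge0//.
Qed.

Lemma Im_conjM (a b : Cx R) : Im (a^* * b) = Re a * Im b - Im a * Re b.
Proof. by case: a => a1 a2; case: b => b1 b2 /=; ring. Qed.

Lemma Re_conjM (a b : Cx R) : Re (a^* * b) = Re a * Re b + Im a * Im b.
Proof. by case: a => a1 a2; case: b => b1 b2 /=; ring. Qed.

Lemma herm_sym (x y x' y' : 'cV[Cx R]_m) :
  al1 X *m x + al2 X *m y = 0 -> al1 X *m x' + al2 X *m y' = 0 ->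
  herm x y' = herm y x'.
Proof. by move=> L L'; rewrite /herm (lagrangian_sym (od_al D) L L'). Qed.

(** For the near values x and derivatives y of an eigenfunction, x^* y is real by the symmetry of
    the vertex condition, while Im z Im (x^* y) is a sum of |c_k|^2 with positive weights. *)
Lemma chardet_nonreal z : Im z != 0 -> chardet z != 0.
Proof.
move=> z0; apply/negP => /eqP /chardet_eq0[c /negP c0 Ac]; apply/c0/eqP.
pose F k := Im z * (Re (u k (lo X k) z) * Im (du k (lo X k) z) -
                     Im (u k (lo X k) z) * Re (du k (lo X k) z)).
apply: (@pos_sum_eq0 F) => [k|]; first exact: (es_nonreal (od_u D k) z0).
move: Ac; rewrite charmx_mul => L.
have := congr1 Im (herm_sym L L); rewrite !hermE !Im_sum.
under eq_bigr do rewrite !mxE Im_conjM.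
under [in RHS]eq_bigr do rewrite !mxE Im_conjM.
move=> E.
have {E} E0 : \sum_k (Re (c k 0 * u k (lo X k) z) * Im (c k 0 * du k (lo X k) z) -
    Im (c k 0 * u k (lo X k) z) * Re (c k 0 * du k (lo X k) z)) = 0.
  set S := (X in X = 0); suff : S = - S by move: S => S; lra.
  rewrite /S {1}E -sumrN; apply: eq_bigr => k _.
  by ring.
transitivity (Im z * 0); last by rewrite mulr0.
rewrite -[X in _ = _ * X]E0 mulr_sumr; apply: eq_bigr => k _.
by rewrite nrm2E /F !cReM !cImM; ring.
Qed.

(** The vertex condition gives x^* y = x^* G x >= - S |x|^2 in real part, with [S] the sum of the
    moduli of the entries of [G]. Far to the left [es_negative] gives at most - (S + 1) |x|^2, so x
    = 0, and then c = 0. *)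
Lemma chardet_bounded_below : exists K : R, forall t : R, t < K -> chardet (cplx t) != 0.
Proof.
have [G GP] := lagrangian_form (od_al D).
pose S : R := \sum_i \sum_j nrm (G i j).
have S0 : 0 <= S by rewrite !sumr_ge0// => i _; rewrite sumr_ge0// => j _; exact: nrm_ge0.
have /choice[K KP] : forall k, exists K : R, forall t : R, t < K -> exists r s : R,
    [/\ u k (lo X k) (cplx t) = cplx r, du k (lo X k) (cplx t) = cplx s, r != 0 &
      r * s <= - (S + 1) * r ^+ 2].
  by move=> k; exact: (es_negative (od_u D k) (- (S + 1))).
exists (- \sum_k `|K k|) => t tK.
have {}tK k : t < K k.
  rewrite (lt_le_trans tK)// lerNl (le_trans (ler_norm _))// normrN.
  by rewrite (bigD1 k)//= lerDl sumr_ge0.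
apply/negP => /eqP /chardet_eq0[c /negP c0 Ac]; apply/c0/eqP.
have /choice[r rP] : forall k, exists r, exists s : R,
    [/\ u k (lo X k) (cplx t) = cplx r, du k (lo X k) (cplx t) = cplx s, r != 0 &
      r * s <= - (S + 1) * r ^+ 2] by move=> k; exact: KP.
have /choice[s sP] := rP.
move: Ac; rewrite charmx_mul; set x := \col__ _; set y := \col__ _ => L.
have Hxy : Re (herm x y) = Re (herm x (G *m x)) by rewrite /herm -(GP _ _ L).
have xE k : nrm (x k 0) ^+ 2 = nrm (c k 0) ^+ 2 * r k ^+ 2.
  by have [e _ _ _] := sP k; rewrite mxE e nrmM nrm_cplx exprMn -normrX ger0_norm ?sqr_ge0.
pose T : R := \sum_k nrm (x k 0) ^+ 2.
have T0 : 0 <= T by apply: sumr_ge0 => k _; exact: sqr_ge0.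
have up : Re (herm x y) <= - (S + 1) * T.
  rewrite hermE Re_sum /T mulr_sumr; apply: ler_sum => k _.
  have [e1 e2 _ H] := sP k; rewrite xE Re_conjM /x /y !mxE e1 e2 !cReM !cImM /=.
  have := ler_wpM2l (sqr_ge0 (nrm (c k 0))) H.
  rewrite nrm2E; set a := Re (c k 0); set b := Im (c k 0); move=> {}H.
  by rewrite -subr_ge0 in H; rewrite -subr_ge0; move: H; congr (_ <= _); ring.
have down : - (S * T) <= Re (herm x (G *m x)).
  rewrite hermE Re_sum.
  have -> : \sum_k Re ((x k 0)^* * (G *m x) k 0) =
      \sum_i \sum_j Re ((x i 0)^* * (G i j * x j 0)).
    by apply: eq_bigr => i _; rewrite [(G *m x) i 0]mxE mulr_sumr Re_sum.
  rewrite -mulNr /S -sumrN mulr_suml; apply: ler_sum => i _.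
  rewrite -sumrN mulr_suml; apply: ler_sum => j _.
  rewrite mulNr lerNl; apply: (le_trans (ler_norm _)); rewrite normrN.
  apply: (le_trans (normRe_le _)); rewrite !nrmM.
  have -> : nrm ((x i 0)^*) = nrm (x i 0).
    by apply: cplx_inj; rewrite -!nrmE norm_conjC.
  rewrite mulrCA ler_wpM2l ?nrm_ge0//.
  have Ti k : nrm (x k 0) ^+ 2 <= T.
    by rewrite /T (bigD1 k)//= lerDl sumr_ge0// => l _; exact: sqr_ge0.
  have := Ti i; have := Ti j; have := sqr_ge0 (nrm (x i 0) - nrm (x j 0)).
  by move: (nrm (x i 0)) (nrm (x j 0)) => a b; nra.
have T1 : T = 0.
  apply/eqP; rewrite eq_le T0 andbT; move: up down; rewrite Hxy.
  by move: (Re _) => h; nra.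
apply: (@pos_sum_eq0 (fun k => r k ^+ 2)).
  by move=> k; have [_ _ r0 _] := sP k; rewrite lt_def sqr_ge0 andbT sqrf_eq0.
by rewrite -[RHS]T1; apply: eq_bigr => k _; rewrite xE.
Qed.

Lemma chardet_order (t : R) : exists h : Cx R -> Cx R,
  [/\ forall z, chardet z = (z - cplx t) ^+ (m - \rank (charmx (cplx t))) * h z,
      h (cplx t) != 0 & entire h].
Proof.
have /choice[U1 H1] : forall k, exists U1 : Cx R -> Cx R, exists DU1 : Cx R -> Cx R,
    [/\ forall t, smooth_at (u k (lo X k)) t (U1 t),
        forall t, smooth_at (du k (lo X k)) t (DU1 t) &
        forall t : R, exists r s r1 s1 : R,
          [/\ u k (lo X k) (cplx t) = cplx r, du k (lo X k) (cplx t) = cplx s,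
              U1 (cplx t) = cplx r1, DU1 (cplx t) = cplx s1 &
              0 < r * s1 - s * r1]].
  by move=> k; exact: es_smooth (od_u D k).
have /choice[V1 H2] := H1.
pose A1 : 'M[Cx R]_m := \matrix_(i, k)
  (al1 X i k * U1 k (cplx t) + al2 X i k * V1 k (cplx t)).
apply: (@det_order _ _ charmx A1 (cplx t)).
  move=> i k; have [s1 s2 _] := H2 k.
  have := smooth_lin (al1 X i k) (al2 X i k) (s1 (cplx t)) (s2 (cplx t)).
  by rewrite mxE; congr (smooth_at _ _ _); apply/funext => z; rewrite mxE.
move=> c b; rewrite !charmx_mul => L L1.
(* The z-derivative of the near data with coefficients c, corrected by the solution with
   coefficients b, satisfies the vertex condition. Pairing it with the data of c cancels b and
   leaves |c_k|^2 times the Wronskians with the z-derivative. *)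
pose x1 : 'cV[Cx R]_m := \col_k (c k 0 * U1 k (cplx t) - b k 0 * u k (lo X k) (cplx t)).
pose y1 : 'cV[Cx R]_m := \col_k (c k 0 * V1 k (cplx t) - b k 0 * du k (lo X k) (cplx t)).
have L2 : al1 X *m x1 + al2 X *m y1 = 0.
  have -> : al1 X *m x1 + al2 X *m y1 = A1 *m c -
    (al1 X *m (\col_k (b k 0 * u k (lo X k) (cplx t))) +
     al2 X *m (\col_k (b k 0 * du k (lo X k) (cplx t)))).
    apply/matrixP => i j; rewrite !mxE -!big_split/= -sumrB; apply: eq_bigr => k _.
    by rewrite !mxE ord1; ring.
  by rewrite L1 subrr.
have := congr1 Re (herm_sym L L2); rewrite !hermE !Re_sum => E.
have /choice[r /choice[s /choice[r1 /choice[s1 P]]]] : forall k, exists r s r1 s1 : R,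
    [/\ u k (lo X k) (cplx t) = cplx r, du k (lo X k) (cplx t) = cplx s,
        U1 k (cplx t) = cplx r1, V1 k (cplx t) = cplx s1 & 0 < r * s1 - s * r1].
  by move=> k; have [_ _] := H2 k; apply.
apply: (@pos_sum_eq0 (fun k => r k * s1 k - s k * r1 k)).
  by move=> k; have [] := P k.
move/eqP: E; rewrite -subr_eq0 -sumrB => /eqP E0; rewrite -[RHS]E0.
apply: eq_bigr => k _.
have [e1 e2 e3 e4 _] := P k.
rewrite !mxE e1 e2 e3 e4 !Re_conjM !cReD !cImD !cReN !cImN !cReM !cImM /= nrm2E; ring.
Qed.

End Operator.

(** * Counting zeros and poles *)

Section Counting.
Context {R : realType}.
Notation C := (Cx R).
Notation Im := (@complex.Im R).
Implicit Types (E F : C -> C) (mu : R -> nat).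

Record real_zeros E mu : Prop := RealZeros {
  rz_entire : entire E;
  rz_nonreal : forall z, Im z != 0 -> E z != 0;
  rz_below : exists K : R, forall t : R, t < K -> E (cplx t) != 0;
  rz_order : forall t : R, exists h : C -> C,
    [/\ forall z, E z = (z - cplx t) ^+ mu t * h z, h (cplx t) != 0 & entire h] }.

Definition zeros_le mu (lam : R) : set R := [set t | t <= lam /\ mu t != 0%N].

Lemma entire_near_neq0 E z : entire E -> E z != 0 -> \forall w \near z, E w != 0.
Proof. by move=> eE; exact: derivable_near_neq0. Qed.

Lemma cplx_nbhs (x : R) (U : set C) : nbhs (cplx x) U -> nbhs x (@cplx R @^-1` U).
Proof.
move=> /nbhs_ballP[e /= e0 eU]; have [d d0 ed] := gt0_cplx e0.
apply/nbhs_ballP; exists d => // y xy; apply: eU.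
by rewrite ed /ball/= -cplxB nrmE nrm_cplx lt_cplx.
Qed.

(** Bolzano-Weierstrass: these zeros lie between [K] and [lam], and near a limit point t the
    cofactor h has no zero, so no other zero of [E] is near t. *)
Lemma rz_finite E mu lam : real_zeros E mu -> finite_set (zeros_le mu lam).
Proof.
move=> [eE _ [K KE] ord]; apply: contrapT => inf.
have bnd : bounded_set (zeros_le mu lam).
  exists (`|K| + `|lam|); split; first exact: num_real.
  move=> M BM t [tl mt] /=; apply: le_trans (ltW BM).
  have Kt : K <= t.
    rewrite leNgt; apply/negP => /KE; have [h [Eh _ _]] := ord t.
    by rewrite Eh subrr expr0n (negPf mt) mul0r eqxx.
  rewrite ler_norml; apply/andP; split.
    apply: le_trans Kt; rewrite lerNl (le_trans (ler_norm _))// normrN.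
    by rewrite lerDl.
  by rewrite (le_trans tl)// (le_trans (ler_norm _))// lerDr.
have [t tE] := infinite_bounded_limit_point_nonempty inf bnd.
have [h [Eh ht eh]] := ord t.
have nh : nbhs t (@cplx R @^-1` [set w | h w != 0]).
  by apply: cplx_nbhs; exact: (entire_near_neq0 eh ht).
have [y [yt [yl my] hy]] := tE _ nh.
have [h' [Eh' _ _]] := ord y.
have := Eh' (cplx y); rewrite subrr expr0n (negPf my) mul0r Eh => /eqP.
rewrite mulf_eq0 (negPf hy) orbF expf_eq0 => /andP[_].
by rewrite subr_eq0 (inj_eq (@cplx_inj R)) (negPf yt).
Qed.

Section Quotient.
Variables (E0 E1 E2 E3 : C -> C) (m0 m1 m2 m3 : R -> nat) (lam : R).
Hypotheses (H0 : real_zeros E0 m0) (H1 : real_zeros E1 m1)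
  (H2 : real_zeros E2 m2) (H3 : real_zeros E3 m3).

(** At zeros of the denominator the value is 0 by convention; [laurent_at] looks only at punctured
    neighbourhoods. *)
Definition quotient (z : C) : C := E0 z / (E1 z * E2 z * E3 z).

Definition quotient_order (t : R) : int :=
  (m0 t)%:Z - (m1 t)%:Z - (m2 t)%:Z - (m3 t)%:Z.

Lemma near_holomorphic_quotient (h0 h1 h2 h3 : C -> C) z :
  entire h0 -> entire h1 -> entire h2 -> entire h3 ->
  h1 z != 0 -> h2 z != 0 -> h3 z != 0 ->
  holomorphic_at (fun w => h0 w / (h1 w * h2 w * h3 w)) z.
Proof.
move=> e0 e1 e2 e3 n1 n2 n3; rewrite /holomorphic_at.
have e123 := entireM (entireM e1 e2) e3.
have n123 : h1 z * h2 z * h3 z != 0 by rewrite !mulf_neq0.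
have near0 := entire_near_neq0 e123 n123.
apply: filterS near0 => w hw.
have i := @cderivableV R (fun w => h1 w * h2 w * h3 w) w hw (e123 w).
exact: (@cderivableM R h0 (fun w => (h1 w * h2 w * h3 w)^-1) w (e0 w) i).
Qed.

Lemma quotient_order_at t : order_at quotient (cplx t) (quotient_order t).
Proof.
have [h0 [Q0 n0 e0]] := rz_order H0 t; have [h1 [Q1 n1 e1]] := rz_order H1 t.
have [h2 [Q2 n2 e2]] := rz_order H2 t; have [h3 [Q3 n3 e3]] := rz_order H3 t.
exists (fun w => h0 w / (h1 w * h2 w * h3 w)); last first.
  by rewrite mulf_neq0// invr_neq0// !mulf_neq0.
split; first exact: near_holomorphic_quotient.
near=> w.
have wt : w - cplx t != 0.
  by rewrite subr_eq0; near: w; exact: nbhs_dnbhs_neq.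
rewrite /quotient Q0 Q1 Q2 Q3 /quotient_order !expfzDr// -!exprnN -!exprnP !invfM.
by ring.
Unshelve. all: by end_near. Qed.

Lemma quotient_meromorphic : meromorphic quotient.
Proof.
move=> z; have [Iz|Iz] := eqVneq (Im z) 0.
  have -> : z = cplx (complex.Re z) by apply: complex_ext.
  by have [g gl _] := quotient_order_at (complex.Re z); exists (quotient_order (complex.Re z)), g.
exists 0, quotient; split.
  exact: (near_holomorphic_quotient (rz_entire H0) (rz_entire H1) (rz_entire H2)
    (rz_entire H3) (rz_nonreal H1 Iz) (rz_nonreal H2 Iz) (rz_nonreal H3 Iz)).
by apply: nearW => w; rewrite expr0z mul1r.
Qed.

(** All counts become sums over this one finite set and can then be compared point by point. *)
Let U : set R := zeros_le m0 lam `|` zeros_le m1 lam `|` zeros_le m2 lam `|` zeros_le m3 lam.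

Let Ufin : finite_set U.
Proof. by rewrite !finite_setU; do !split; apply: rz_finite; by [exact: H0|exact: H1|exact: H2|exact: H3]. Qed.

Let widen (f : R -> nat) : (forall t, t <= lam -> f t != 0%N -> U t) ->
  finite_set [set t | t <= lam /\ f t != 0%N] /\
  \big[addn/0%N]_(t \in [set t | t <= lam /\ f t != 0%N]) f t =
    (\sum_(t <- fset_set U) f t)%N.
Proof.
move=> fU; have sub : [set t | t <= lam /\ f t != 0%N] `<=` U by move=> t [tl ft]; exact: fU.
split; first exact: sub_finite_set Ufin.
rewrite (fsbig_widen _ _ _ sub) ?fsbig_finite// => t [Ut nt] /=.
apply/eqP; apply/negPn/negP => ft; apply: nt; split=> //.
by case: Ut => [[[[]|[]]|[]]|[]].
Qed.

Lemma count_identity : exists Nz : int, zero_pole_count quotient lam Nz /\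
  (\big[addn/0%N]_(t \in zeros_le m0 lam) m0 t)%:Z =
  (\big[addn/0%N]_(t \in zeros_le m1 lam) m1 t)%:Z +
  (\big[addn/0%N]_(t \in zeros_le m2 lam) m2 t)%:Z +
  (\big[addn/0%N]_(t \in zeros_le m3 lam) m3 t)%:Z + Nz.
Proof.
pose zm t := `|Num.max (quotient_order t) 0|%N.
pose pm t := `|Num.max (- quotient_order t) 0|%N.
have mem (f : R -> nat) : (forall t, m0 t = 0%N -> m1 t = 0%N -> m2 t = 0%N -> m3 t = 0%N -> f t = 0%N) ->
    forall t, t <= lam -> f t != 0%N -> U t.
  move=> f0 t tl ft.
  have [a|a] := eqVneq (m0 t) 0%N; last by do 3 left.
  have [b|b] := eqVneq (m1 t) 0%N; last by left; left; right.
  have [c|c] := eqVneq (m2 t) 0%N; last by left; right.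
  have [d|d] := eqVneq (m3 t) 0%N; last by right.
  by rewrite f0 in ft.
have zm0 : forall t, m0 t = 0%N -> m1 t = 0%N -> m2 t = 0%N -> m3 t = 0%N -> zm t = 0%N.
  by move=> t a b c d; rewrite /zm /quotient_order a b c d.
have pm0 : forall t, m0 t = 0%N -> m1 t = 0%N -> m2 t = 0%N -> m3 t = 0%N -> pm t = 0%N.
  by move=> t a b c d; rewrite /pm /quotient_order a b c d.
have [fz sz] := widen (mem _ zm0); have [fp sp] := widen (mem _ pm0).
have [_ s0] := widen (mem m0 (fun t a b c d => a)).
have [_ s1] := widen (mem m1 (fun t a b c d => b)).
have [_ s2] := widen (mem m2 (fun t a b c d => c)).
have [_ s3] := widen (mem m3 (fun t a b c d => d)).
exists ((\sum_(t <- fset_set U) zm t)%N%:Z - (\sum_(t <- fset_set U) pm t)%N%:Z); split.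
  exists (\sum_(t <- fset_set U) zm t)%N, (\sum_(t <- fset_set U) pm t)%N; split=> //.
    exists zm; split=> // t _; exists (quotient_order t) => //; exact: quotient_order_at.
  exists pm; split=> // t _; exists (quotient_order t) => //; exact: quotient_order_at.
rewrite [in LHS]s0 [X in X%:Z + _ + _ + _]s1 [X in _ + X%:Z + _ + _]s2 [X in _ + X%:Z + _]s3.
have PS (f : R -> nat) : (\sum_(t <- fset_set U) f t)%N%:Z = \sum_(t <- fset_set U) (f t)%:Z.
  exact: (big_morph Posz PoszD).
rewrite !PS -sumrB -!big_split/=; apply: eq_bigr => t _.
(* At each point this is max d 0 - max (- d) 0 = d for the order d of the quotient. *)
rewrite /zm /pm /quotient_order.
move: (m0 t) (m1 t) (m2 t) (m3 t) => a b c d; lia.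
Qed.

End Quotient.
End Counting.

(** * Splitting the star graph *)

(** Two block triangular factorisations of one matrix. It shrinks the determinant of a rank r
    perturbation of the identity to size r. *)
Lemma sylvester_det (K : comNzRingType) m r (U : 'M[K]_(m, r)) (W : 'M[K]_(r, m)) :
  \det (1%:M + U *m W) = \det (1%:M + W *m U).
Proof.
have E : block_mx 1%:M 0 (- W) 1%:M *m block_mx 1%:M U 0 (1%:M + W *m U) =
         block_mx (1%:M + U *m W) U 0 1%:M *m block_mx 1%:M 0 (- W) 1%:M.
  rewrite !mulmx_block !mul1mx !mulmx1 !mul0mx !mulmx0 !mulmxN !mulNmx !addr0 !add0r.
  by rewrite addrK addrCA addNr addr0.
have := congr1 determinant E; rewrite !det_mulmx !det_lblock !det_ublock !det1.
by rewrite !mul1r !mulr1.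
Qed.

(** [A] is the identity plus [U *m W], where [W] selects the replaced columns; only their entries in
    the selected rows survive. *)
Lemma det_replace_cols (K : comNzRingType) m r (f : 'I_r -> 'I_m) (A : 'M[K]_m)
    (x : 'I_r -> 'cV[K]_m) : injective f ->
  (forall k i, A i (f k) = x k i 0) ->
  (forall l i, (forall k, l != f k) -> A i l = (i == l)%:R) ->
  \det A = \det (\matrix_(a, b) x b (f a) 0).
Proof.
move=> fI Af An.
pose W : 'M[K]_(r, m) := \matrix_(a, l) (f a == l)%:R.
pose U : 'M[K]_(m, r) := \matrix_(i, a) (x a i 0 - (i == f a)%:R).
have -> : A = 1%:M + U *m W.
  apply/matrixP => i l; rewrite !mxE.
  have [[k lk]|nl] := pselect (exists k, l = f k).
    rewrite lk Af.
    rewrite (bigD1 k)//=.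
    rewrite big1; last first.
      move=> k' k'k.
      by rewrite !mxE (inj_eq fI) (negPf k'k) mulr0.
    rewrite !mxE eqxx mulr1.
    by rewrite addr0 addrC subrK.
  rewrite An => [|k]; last by apply/eqP => lk; apply: nl; exists k.
  rewrite big1 ?addr0// => k _; rewrite !mxE [f k == l]eq_sym.
  by case: (l =P f k) => [lk|]; [case: nl; exists k|rewrite mulr0].
rewrite sylvester_det; congr (\det _); apply/matrixP => a b; rewrite !mxE.
rewrite (bigD1 (f a))//= !mxE eqxx mul1r big1 ?addr0 => [|i ia].
  by rewrite (inj_eq fI) addrC subrK.
by rewrite !mxE eq_sym (negPf ia) mul0r.
Qed.

(** * From characteristic determinants to counts *)

Section SplitCounting.
Context {R : realType}.
Notation mu := (@lebesgue_measure R).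

Lemma chardet_real_zeros m (X : schroedinger R m) p q gam u du (D : op_data X p q gam u du) :
  real_zeros (chardet X u du) (fun t => (m - \rank (charmx X u du (cplx t)))%N).
Proof.
split.
- exact: (chardet_entire D).
- exact: (chardet_nonreal D).
- exact: (chardet_bounded_below D).
- exact: (chardet_order D).
Qed.

Lemma eigen_count_chardet m (X : schroedinger R m) p q gam u du (D : op_data X p q gam u du) lam :
  let f := fun t : R => (m - \rank (charmx X u du (cplx t)))%N in
  eigen_count X lam (\big[addn/0%N]_(t \in zeros_le f lam) f t).
Proof.
exists (fun t => (m - \rank (charmx X u du (cplx t)))%N); split=> // [t _|].
  exact: (eigen_mult_charmx D).
exact: (rz_finite lam (chardet_real_zeros D)).
Qed.

Lemma count_split m0 m1 m2 m3 (X0 : schroedinger R m0) (X1 : schroedinger R m1)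
    (X2 : schroedinger R m2) (X3 : schroedinger R m3)
    p0 q0 gam0 u0 du0 p1 q1 gam1 u1 du1 p2 q2 gam2 u2 du2 p3 q3 gam3 u3 du3
    (D0 : op_data X0 p0 q0 gam0 u0 du0) (D1 : op_data X1 p1 q1 gam1 u1 du1)
    (D2 : op_data X2 p2 q2 gam2 u2 du2) (D3 : op_data X3 p3 q3 gam3 u3 du3) lam :
  let F := quotient (chardet X0 u0 du0) (chardet X1 u1 du1) (chardet X2 u2 du2)
    (chardet X3 u3 du3) in
  meromorphic F /\ exists (N N1 N2 N3 : nat) (Nz : int),
    [/\ eigen_count X0 lam N, eigen_count X1 lam N1, eigen_count X2 lam N2,
        eigen_count X3 lam N3 & zero_pole_count F lam Nz] /\
    N%:Z = N1%:Z + N2%:Z + N3%:Z + Nz.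
Proof.
have Z0 := chardet_real_zeros D0; have Z1 := chardet_real_zeros D1.
have Z2 := chardet_real_zeros D2; have Z3 := chardet_real_zeros D3.
split; first exact: (quotient_meromorphic Z0 Z1 Z2 Z3).
have [Nz [H1 H2]] := count_identity lam Z0 Z1 Z2 Z3.
do 4 eexists; exists Nz; split; last exact: H2.
by split; [exact: (eigen_count_chardet D0 lam)|exact: (eigen_count_chardet D1 lam)|
  exact: (eigen_count_chardet D2 lam)|exact: (eigen_count_chardet D3 lam)|exact: H1].
Qed.

(** Full rank excludes g_k = h_k = 0, and the symmetry makes g_k times the conjugate of h_k real. So
    (p, q) = (0, 1) with factor g_k if h_k = 0, and (- 1, g_k / h_k) with factor h_k otherwise. *)
Lemma separated_far n (g h : 'rV[Cx R]_n) : selfadjoint_bc (diag_mx g) (diag_mx h) ->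
  forall k, exists (gam : Cx R) (p q : R), [/\ gam != 0, (p != 0) || (q != 0),
    g 0 k = gam * cplx q & h 0 k = - (gam * cplx p)].
Proof.
move=> [rk sa] k.
have gh0 : (g 0 k != 0) || (h 0 k != 0).
  have : delta_mx 0 k *m row_mx (diag_mx g) (diag_mx h) != 0 :> 'rV_(n + n).
    rewrite mulmx_free_eq0 /row_free ?rk//.
    by apply/eqP => /matrixP/(_ 0 k)/eqP; rewrite !mxE !eqxx oner_eq0.
  apply: contraR; rewrite negb_or !negbK => /andP[/eqP g0 /eqP h0].
  apply/eqP; rewrite mul_mx_row -!rowE; apply/matrixP => a b; rewrite [RHS]mxE.
  by rewrite mxE; case: (fintype.split b) => c; rewrite !mxE ?g0 ?h0 mul0rn.
have ghc : g 0 k * (h 0 k)^* = h 0 k * (g 0 k)^*.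
  have := congr1 (fun M : 'M[Cx R]_n => M k k) sa.
  by rewrite !mul_diag_mx !mxE !eqxx !mulr1n.
have [hk0|hk0] := eqVneq (h 0 k) 0.
  exists (g 0 k), 0, 1; rewrite cplx0 cplx1 mulr1 mulr0 oppr0 oner_eq0 eqxx; split=> //.
  by move: gh0; rewrite hk0 eqxx orbF.
exists (h 0 k), (- 1), (complex.Re (g 0 k / h 0 k : Cx R)); split=> //.
- by rewrite oppr_eq0 oner_eq0.
- set w := g 0 k / h 0 k : Cx R.
  have wc : w^* = w.
    rewrite /w rmorphM fmorphV; apply: (mulIf hk0); rewrite divfK//.
    have hc : (h 0 k)^* != 0 by rewrite conjC_eq0.
    by apply: (mulIf hc); rewrite ghc mulrAC divfK// mulrC.
  rewrite (_ : cplx (complex.Re w) = w); first by rewrite /w mulrC divfK.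
  by move: wc; case: w => a b [/eqP ab]; apply: complex_ext => //=; lra.
- by rewrite cplxN cplx1 mulrN1 opprK.
Qed.

End SplitCounting.

Section TwoByTwo.
Context {R : realType}.
Notation C := (Cx R).

Definition mx2 (a b c d : C) : 'M[C]_2 :=
  \matrix_(x, y) if x == 0 then if y == 0 then a else b else if y == 0 then c else d.

Lemma det_mx2 (A : 'M[C]_2) : \det A = A 0 0 * A 1 1 - A 0 1 * A 1 0.
Proof.
rewrite (expand_det_row _ 0) !big_ord_recl big_ord0 /cofactor !det_mx11 !mxE /=.
rewrite (_ : lift _ _ = 1); last exact: val_inj.
rewrite (_ : lift 1 0 = 0); last exact: val_inj.
by rewrite /= expr0 expr1; ring.
Qed.

Lemma mx2_vec2 a b c d x y : mx2 a b c d *m vec2 x y = vec2 (a * x + b * y) (c * x + d * y).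
Proof.
apply/colP => k; rewrite !mxE !big_ord_recl big_ord0 !mxE /= addr0.
by case: (k == 0).
Qed.

End TwoByTwo.

Section InhomogeneousConditions.
Context {R : realType} {m : nat}.
Variables (X : schroedinger R m) (p q : 'I_m -> R) (gam : 'I_m -> Cx R).
Variables (u du : 'I_m -> R -> Cx R -> Cx R) (D : op_data X p q gam u du).

(** The factor [d k 0] in the hypothesis on [e] asks for its normalisation at the far end only on
    edges with prescribed nonzero data. *)
Lemma far_condition_solution z (e de : gfun R m) (a c d : 'cV[Cx R]_m) :
  (forall k, solves (pot X k) (lo X k) (hi X k) z (e k) (de k)) ->
  (forall k, d k 0 * (gam k * (cplx (q k) * e k (hi X k) - cplx (p k) * de k (hi X k))) =
     d k 0) ->
  charmx X u du z *m c + charmx X (fun k x _ => e k x) (fun k x _ => de k x) z *m d = a ->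
  bvp X z a d (fun k x => c k 0 * u k x z + d k 0 * e k x)
              (fun k x => c k 0 * du k x z + d k 0 * de k x).
Proof.
move=> S far E.
have [r1 r2] := @regular_of_solves _ _ X z (fun k x => c k 0 * u k x z + d k 0 * e k x)
  (fun k x => c k 0 * du k x z + d k 0 * de k x)
  (fun k => solves_lin (c k 0) (d k 0) (es_solves (od_u D k) z) (S k)).
split=> //; split.
  rewrite -E 2!charmx_mul addrACA -2!mulmxDr.
  by congr (al1 X *m _ + al2 X *m _); apply/matrixP => k y; rewrite !mxE.
apply: (@far_condition _ _ _ _ _ _ _ _ D (fun k x => c k 0 * u k x z + d k 0 * e k x)
  (fun k x => c k 0 * du k x z + d k 0 * de k x)) => k; rewrite -[RHS]far.
by rewrite (es_base (od_u D k)) (es_dbase (od_u D k)); ring.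
Qed.

End InhomogeneousConditions.

(** Factoring out [A] leaves [invmx A *m H] scaled by a, plus the diagonal b. Outside the range of
    [f] its columns are those of the identity, so [det_replace_cols] applies. *)
Lemma det_cut_cols (K : fieldType) m r (f : 'I_r -> 'I_m) (A0 A H : 'M[K]_m)
    (a b : 'I_m -> K) : injective f -> A \in unitmx ->
  (forall i k, A0 i k = A i k * b k + H i k * a k) ->
  (forall l, (forall k, l != f k) -> a l = 0 /\ b l = 1) ->
  \det A0 = \det A * \det (\matrix_(x, y)
    ((invmx A *m H) (f x) (f y) * a (f y) + (x == y)%:R * b (f y))).
Proof.
move=> fI Au AE ab.
have -> : A0 = A *m \matrix_(i, k) ((invmx A *m H) i k * a k + (i == k)%:R * b k).
  apply/matrixP => i k; rewrite AE !mxE.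
  under eq_bigr do rewrite mxE mulrDr !mulrA.
  rewrite big_split/= -!mulr_suml addrC; congr (_ * _ + _ * _).
    rewrite (bigD1 k)//= eqxx mulr1 big1 ?addr0// => y /negPf yk.
    by rewrite yk mulr0.
  have := congr1 (fun M : 'M[K]_m => M i k) (mulKVmx Au H); rewrite /= mxE => <-.
  by apply: eq_bigr => y _.
rewrite det_mulmx; congr (_ * _).
rewrite (@det_replace_cols _ _ _ f _
  (fun k => \col_i ((invmx A *m H) i (f k) * a (f k) + (i == f k)%:R * b (f k))))//.
- by congr (\det _); apply/matrixP => x y; rewrite !mxE (inj_eq fI).
- by move=> k i; rewrite !mxE.
- by move=> l i /ab[a0 b1]; rewrite mxE a0 b1 mulr0 add0r mulr1.
Qed.

(** * Cutting the star: determinants and response at the cuts *)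

Section Split.
Context {R : realType} {n : nat}.
Notation C := (Cx R).
Notation mu := (@lebesgue_measure R).
Variables (l : 'I_n -> R) (V : 'I_n -> R -> R) (alpha1 alpha2 : 'M[C]_n).
Variables (g h : 'rV[C]_n) (i j : 'I_n) (s1 s2 : R).
Variables (p q : 'I_n -> R) (gam : 'I_n -> C) (psi dpsi u3 du3 : 'I_n -> R -> C -> C).
Hypothesis D0 : op_data (star_op l V alpha1 alpha2 g h) p q gam psi dpsi.

Lemma interval_charmx k a b (c d : C) (u du : 'I_1 -> R -> C -> C) z :
  charmx (interval_op V k a b c d) u du z = (u 0 a z)%:M.
Proof.
by apply/matrixP => x y; rewrite !ord1 !mxE ?eqxx /= mul1r mul0r addr0.
Qed.

Lemma interval_chardet k a b (c d : C) (u du : 'I_1 -> R -> C -> C) z :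
  chardet (interval_op V k a b c d) u du z = u 0 a z.
Proof. by rewrite /chardet interval_charmx det_scalar1. Qed.

Lemma interval_op_data k a b (c : C) r s : a < b ->
  mu.-integrable (edge a b) (EFin \o V k) -> c != 0 -> (r != 0) || (s != 0) ->
  exists u du, op_data (interval_op V k a b (c * cplx s) (- (c * cplx r)))
    (fun=> r) (fun=> s) (fun=> c) u du.
Proof.
move=> ab iV c0 rs; have [u [du H]] := edge_solution_exists ab iV rs.
exists (fun=> u), (fun=> du); split=> //=.
- split; last by rewrite trmx0 map_mx0 mulmx0 mul0mx.
  by rewrite rank_row_mx0 mxrank1.
- by apply/matrixP => x y; rewrite !ord1 !mxE.
- by apply/matrixP => x y; rewrite !ord1 !mxE.
Qed.

(** The quotient u' / u at [a] is the Dirichlet-to-Neumann map of the interval. *)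
Lemma interval_near k a b (c d : C) r s e (u du : 'I_1 -> R -> C -> C) z :
  op_data (interval_op V k a b c d) r s e u du -> u 0 a z != 0 ->
  forall f, exists w dw, bvp (interval_op V k a b c d) z f%:M 0 w dw /\
    dw 0 a = du 0 a z / u 0 a z * f.
Proof.
move=> D u0 f.
have E : charmx (interval_op V k a b c d) u du z *m (f / u 0 a z)%:M = f%:M.
  by rewrite interval_charmx -scalar_mxM mulrC divfK.
exists (fun k x => (f / u 0 a z)%:M k 0 * u k x z).
exists (fun k x => (f / u 0 a z)%:M k 0 * du k x z).
split; first exact: (charmx_solution D E).
by rewrite mxE eqxx mulr1n; ring.
Qed.

(** Both solutions have the data (p, q) at [l k], so the determinant of the piece beyond the cut is
    [psi] at the cut. *)
Lemma interval_agrees k a (c d : C) e (u du : 'I_1 -> R -> C -> C) z : 0 <= a ->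
  op_data (interval_op V k a (l k) c d) (fun=> p k) (fun=> q k) e u du ->
  u 0 a z = psi k a z /\ du 0 a z = dpsi k a z.
Proof.
move=> a0 D; have al := od_lt D 0; rewrite /= in al.
have S := od_u D 0; have S0 := od_u D0 k; rewrite /= in S S0.
apply: (solves_unique (od_pot D 0) (es_solves S z)
  (solves_sub a0 (lexx _) (es_solves S0 z))).
- by rewrite (es_base S) (es_base S0).
- by rewrite (es_dbase S) (es_dbase S0).
- by rewrite /= lexx ltW.
Qed.

Let hi3 k := if k == i then s2 else if k == j then s1 else l k.
Let cut k := (k == i) || (k == j).
Let X3 := tOmega2_op l V alpha1 alpha2 g h i j s1 s2.
Hypothesis D3 : op_data X3 (fun k => if cut k then 0 else p k)
  (fun k => if cut k then 1 else q k) (fun k => if cut k then 1 else gam k) u3 du3.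
Hypothesis u3E : forall k, ~~ cut k -> u3 k = psi k /\ du3 k = dpsi k.
Hypothesis hi3_le : forall k, hi3 k <= l k.

(* At the cut, (e_k, e_k') = (1, 0) and (u3_k, u3_k') = (0, 1). *)
Variables (z : C) (e de : gfun R n).
Hypothesis eS : forall k, solves (V k) 0 (hi3 k) z (e k) (de k).
Hypothesis e1 : forall k, e k (hi3 k) = 1.
Hypothesis de0 : forall k, de k (hi3 k) = 0.

Let H := charmx X3 (fun k x _ => e k x) (fun k x _ => de k x) z.
Let B := invmx (charmx X3 u3 du3 z) *m H.

Lemma cut_expand k x : cut k -> 0 <= x <= hi3 k ->
  psi k x z = psi k (hi3 k) z * e k x + dpsi k (hi3 k) z * u3 k x z /\
  dpsi k x z = psi k (hi3 k) z * de k x + dpsi k (hi3 k) z * du3 k x z.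
Proof.
move=> ck; have S3 := od_u D3 k; have S0 := od_u D0 k; rewrite /= ck in S3 S0.
have b3 := es_base S3 z; have d3 := es_dbase S3 z.
apply: (solves_unique (od_pot D3 k) (solves_sub (lexx _) (hi3_le k) (es_solves S0 z))
  (solves_lin (psi k (hi3 k) z) (dpsi k (hi3 k) z) (eS k) (es_solves S3 z))).
- by rewrite /= e1 b3 cplx0 mulr0 addr0 mulr1.
- by rewrite /= de0 d3 cplx1 mulr0 add0r mulr1.
Qed.

(** By [cut_expand] at 0, a cut column of the star's matrix is dpsi times the column of tOmega2 plus
    psi times that of [H], both factors taken at the cut; the other columns coincide. *)
Lemma chardet_cut r (f : 'I_r -> 'I_n) : injective f -> (forall a, cut (f a)) ->
  (forall k, cut k -> exists a, k = f a) -> chardet X3 u3 du3 z != 0 ->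
  chardet (star_op l V alpha1 alpha2 g h) psi dpsi z =
  chardet X3 u3 du3 z * \det (\matrix_(x, y)
    (B (f x) (f y) * psi (f y) (hi3 (f y)) z +
     (x == y)%:R * dpsi (f y) (hi3 (f y)) z)).
Proof.
move=> fI fcut cutf d3.
pose a k := if cut k then psi k (hi3 k) z else 0.
pose b k := if cut k then dpsi k (hi3 k) z else 1.
have A3u : charmx X3 u3 du3 z \in unitmx by rewrite unitmxE unitfE.
have AE y k : charmx (star_op l V alpha1 alpha2 g h) psi dpsi z y k =
    charmx X3 u3 du3 z y k * b k + H y k * a k.
  rewrite !mxE /a /b /=; have [ck|nk] := boolP (cut k).
    have h0 : (0 : R) <= 0 <= hi3 k by rewrite lexx ltW//; exact: (od_lt D3 k).
    by have [-> ->] := cut_expand ck h0; ring.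
  by have [-> ->] := u3E nk; ring.
have ab y : (forall x, y != f x) -> a y = 0 /\ b y = 1.
  move=> yf; rewrite /a /b; case: ifP => // /cutf[x xy].
  by have := yf x; rewrite xy eqxx.
rewrite /chardet (det_cut_cols fI A3u AE ab).
by congr (_ * \det _); apply/matrixP => x y; rewrite !mxE /a /b fcut.
Qed.

(** [- B] is the Dirichlet-to-Neumann map at the cuts: the coefficients - B d cancel the near data
    of d e, and at a cut u3' = 1 while e' = 0. *)
Lemma cut_response (d : 'cV[C]_n) : chardet X3 u3 du3 z != 0 ->
  (forall k, ~~ cut k -> d k 0 = 0) ->
  exists w dw, bvp X3 z 0 d w dw /\ forall k, cut k -> dw k (hi3 k) = - (B *m d) k 0.
Proof.
move=> d3 dcut; pose c := - (B *m d).
exists (fun k x => c k 0 * u3 k x z + d k 0 * e k x).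
exists (fun k x => c k 0 * du3 k x z + d k 0 * de k x); split.
  apply: (far_condition_solution D3); first exact: eS.
    move=> k; rewrite /=; have [ck|/dcut ->] := boolP (cut k); last by rewrite mul0r.
    by rewrite e1 de0 cplx0 cplx1 mul0r subr0 !mulr1.
  by rewrite /c mulmxN mulmxA mulKVmx ?addNr// unitmxE unitfE.
move=> k ck; have S3 := od_u D3 k; rewrite /= ck in S3.
by have b3 := es_dbase S3 z; rewrite b3 cplx1 de0 mulr0 mulr1 addr0 /c mxE.
Qed.

End Split.

(** * The two-sided maps on one wire and on two wires *)

Section TwoSidedMaps.
Context {R : realType} {n : nat}.
Notation C := (Cx R).
Notation mu := (@lebesgue_measure R).
Variables (l : 'I_n -> R) (V : 'I_n -> R -> R) (alpha1 alpha2 : 'M[C]_n).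
Variables (g h : 'rV[C]_n) (p q : 'I_n -> R) (gam : 'I_n -> C).
Variables (psi dpsi u3 du3 : 'I_n -> R -> C -> C).
Hypothesis D0 : op_data (star_op l V alpha1 alpha2 g h) p q gam psi dpsi.

(** The star's determinant is cut at s2 only, hence r = 1; the cut at s1 enters by expanding psi
    between s2 and s1 in the solutions with data (1, 0) and (0, 1) at s1. *)
Lemma two_sided_same (i : 'I_n) (s1 s2 : R) (e1 : 'I_1 -> C) (u1 du1 u2 du2 : 'I_1 -> R -> C -> C) z :
  let X1 := interval_op V i s1 (l i) (g 0 i) (h 0 i) in
  let X2 := interval_op V i s2 s1 1 0 in
  let X3 := tOmega2_op l V alpha1 alpha2 g h i i s1 s2 in
  let cut k := (k == i) || (k == i) in
  0 < s1 < l i -> 0 < s2 < s1 ->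
  op_data X1 (fun=> p i) (fun=> q i) e1 u1 du1 ->
  op_data X2 (fun=> 0) (fun=> 1) (fun=> 1) u2 du2 ->
  op_data X3 (fun k => if cut k then 0 else p k)
    (fun k => if cut k then 1 else q k) (fun k => if cut k then 1 else gam k) u3 du3 ->
  (forall k, ~~ cut k -> u3 k = psi k /\ du3 k = dpsi k) ->
  chardet X1 u1 du1 z != 0 -> chardet X2 u2 du2 z != 0 -> chardet X3 u3 du3 z != 0 ->
  exists M1 M2 : 'M[C]_2,
  [/\ M1_same l V g h i i s1 s2 z M1, M2_same l V alpha1 alpha2 g h i i s1 s2 z M2 &
    quotient (chardet (star_op l V alpha1 alpha2 g h) psi dpsi) (chardet X1 u1 du1)
      (chardet X2 u2 du2) (chardet X3 u3 du3) z = \det (M1 + M2)].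
Proof.
move=> X1 X2 X3 cut /andP[s1_gt0 s1l] /andP[s2_gt0 s21] D1 D2 D3 u3E.
rewrite !interval_chardet => n1 n2 n3.
have hi3_le k : (if k == i then s2 else if k == i then s1 else l k) <= l k.
  by case: eqP => // ->; rewrite ltW// (lt_trans s21).
have /choice[e /choice[de eP]] : forall k, exists e de,
    [/\ solves (V k) 0 (if k == i then s2 else if k == i then s1 else l k) z e de,
        e (if k == i then s2 else if k == i then s1 else l k) = cplx 1 &
        de (if k == i then s2 else if k == i then s1 else l k) = cplx 0].
  by move=> k; exact: (solves_exists _ 1 0 z (od_pot D3 k)).
have eS k : solves (V k) 0 (if k == i then s2 else if k == i then s1 else l k) z (e k) (de k).
  by have [] := eP k.
have eb k : e k (if k == i then s2 else if k == i then s1 else l k) = 1.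
  by have [_ -> _] := eP k; exact: cplx1.
have deb k : de k (if k == i then s2 else if k == i then s1 else l k) = 0.
  by have [_ _ ->] := eP k; exact: cplx0.
set B := invmx (charmx X3 u3 du3 z) *m
  charmx X3 (fun k x _ => e k x) (fun k x _ => de k x) z.
have cutD := @chardet_cut _ _ _ _ _ _ _ _ _ _ _ _ _ _ _ _ _ _ _ D0 D3 u3E hi3_le z e de
  eS eb deb 1 (fun=> i).
have {cutD}E0 : chardet (star_op l V alpha1 alpha2 g h) psi dpsi z =
    chardet X3 u3 du3 z * (B i i * psi i s2 z + dpsi i s2 z).
  rewrite cutD//; first by rewrite det_mx11 !mxE eqxx mul1r.
  - by move=> x y _; rewrite !ord1.
  - by move=> _; rewrite orbb eqxx.
  - by move=> k; rewrite orbb => /eqP ->; exists 0.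
have [a1 a2] := interval_agrees D0 z (ltW s1_gt0) D1.
have S2 := od_u D2 0; rewrite /= in S2.
have [th [dth [thS th1 dth1]]] := solves_exists s1 1 0 z (od_pot D2 0).
rewrite /= cplx1 in thS th1; rewrite cplx0 in dth1.
have b2 := es_base S2 z; have d2 := es_dbase S2 z; rewrite cplx0 in b2; rewrite cplx1 in d2.
have W := solves_wronskian (ltW s21) thS (es_solves S2 z).
rewrite b2 d2 th1 dth1 mulr1 mulr0 subr0 in W.
have PS : solves (V i) s2 s1 z (psi i ^~ z) (dpsi i ^~ z).
  exact: (solves_sub (ltW s2_gt0) (ltW s1l) (es_solves (od_u D0 i) z)).
have [] := solves_unique (od_pot D2 0) PS
  (solves_lin (psi i s1 z) (dpsi i s1 z) thS (es_solves S2 z)) _ _ (x := s2).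
- by rewrite /= th1 b2 mulr1 mulr0 addr0.
- by rewrite /= dth1 d2 mulr1 mulr0 add0r.
- by rewrite /= lexx ltW.
rewrite -a1 -a2 => c1 c2.
have dthE : dth s2 = (th s2 * du2 0 s2 z - 1) / u2 0 s2 z.
  by apply: (mulIf n2); rewrite divfK// -W; ring.
(* Dirichlet-to-Neumann matrix of the middle interval; both off-diagonal entries are 1 / u2(s2)
   because the Wronskian of [th] and [u2] is 1. *)
pose M1 := mx2 (- th s2 / u2 0 s2 z) (1 / u2 0 s2 z) (1 / u2 0 s2 z) (- du2 0 s2 z / u2 0 s2 z).
pose M2 := mx2 (- du1 0 s1 z / u1 0 s1 z) 0 0 (- B i i).
exists M1, M2; split.
- move=> f1 f2; rewrite /tOmega1_op eqxx.
  pose c := (f2 - f1 * th s2) / u2 0 s2 z.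
  exists (fun k x => c%:M k 0 * u2 k x z + f1%:M k 0 * th x).
  exists (fun k x => c%:M k 0 * du2 k x z + f1%:M k 0 * dth x); split.
    apply: (far_condition_solution D2 (fun=> thS)).
      by move=> k; rewrite /= th1 dth1 cplx0 cplx1 mul0r subr0 !mulr1.
    rewrite !interval_charmx -!scalar_mxM -raddfD/=; congr (_%:M).
    by rewrite mulrC divfK// [th s2 * _]mulrC subrK.
  rewrite mx2_vec2 !mxE eqxx !mulr1n d2 dth1 dthE; congr vec2; rewrite /c; field; exact: n2.
- move=> f1 f2; have [u [du [bu uE]]] := interval_near D1 n1 f1.
  have [k|w [dw [bw wE]]] := cut_response (d := f2 *: delta_mx i 0) D3 eS eb deb n3.
    by rewrite orbb !mxE => /negPf ->; rewrite mulr0.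
  exists u, du, w, dw; split=> //.
  have := wE i; rewrite eqxx => /(_ isT) => ->.
  rewrite mx2_vec2 uE -scalemxAr -colE !mxE; congr vec2; ring.
rewrite /quotient !interval_chardet E0 det_mx2 !mxE /= c1 c2 dthE.
field; rewrite n1 n2 n3//.
Qed.

(** M1 + M2 is minus the matrix B + diag (u' / u) on the two cut edges; in size 2 the sign does not
    affect the determinant. *)
Lemma two_sided_diff (i j : 'I_n) (s1 s2 : R) (e1 e2 : 'I_1 -> C)
    (u1 du1 u2 du2 : 'I_1 -> R -> C -> C) z :
  let X1 := interval_op V j s1 (l j) (g 0 j) (h 0 j) in
  let X2 := interval_op V i s2 (l i) (g 0 i) (h 0 i) in
  let X3 := tOmega2_op l V alpha1 alpha2 g h i j s1 s2 in
  let cut k := (k == i) || (k == j) in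
  i != j -> 0 < s1 < l j -> 0 < s2 < l i ->
  op_data X1 (fun=> p j) (fun=> q j) e1 u1 du1 ->
  op_data X2 (fun=> p i) (fun=> q i) e2 u2 du2 ->
  op_data X3 (fun k => if cut k then 0 else p k)
    (fun k => if cut k then 1 else q k) (fun k => if cut k then 1 else gam k) u3 du3 ->
  (forall k, ~~ cut k -> u3 k = psi k /\ du3 k = dpsi k) ->
  chardet X1 u1 du1 z != 0 -> chardet X2 u2 du2 z != 0 -> chardet X3 u3 du3 z != 0 ->
  exists M1 M2 : 'M[C]_2,
  [/\ M1_diff l V g h i j s1 s2 z M1, M2_diff l V alpha1 alpha2 g h i j s1 s2 z M2 &
    quotient (chardet (star_op l V alpha1 alpha2 g h) psi dpsi) (chardet X1 u1 du1)
      (chardet X2 u2 du2) (chardet X3 u3 du3) z = \det (M1 + M2)].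
Proof.
move=> X1 X2 X3 cut ij /andP[s1_gt0 s1l] /andP[s2_gt0 s2l] D1 D2 D3 u3E.
rewrite !interval_chardet => n1 n2 n3.
have hi3_le k : (if k == i then s2 else if k == j then s1 else l k) <= l k.
  by case: eqP => [->|_]; [rewrite ltW|case: eqP => // ->; rewrite ltW].
have /choice[e /choice[de eP]] : forall k, exists e de,
    [/\ solves (V k) 0 (if k == i then s2 else if k == j then s1 else l k) z e de,
        e (if k == i then s2 else if k == j then s1 else l k) = cplx 1 &
        de (if k == i then s2 else if k == j then s1 else l k) = cplx 0].
  by move=> k; exact: (solves_exists _ 1 0 z (od_pot D3 k)).
have eS k : solves (V k) 0 (if k == i then s2 else if k == j then s1 else l k) z (e k) (de k).
  by have [] := eP k.
have eb k : e k (if k == i then s2 else if k == j then s1 else l k) = 1.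
  by have [_ -> _] := eP k; exact: cplx1.
have deb k : de k (if k == i then s2 else if k == j then s1 else l k) = 0.
  by have [_ _ ->] := eP k; exact: cplx0.
have ji : (j == i) = false by rewrite eq_sym (negPf ij).
set B := invmx (charmx X3 u3 du3 z) *m
  charmx X3 (fun k x _ => e k x) (fun k x _ => de k x) z.
(* Edge j precedes edge i, in the order of the entries of [vec2 f1 f2]. *)
have cutD := @chardet_cut _ _ _ _ _ _ _ _ _ _ _ _ _ _ _ _ _ _ _ D0 D3 u3E hi3_le z e de
  eS eb deb 2 (fun a => if a == 0 then j else i).
have {cutD}E0 : chardet (star_op l V alpha1 alpha2 g h) psi dpsi z =
    chardet X3 u3 du3 z * ((B j j * psi j s1 z + dpsi j s1 z) * (B i i * psi i s2 z + dpsi i s2 z) -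
      B j i * psi i s2 z * (B i j * psi j s1 z)).
  rewrite cutD//.
  - by rewrite det_mx2 !mxE /= ji !eqxx !mul1r !mul0r !addr0.
  - move=> x y; case: (eqVneq x 0) => x0; case: (eqVneq y 0) => y0 //; rewrite ?x0 ?y0 //.
    + by move=> E; move: ij; rewrite E eqxx.
    + by move=> E; move: ij; rewrite E eqxx.
    + by move=> _; apply: val_inj; move: x0 y0; case: x y => [[|[|//]] ?] [[|[|//]] ?].
  - by move=> a; rewrite /cut; case: (a == 0); rewrite eqxx ?orbT.
  - by move=> k /orP[/eqP ->|/eqP ->]; [exists 1|exists 0].
have [a1 a2] := interval_agrees D0 z (ltW s1_gt0) D1.
have [a3 a4] := interval_agrees D0 z (ltW s2_gt0) D2.
pose M1 := mx2 (- du1 0 s1 z / u1 0 s1 z) 0 0 (- du2 0 s2 z / u2 0 s2 z).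
pose M2 := mx2 (- B j j) (- B j i) (- B i j) (- B i i).
exists M1, M2; split.
- move=> f1 f2; have [u [du [bu uE]]] := interval_near D1 n1 f1.
  have [w [dw [bw wE]]] := interval_near D2 n2 f2.
  exists u, du, w, dw; rewrite /tOmega1_op (negPf ij); split=> //.
  by rewrite mx2_vec2 uE wE; congr vec2; ring.
- move=> f1 f2.
  have [k|w [dw [bw wE]]] := cut_response (d := f1 *: delta_mx j 0 + f2 *: delta_mx i 0)
      D3 eS eb deb n3.
    by rewrite negb_or !mxE => /andP[/negPf -> /negPf ->]; rewrite !mulr0 addr0.
  exists w, dw; split=> //.
  have := wE i; rewrite eqxx => /(_ isT) ->.
  have := wE j; rewrite ji eqxx => /(_ isT) ->.
  by rewrite mx2_vec2 mulmxDr -!scalemxAr -!colE !mxE; congr vec2; ring.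
rewrite /quotient !interval_chardet E0 det_mx2 !mxE /= -a1 -a2 -a3 -a4.
field; rewrite n1 n2 n3//.
Qed.

End TwoSidedMaps.

Theorem theorem1p11 (R : realType) (n : nat)
    (l : 'I_n -> R) (hl : forall k, 0 < l k)
    (V : 'I_n -> R -> R)
    (hV : forall k, (@lebesgue_measure R).-integrable
                      [set x | 0 <= x <= l k] (EFin \o V k))
    (alpha1 alpha2 : 'M[Cx R]_n) (g h : 'rV[Cx R]_n)
    (halpha : selfadjoint_bc alpha1 alpha2)
    (hbeta : selfadjoint_bc (diag_mx g) (diag_mx h))
    (i j : 'I_n) (s1 s2 : R)
    (hs1 : 0 < s1 < l j)
    (hs2 : 0 < s2 < (if i == j then s1 else l i))
    (lam : R) :
  exists (F : Cx R -> Cx R) (N N1 N2 N3 : nat) (Nz : int),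
    two_sided_det l V alpha1 alpha2 g h i j s1 s2 F /\
    [/\ eigen_count (star_op l V alpha1 alpha2 g h) lam N,
        eigen_count (Omega1_op l V g h j s1) lam N1,
        eigen_count (tOmega1_op l V g h i j s1 s2) lam N2,
        eigen_count (tOmega2_op l V alpha1 alpha2 g h i j s1 s2) lam N3 &
        zero_pole_count F lam Nz] /\
    N%:Z = N1%:Z + N2%:Z + N3%:Z + Nz.
Proof.
have /choice[gam /choice[p /choice[q far]]] := separated_far hbeta.
have gam0 k : gam k != 0 by have [] := far k.
have pq k : (p k != 0) || (q k != 0) by have [] := far k.
have gE k : g 0 k = gam k * cplx (q k) by have [] := far k.
have hE k : h 0 k = - (gam k * cplx (p k)) by have [] := far k.
have iV k a b : 0 <= a -> b <= l k ->
    (@lebesgue_measure R).-integrable (edge a b) (EFin \o V k).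
  move=> a0 bl; apply: integrableS (hV k).
  - exact: (measurable_edge 0 (l k)).
  - exact: measurable_edge.
  - by move=> x /andP[ax xb] /=; rewrite (le_trans a0 ax) (le_trans xb bl).
have /andP[s1_gt0 s1l] := hs1.
pose hi3 k := if k == i then s2 else if k == j then s1 else l k.
pose cut k := (k == i) || (k == j).
have hi3_itv k : 0 < hi3 k <= l k.
  rewrite /hi3; case: eqP => [->|_].
    case: eqP hs2 => [->|_] /andP[-> s2l] /=; last exact: ltW.
    by rewrite ltW// (lt_trans s2l).
  by case: eqP => [->|_]; [rewrite s1_gt0 ltW|rewrite hl lexx].
have /choice[psi /choice[dpsi psiP]] : forall k, exists u du,
    edge_solution (V k) 0 (l k) (p k) (q k) u du.
  by move=> k; apply: edge_solution_exists; [exact: hl|exact: iV|exact: pq].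
have D0 : op_data (star_op l V alpha1 alpha2 g h) p q gam psi dpsi.
  split=> //=.
  - by apply: (congr1 (@diag_mx _ n)); apply/rowP => k; rewrite mxE gE.
  - by apply: (congr1 (@diag_mx _ n)); apply/rowP => k; rewrite mxE hE.
(* On an uncut edge [psi] itself is taken, so that the star and tOmega2 share this column
   exactly. *)
have /choice[u3 /choice[du3 u3P]] : forall k, exists u du,
    edge_solution (V k) 0 (hi3 k) (if cut k then 0 else p k) (if cut k then 1 else q k) u du /\
    (~~ cut k -> u = psi k /\ du = dpsi k).
  move=> k; have [ck|nk] := boolP (cut k).
    have /andP[h0 hk] := hi3_itv k.
    have [|u [du H]] := edge_solution_exists (p := 0) (q := 1) h0 (iV k 0 _ (lexx 0) hk).
      by rewrite oner_eq0 orbT.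
    by exists u, du; split.
  exists (psi k), (dpsi k); split=> //.
  by move: nk; rewrite /hi3 negb_or => /andP[/negPf -> /negPf ->]; exact: psiP.
have D3 : op_data (tOmega2_op l V alpha1 alpha2 g h i j s1 s2)
    (fun k => if cut k then 0 else p k) (fun k => if cut k then 1 else q k)
    (fun k => if cut k then 1 else gam k) u3 du3.
  split=> //=.
  - by move=> k; have /andP[] := hi3_itv k.
  - by move=> k; apply: iV => //; have /andP[] := hi3_itv k.
  - by move=> k; case: ifP => // _; exact: oner_neq0.
  - by move=> k; case: ifP => // _; rewrite oner_eq0 orbT.
  - apply: (congr1 (@diag_mx _ n)); apply/rowP => k; rewrite !mxE -/(cut k).
    by case: ifP => _; rewrite ?cplx1 ?mulr1.
  - apply: (congr1 (@diag_mx _ n)); apply/rowP => k; rewrite !mxE -/(cut k).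
    by case: ifP => _; rewrite ?cplx0 ?mulr0 ?oppr0.
  - by move=> k; have [] := u3P k.
have u3E k : ~~ cut k -> u3 k = psi k /\ du3 k = dpsi k by have [] := u3P k.
have [u1 [du1 D1]] := interval_op_data s1l (iV j _ _ (ltW s1_gt0) (lexx _)) (gam0 j) (pq j).
rewrite -gE -hE in D1.
(* The two positions of the cuts differ only in tOmega1 and in the maps; one existential statement
   covers both. *)
have [p2 [q2 [gam2 [u2 [du2 [D2 maps]]]]]] : exists p2 q2 gam2 u2 du2,
    op_data (tOmega1_op l V g h i j s1 s2) p2 q2 gam2 u2 du2 /\
    forall z, chardet (Omega1_op l V g h j s1) u1 du1 z != 0 ->
      chardet (tOmega1_op l V g h i j s1 s2) u2 du2 z != 0 ->
      chardet (tOmega2_op l V alpha1 alpha2 g h i j s1 s2) u3 du3 z != 0 ->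
      exists M1 M2 : 'M[Cx R]_2,
      [/\ is_M1 l V g h i j s1 s2 z M1, is_M2 l V alpha1 alpha2 g h i j s1 s2 z M2 &
        quotient (chardet (star_op l V alpha1 alpha2 g h) psi dpsi)
          (chardet (Omega1_op l V g h j s1) u1 du1)
          (chardet (tOmega1_op l V g h i j s1 s2) u2 du2)
          (chardet (tOmega2_op l V alpha1 alpha2 g h i j s1 s2) u3 du3) z =
        \det (M1 + M2)].
  rewrite /tOmega1_op /is_M1 /is_M2.
  have [ij|ij] := eqVneq i j.
    have {}hs2 : 0 < s2 < s1 by move: hs2; rewrite ij eqxx.
    have /andP[s2_gt0 s21] := hs2; subst j.
    have [|u2 [du2 D2]] := @interval_op_data R n V i s2 s1 1 0 1 s21
      (iV i _ _ (ltW s2_gt0) (ltW s1l)) (oner_neq0 _); first by rewrite oner_eq0 orbT.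
    rewrite cplx0 cplx1 mulr1 mulr0 oppr0 in D2.
    exists (fun=> 0), (fun=> 1), (fun=> 1), u2, du2; split=> // z n1 n2 n3.
    exact: (two_sided_same D0 hs1 hs2 D1 D2 D3 u3E n1 n2 n3).
  have {}hs2 : 0 < s2 < l i by move: hs2; rewrite (negPf ij).
  have /andP[s2_gt0 s2l] := hs2.
  have [u2 [du2 D2]] :=
    interval_op_data s2l (iV i _ _ (ltW s2_gt0) (lexx _)) (gam0 i) (pq i).
  rewrite -gE -hE in D2.
  exists (fun=> p i), (fun=> q i), (fun=> gam i), u2, du2; split=> // z n1 n2 n3.
  exact: (two_sided_diff D0 ij hs1 hs2 D1 D2 D3 u3E n1 n2 n3).
have [mero [N [N1 [N2 [N3 [Nz [counts E]]]]]]] := count_split D0 D1 D2 D3 lam.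
eexists; exists N, N1, N2, N3, Nz; split; last by split; [exact: counts|exact: E].
split; first exact: mero.
(* At common resolvent points the three determinants in the denominator are nonzero, so the quotient
   has its true value there. *)
move=> z r1 r2 r3; apply: maps.
- exact: (resolvent_chardet D1 r1).
- exact: (resolvent_chardet D2 r2).
- exact: (resolvent_chardet D3 r3).
Qed.
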